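(* For every $\alpha_0>0$ there are constants $C,K>0$ (depending only on $\alpha_0$) such that the following holds. Fix $A\in\mathbb{R}^{n\times d}$ and a positive semidefinite $C_0\in\mathbb{R}^{d\times d}$ such that $H=A^\top A+C_0$ is invertible, and let $U=AH^{-1/2}$, $d_{\mathrm{eff}}=\mathrm{tr}(U^\top U)$, $\tilde d_{\mathrm{eff}}=\mathrm{tr}((U^\top U)^2)$. Let $m$ be a positive integer divisible by $3$ with $m\ge C d_{\mathrm{eff}}$ and $m>d_{\mathrm{eff}}$, and let $S$ be a random $m\times n$ matrix consisting of $m$ i.i.d. rows distributed as $\frac1{\sqrt{m-d_{\mathrm{eff}}}}s^\top$, where $s$ is a random vector in $\mathbb{R}^n$ with $\mathbb{E}[ss^\top]=I_n$. Let $\eta\le 1/2$ and $\delta\le 1/m^3$. Suppose that: (i) the matrix $\tilde S$ consisting of the first $m/3$ rows of $S$ scaled by $\sqrt3$ satisfies $\|U^\top\tilde S^\top\tilde SU-U^\top U\|\le\eta$ with probability at least $1-\delta/3$; (ii) for some $\alpha\le\alpha_0$, $\mathrm{Var}[s^\top UBU^\top s]\le\alpha\,\mathrm{tr}(UB^2U^\top)$ for all positive semidefinite $d\times d$ matrices $B$. Then there is an event $\mathcal{E}$ with probability at least $1-\delta$ such that, conditioned on $\mathcal{E}$, the matrix $Q=H^{1/2}(A^\top S^\top SA+C_0)^{-1}H^{1/2}$ (is well defined and) satisfies $\|Q-I\|\le K\eta$, and $$\big\|\mathbb{E}[Q\mid\mathcal{E}]-I\big\|\le K\,\frac{\sqrt{d_{\mathrm{eff}}}}{m},\qquad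 \Big\|\mathbb{E}[Q^2\mid\mathcal{E}]-\Big(I+\frac{d_{\mathrm{eff}}}{m-\tilde d_{\mathrm{eff}}}\,U^\top U\Big)\Big\|\le K\,\frac{\sqrt{d_{\mathrm{eff}}}}{m}.$$
   Context: Matrix norms $\|\cdot\|$ are spectral norms. The paper writes $\alpha=O(1)$, $m\ge O(d_{\mathrm{eff}})$ and $O(\cdot)$ error bounds; these are unfolded here as constants. *)

(* Defs.v *)
From HB Require Import structures.
From mathcomp Require Import all_boot all_order all_algebra.
From mathcomp Require Import all_classical all_reals all_analysis.

Set Implicit Arguments.
Unset Strict Implicit.
Unset Printing Implicit Defensive.

Import Order.TTheory GRing.Theory Num.Theory.
Import numFieldNormedType.Exports.

Local Open Scope classical_set_scope.
Local Open Scope ring_scope.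

Definition measure_matrix_display : measure_display -> measure_display.
Proof. exact. Qed.

(* Matrices carry the product sigma-algebra, generated by the coordinate maps
   (for real entries: the Borel sigma-algebra of R^(m x n)), as the library
   does for tuples. *)
Section measurable_matrix.
Context {d : measure_display} {T : sigmaRingType d}.
Variables m n : nat.

Definition matrix_cylinders : set (set 'M[T]_(m, n)) :=
  [set D | exists i j, exists2 B : set T, measurable B &
           D = [set M : 'M[T]_(m, n) | B (M i j)]].

Let matrix_set0 : <<s matrix_cylinders >> set0.
Proof. exact: sigma_algebra0. Qed.

Let matrix_setC D : <<s matrix_cylinders >> D -> <<s matrix_cylinders >> (~` D).
Proof. exact: sigma_algebraC. Qed.

Let matrix_bigcup (F : (set 'M[T]_(m, n))^nat) :
  (forall i, <<s matrix_cylinders >> (F i)) ->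
  <<s matrix_cylinders >> (\bigcup_i F i).
Proof. exact: sigma_algebra_bigcup. Qed.

HB.instance Definition _ := @isMeasurable.Build (measure_matrix_display d)
  'M[T]_(m, n) <<s matrix_cylinders >> matrix_set0 matrix_setC matrix_bigcup.

End measurable_matrix.

Section linear_algebra.
Variable R : realType.

Definition enorm n (x : 'cV[R]_n) : R := Num.sqrt (\sum_i x i 0 ^+ 2).

(* The library's norm `|M| on matrices is the entrywise maximum, hence this
   separate definition. *)
Definition specnorm p q (M : 'M[R]_(p, q)) : R :=
  sup [set enorm (M *m x) | x in [set x : 'cV[R]_q | enorm x <= 1]].

Definition psd n (M : 'M[R]_n) : Prop :=
  M^T = M /\ forall x : 'cV[R]_n, 0 <= (x^T *m M *m x) 0 0.

(* For psd M this is the unique psd square root; the default value 0 is taken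
   only when M is not psd. *)
Definition mxsqrt n (M : 'M[R]_n) : 'M[R]_n :=
  xget 0 [set X : 'M[R]_n | psd X /\ X *m X = M].

Section regularized_gram.
Variables (n d : nat) (A : 'M[R]_(n, d)) (C0 : 'M[R]_d).

Definition Hmx : 'M[R]_d := A^T *m A + C0.

Definition Umx : 'M[R]_(n, d) := A *m invmx (mxsqrt Hmx).

Definition deff : R := \tr (Umx^T *m Umx).

Definition deff2 : R := \tr ((Umx^T *m Umx) *m (Umx^T *m Umx)).

Definition sketched_Hmx m (S : 'M[R]_(m, n)) : 'M[R]_d :=
  A^T *m S^T *m S *m A + C0.

(* invmx M is M itself when M is singular, so Qmx is meaningful only where
   sketched_Hmx S is a unit. *)
Definition Qmx m (S : 'M[R]_(m, n)) : 'M[R]_d :=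
  mxsqrt Hmx *m invmx (sketched_Hmx S) *m mxsqrt Hmx.

End regularized_gram.

Definition first_third m n (S : 'M[R]_(m, n)) : 'M[R]_(m %/ 3, n) :=
  rowsub (widen_ord (leq_div m 3)) S.

End linear_algebra.

Section random_matrices.
Variable R : realType.

(* The rows of S are mutually independent (sets equal to setT give every
   subfamily) and each has the law of the row vector v, which may live on
   another probability space. *)
Definition iid_rows {dT dT' : measure_display}
    {T : measurableType dT} {T' : measurableType dT'}
    (P : probability T R) (P' : probability T' R) m n
    (S : T -> 'M[R]_(m, n)) (v : T' -> 'rV[R]_n) : Prop :=
  (forall B : 'I_m -> set 'rV[R]_n, (forall i, measurable (B i)) ->
     P [set w | forall i, B i (row i (S w))] =
     (\prod_(i < m) P [set w | B i (row i (S w))])%E) /\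
  (forall (i : 'I_m) (B : set 'rV[R]_n), measurable B ->
     P [set w | B (row i (S w))] = P' [set w | B (v w)]).

(* E[X | F] = E[X 1_F] / P(F), entrywise, for an event F with P(F) > 0. *)
Definition cond_expmx {dT : measure_display} {T : measurableType dT}
    (P : probability T R) (F : set T) p q (X : T -> 'M[R]_(p, q)) :
    'M[R]_(p, q) :=
  \matrix_(i < p, j < q) ((\int[P]_(w in F) X w i j) / fine (P F)).

Definition integrable_mx {dT : measure_display} {T : measurableType dT}
    (P : probability T R) (F : set T) p q (X : T -> 'M[R]_(p, q)) : Prop :=
  forall i j, P.-integrable F (fun w => (X w i j)%:E).

End random_matrices.

(* Main.v *)
Require Import Defs.
From HB Require Import structures.
From mathcomp Require Import complex spectral.
From mathcomp Require Import all_boot all_order all_algebra fingroup perm.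
From mathcomp Require Import all_classical all_reals all_analysis.
From mathcomp Require Import measurable_realfun ring lra.

Set Implicit Arguments.
Unset Strict Implicit.
Unset Printing Implicit Defensive.

Import Order.TTheory GRing.Theory Num.Theory.
Import numFieldNormedType.Exports.

Local Open Scope classical_set_scope.
Local Open Scope ring_scope.

(* Conjugating by H^(1/2), the matrix Q is the inverse of
   W = (1/N) sum_k x_k x_k^T + I - G, where G = U^T U, N = m - deff and the
   x_k = U^T s_k are i.i.d. with second moment G.  On the event that all three
   thirds of the rows approximate G one has |W - I| <= eta; the weaker event
   that the two thirds avoiding row k do so is independent of x_k and already
   gives |Q_(-k)| <= 3, where Q_(-k) is the inverse of W without row k.  The
   Sherman-Morrison formula
     Q x_k = Q_(-k) x_k / gamma_k,   gamma_k = 1 + x_k^T Q_(-k) x_k / N,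
   reduces both expectations to averages over k of terms in which x_k meets only
   matrices independent of it: redrawing x_k replaces x_k x_k^T by G, at the
   price of the small probability of the conditioning.  The normalization N is
   chosen so that gamma_k is close to m / N, because x_k^T Q_(-k) x_k fluctuates
   around tr (Q_(-k) G), which is close to deff.  This last fact is a second
   moment bound for t = tr ((Q - I) G): Sherman-Morrison writes t as an average
   over k, and the identity so obtained bounds E t^2 by a fraction of itself plus
   O(deff), as soon as m is a large multiple of deff. *)

(** * Operator bounds for the Euclidean norm *)

(** Both means are tested against fixed vectors [v], [w] of norm at most 1, which turns spectral
    norms into scalar bounds. The rate [sqrt deff / m] comes from Cauchy-Schwarz: [gamma_k - m / N]
    has standard deviation [O(sqrt deff) / N], and the linear forms in [x_k] multiplying it have
    bounded fourth moments. The denominator [m - deff2] comes from a second equation. In mean and up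
    to the error, [Q^2 = Q + (deff / m) Q G Q], because [gamma_k] enters squared, while
    [Q G Q = G Q + (deff2 / m) Q G Q], because Sherman-Morrison leaves the form
    [x_k^T Q_(-k) G x_k], which is close to [tr (G^2)]. Eliminating [Q G Q] gives
    [deff / (m - deff2)]. Hence the trace estimate is run twice, with weights [G] and [G^2]. It
    closes on itself for [deff >= 1], where errors [O(1)] are [O(deff)]; for [deff < 1] the sure
    bound [t = O(deff)] is already enough. *)

Section euclidean.
Variable R : realType.

Definition dot n (u v : 'cV[R]_n) : R := (u^T *m v) 0 0.

Lemma dotE n (u v : 'cV[R]_n) : dot u v = \sum_i u i 0 * v i 0.
Proof. by rewrite /dot mxE; apply: eq_bigr => i _; rewrite mxE. Qed.

Lemma dotC n (u v : 'cV[R]_n) : dot u v = dot v u.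
Proof. by rewrite !dotE; apply: eq_bigr => i _; rewrite mulrC. Qed.

Lemma dotDl n (u v w : 'cV[R]_n) : dot (u + v) w = dot u w + dot v w.
Proof. by rewrite /dot linearD mulmxDl mxE. Qed.

Lemma dotZl n a (u w : 'cV[R]_n) : dot (a *: u) w = a * dot u w.
Proof. by rewrite /dot linearZ -scalemxAl mxE. Qed.

Lemma dotDr n (u v w : 'cV[R]_n) : dot w (u + v) = dot w u + dot w v.
Proof. by rewrite dotC dotDl !(dotC w). Qed.

Lemma dotZr n a (u w : 'cV[R]_n) : dot w (a *: u) = a * dot w u.
Proof. by rewrite dotC dotZl dotC. Qed.

Lemma dotNl n (u w : 'cV[R]_n) : dot (- u) w = - dot u w.
Proof. by rewrite -scaleN1r dotZl mulN1r. Qed.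

Lemma dotNr n (u w : 'cV[R]_n) : dot w (- u) = - dot w u.
Proof. by rewrite dotC dotNl dotC. Qed.

Lemma dotBl n (u v w : 'cV[R]_n) : dot (u - v) w = dot u w - dot v w.
Proof. by rewrite dotDl dotNl. Qed.

Lemma dotBr n (u v w : 'cV[R]_n) : dot w (u - v) = dot w u - dot w v.
Proof. by rewrite dotDr dotNr. Qed.

Lemma dot0l n (w : 'cV[R]_n) : dot 0 w = 0.
Proof. by rewrite -(scale0r 0) dotZl mul0r. Qed.

Lemma dot0r n (w : 'cV[R]_n) : dot w 0 = 0.
Proof. by rewrite dotC dot0l. Qed.

Lemma dot_sumr n (I : Type) (r : seq I) (P : pred I) (F : I -> 'cV[R]_n) w :
  dot w (\sum_(i <- r | P i) F i) = \sum_(i <- r | P i) dot w (F i).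
Proof.
elim/big_rec2: _ => [|i y1 y2 _ <-]; first by rewrite dot0r.
by rewrite dotDr.
Qed.

Lemma dot_mul n p (M : 'M[R]_(n, p)) u v : dot u (M *m v) = dot (M^T *m u) v.
Proof. by rewrite /dot trmx_mul trmxK mulmxA. Qed.

Lemma dot_sym n (M : 'M[R]_n) u v : M^T = M -> dot u (M *m v) = dot (M *m u) v.
Proof. by move=> h; rewrite dot_mul h. Qed.

Lemma dot_ge0 n (u : 'cV[R]_n) : 0 <= dot u u.
Proof. by rewrite dotE; apply: sumr_ge0 => i _; rewrite -expr2 sqr_ge0. Qed.

Lemma mul_outer n p (x : 'cV[R]_n) (y w : 'cV[R]_p) :
  (x *m y^T) *m w = dot y w *: x.
Proof.
rewrite -mulmxA [y^T *m w]mx11_scalar -/(dot y w) mul_mx_scalar //.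
Qed.

Lemma trace_outer n (x y : 'cV[R]_n) : \tr (x *m y^T) = dot y x.
Proof. by rewrite mxtrace_mulC /mxtrace big_ord1. Qed.

Lemma trace_outerM n (x y : 'cV[R]_n) (M : 'M[R]_n) :
  \tr (x *m y^T *m M) = dot y (M *m x).
Proof. by rewrite mxtrace_mulC mulmxA trace_outer. Qed.

Lemma enormE n (x : 'cV[R]_n) : enorm x = Num.sqrt (dot x x).
Proof. by rewrite /enorm dotE; congr Num.sqrt; apply: eq_bigr => i _; rewrite expr2. Qed.

Lemma enorm_ge0 n (x : 'cV[R]_n) : 0 <= enorm x.
Proof. exact: sqrtr_ge0. Qed.

Lemma sqr_enorm n (x : 'cV[R]_n) : enorm x ^+ 2 = dot x x.
Proof. by rewrite enormE sqr_sqrtr // dot_ge0. Qed.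

Lemma dot_eq0 n (x : 'cV[R]_n) : dot x x = 0 -> x = 0.
Proof.
rewrite dotE => /psumr_eq0P h; apply/colP => i; rewrite mxE.
have := h (fun i _ => _) i isT; rewrite -expr2 => h2.
by apply/eqP; rewrite -sqrf_eq0; apply/eqP; apply: h2 => j; rewrite -expr2 sqr_ge0.
Qed.

Lemma enorm0 n : enorm (0 : 'cV[R]_n) = 0.
Proof. by rewrite enormE dot0l sqrtr0. Qed.

Lemma enormZ n a (x : 'cV[R]_n) : enorm (a *: x) = `|a| * enorm x.
Proof. by rewrite !enormE dotZl dotZr mulrA -expr2 sqrtrM ?sqr_ge0 // sqrtr_sqr. Qed.

Lemma enormN n (x : 'cV[R]_n) : enorm (- x) = enorm x.
Proof. by rewrite -scaleN1r enormZ normrN1 mul1r. Qed.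

Lemma dot_cauchy n (u v : 'cV[R]_n) : `|dot u v| <= enorm u * enorm v.
Proof.
have key : dot u v ^+ 2 <= dot u u * dot v v.
  have [/dot_eq0 ->|vv0] := eqVneq (dot v v) 0.
    by rewrite !dot0r expr2 !mulr0.
  have vv : 0 < dot v v by rewrite lt_neqAle eq_sym vv0 dot_ge0.
  have := dot_ge0 (dot v v *: u - dot u v *: v).
  rewrite !(dotBl, dotBr, dotZl, dotZr) (dotC v u) => h.
  rewrite -(ler_pM2l vv); nra.
rewrite -(@ler_pXn2r _ 2) ?nnegrE ?mulr_ge0 ?enorm_ge0 //.
by rewrite exprMn !sqr_enorm real_normK ?num_real.
Qed.

Lemma enormD n (u v : 'cV[R]_n) : enorm (u + v) <= enorm u + enorm v.
Proof.
rewrite -(@ler_pXn2r _ 2) ?nnegrE ?addr_ge0 ?enorm_ge0 //.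
rewrite sqrrD !sqr_enorm dotDl !dotDr (dotC v u).
have := dot_cauchy u v; have := ler_norm (dot u v); lra.
Qed.

Lemma enormB n (u v : 'cV[R]_n) : enorm (u - v) <= enorm u + enorm v.
Proof. by apply: le_trans (enormD _ _) _; rewrite enormN. Qed.

(** Used in place of [specnorm]: bounds compose with no supremum to handle, and restricting [v] to
    rational vectors makes the condition a countable intersection, hence measurable. *)
Definition opb p q (c : R) (M : 'M[R]_(p, q)) :=
  forall v, enorm (M *m v) <= c * enorm v.

Lemma opb_le p q c c' (M : 'M[R]_(p, q)) : c <= c' -> opb c M -> opb c' M.
Proof. by move=> cc h v; apply: le_trans (h v) _; rewrite ler_wpM2r ?enorm_ge0. Qed.

Lemma opbM p q r a b (A : 'M[R]_(p, q)) (B : 'M[R]_(q, r)) :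
  0 <= a -> opb a A -> opb b B -> opb (a * b) (A *m B).
Proof.
move=> a0 hA hB v; rewrite -mulmxA; apply: le_trans (hA _) _.
by rewrite -mulrA ler_wpM2l.
Qed.

Lemma opbD p q a b (A B : 'M[R]_(p, q)) : opb a A -> opb b B -> opb (a + b) (A + B).
Proof.
move=> hA hB v; rewrite mulmxDl; apply: le_trans (enormD _ _) _.
by rewrite mulrDl lerD.
Qed.

Lemma opbN p q a (A : 'M[R]_(p, q)) : opb a A -> opb a (- A).
Proof. by move=> hA v; rewrite mulNmx enormN. Qed.

Lemma opbB p q a b (A B : 'M[R]_(p, q)) : opb a A -> opb b B -> opb (a + b) (A - B).
Proof. by move=> hA hB; apply: opbD => //; apply: opbN. Qed.

Lemma opbZ p q k a (A : 'M[R]_(p, q)) : opb a A -> opb (`|k| * a) (k *: A).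
Proof.
move=> hA v; rewrite -scalemxAl enormZ -mulrA; apply: ler_wpM2l => //.
Qed.

Lemma opb1 n : opb 1 (1%:M : 'M[R]_n).
Proof. by move=> v; rewrite mul1mx mul1r. Qed.

Lemma opb_outer n p (x : 'cV[R]_n) (y : 'cV[R]_p) : opb (enorm x * enorm y) (x *m y^T).
Proof.
move=> v; rewrite mul_outer enormZ mulrC -mulrA.
by rewrite ler_wpM2l ?enorm_ge0 ?dot_cauchy.
Qed.

Lemma opb_dot p q c (M : 'M[R]_(p, q)) u v :
  opb c M -> `|dot u (M *m v)| <= c * enorm u * enorm v.
Proof.
move=> h; apply: le_trans (dot_cauchy _ _) _.
by rewrite mulrAC [leRHS]mulrC ler_wpM2l ?enorm_ge0 // mulrC.
Qed.

Lemma dot_opb p q c (M : 'M[R]_(p, q)) : 0 <= c ->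
  (forall u v, enorm u = 1 -> enorm v = 1 -> `|dot u (M *m v)| <= c) -> opb c M.
Proof.
move=> c0 h.
have unit n (u : 'cV[R]_n) : enorm u != 0 -> enorm ((enorm u)^-1 *: u) = 1.
  by move=> u0; rewrite enormZ ger0_norm ?invr_ge0 ?enorm_ge0 // mulVf.
move=> v; have [v0|v0] := eqVneq (enorm v) 0.
  have -> : v = 0 by apply: dot_eq0; rewrite -sqr_enorm v0 expr0n.
  by rewrite mulmx0 !enorm0 mulr0.
have [->|w0] := eqVneq (enorm (M *m v)) 0; first by rewrite mulr_ge0 ?enorm_ge0.
have := h _ _ (unit _ _ w0) (unit _ _ v0).
rewrite -scalemxAr dotZl dotZr -sqr_enorm.
have wp : 0 < enorm (M *m v) by rewrite lt_neqAle eq_sym w0 enorm_ge0.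
have vp : 0 < enorm v by rewrite lt_neqAle eq_sym v0 enorm_ge0.
rewrite [X in `|X|](_ : _ = enorm (M *m v) / enorm v).
  by rewrite ger0_norm ?divr_ge0 ?enorm_ge0 // ler_pdivrMr.
by field; rewrite w0 v0.
Qed.

Lemma opb_tr p q c (M : 'M[R]_(p, q)) : 0 <= c -> opb c M -> opb c M^T.
Proof.
move=> c0 h; apply: dot_opb => // u v u1 v1.
by rewrite dot_mul trmxK dotC; apply: le_trans (opb_dot _ _ h) _; rewrite u1 v1 !mulr1.
Qed.

(** Only finiteness matters: it makes the supremum in [specnorm] a genuine least upper bound. The
    constant is the sum of the row norms, since each coordinate of a unit vector is at most 1 in
    absolute value. *)
Lemma opb_frobenius p q (M : 'M[R]_(p, q)) : exists2 c, 0 <= c & opb c M.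
Proof.
exists (\sum_i enorm (row i M)^T).
  by apply: sumr_ge0 => i _; apply: enorm_ge0.
apply: dot_opb; first by apply: sumr_ge0 => i _; apply: enorm_ge0.
move=> u v u1 v1; rewrite dotE.
apply: le_trans (ler_norm_sum _ _ _) _; apply: ler_sum => i _.
have -> : (M *m v) i 0 = dot (row i M)^T v.
  by rewrite /dot trmxK -row_mul [RHS]mxE.
rewrite normrM -[leRHS]mul1r ler_pM //.
  have := dot_cauchy u (delta_mx i 0).
  rewrite u1 mul1r.
  have -> : dot u (delta_mx i 0) = u i 0.
    rewrite dotE (bigD1 i) //= big1 ?mxE ?eqxx ?mulr1 ?addr0 // => j ji.
    by rewrite mxE (negPf ji) /= mulr0.
  suff -> : enorm (delta_mx i 0 : 'cV[R]_p) = 1 by [].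
  rewrite enormE dotE (bigD1 i) //= big1 ?mxE ?eqxx ?mulr1 ?addr0 ?sqrtr1 // => j ji.
  by rewrite mxE (negPf ji) /= mulr0.
by have := dot_cauchy (row i M)^T v; rewrite v1 mulr1.
Qed.

Lemma opb_specnorm p q (M : 'M[R]_(p, q)) : opb (specnorm M) M.
Proof.
have [c c0 hc] := opb_frobenius M.
have hs : has_sup [set enorm (M *m x) | x in [set x : 'cV[R]_q | enorm x <= 1]].
  split; first by exists (enorm (M *m 0)), 0 => //=; rewrite enorm0.
  exists c => _ [x /= x1 <-]; apply: le_trans (hc x) _.
  by rewrite -[leRHS]mulr1 ler_wpM2l.
move=> v; have [v0|v0] := eqVneq (enorm v) 0.
  have -> : v = 0 by apply: dot_eq0; rewrite -sqr_enorm v0 expr0n.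
  by rewrite mulmx0 !enorm0 mulr0.
have vp : 0 < enorm v by rewrite lt_neqAle eq_sym v0 enorm_ge0.
have := @sup_upper_bound _ _ hs (enorm (M *m ((enorm v)^-1 *: v))).
rewrite -scalemxAr enormZ ger0_norm ?invr_ge0 ?enorm_ge0 // => h.
rewrite -ler_pdivrMr // mulrC; apply: h.
exists ((enorm v)^-1 *: v) => /=.
  by rewrite enormZ ger0_norm ?invr_ge0 ?enorm_ge0 // mulVf.
by rewrite -scalemxAr enormZ ger0_norm ?invr_ge0 ?enorm_ge0.
Qed.

Lemma specnorm_le p q c (M : 'M[R]_(p, q)) : 0 <= c -> opb c M -> specnorm M <= c.
Proof.
move=> c0 h; apply: ge_sup; first by exists (enorm (M *m 0)), 0 => //=; rewrite enorm0.
move=> _ [x /= x1 <-]; apply: le_trans (h x) _.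
by rewrite -[leRHS]mulr1 ler_wpM2l.
Qed.

Lemma specnorm_ge0 p q (M : 'M[R]_(p, q)) : 0 <= specnorm M.
Proof.
have [c c0 hc] := opb_frobenius M.
apply: (@le_trans _ _ (enorm (M *m 0))); first exact: enorm_ge0.
apply: sup_upper_bound; last by exists 0 => //=; rewrite enorm0.
split; first by exists (enorm (M *m 0)), 0 => //=; rewrite enorm0.
exists c => _ [x /= x1 <-]; apply: le_trans (hc x) _.
by rewrite -[leRHS]mulr1 ler_wpM2l.
Qed.

Lemma specnormP p q c (M : 'M[R]_(p, q)) : 0 <= c -> (specnorm M <= c) <-> opb c M.
Proof.
move=> c0; split; last exact: specnorm_le.
by move=> h; apply: opb_le h (opb_specnorm M).
Qed.

Lemma trace_gram n d (U : 'M[R]_(n, d)) (B : 'M[R]_d) :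
  \tr (B *m (U^T *m U)) = \sum_k dot (row k U)^T (B *m (row k U)^T).
Proof.
rewrite mulmxA mxtrace_mulC mulmxA /mxtrace; apply: eq_bigr => k _.
rewrite /dot trmxK mulmxA -row_mul [LHS]mxE [RHS]mxE; apply: eq_bigr => j _.
by rewrite [in RHS]mxE [X in _ = _ * X]mxE [X in _ = _ * X]mxE [X in _ * X = _]mxE.
Qed.

(** The duality between operator norm and trace, read off the rows of [U] with no diagonalization of
    the Gram matrix; [B] may be nonsymmetric. *)
Lemma trace_gram_le n d (U : 'M[R]_(n, d)) (B : 'M[R]_d) b : opb b B ->
  `|\tr (B *m (U^T *m U))| <= b * \tr (U^T *m U).
Proof.
move=> hB; have := trace_gram U 1%:M; rewrite mul1mx => ->.
rewrite trace_gram mulr_sumr; apply: le_trans (ler_norm_sum _ _ _) _.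
apply: ler_sum => k _; apply: le_trans (opb_dot _ _ hB) _.
by rewrite -mulrA -expr2 sqr_enorm mul1mx.
Qed.

Lemma trace_gram_ge0 n d (U : 'M[R]_(n, d)) : 0 <= \tr (U^T *m U).
Proof.
have := trace_gram U 1%:M; rewrite mul1mx => ->.
by apply: sumr_ge0 => k _; rewrite mul1mx dot_ge0.
Qed.

Lemma gram_dot n d (U : 'M[R]_(n, d)) u v :
  dot u (U^T *m U *m v) = dot (U *m u) (U *m v).
Proof. by rewrite -mulmxA dot_mul trmxK. Qed.

Lemma gram_le_trace n d (U : 'M[R]_(n, d)) v :
  dot v (U^T *m U *m v) <= \tr (U^T *m U) * dot v v.
Proof.
rewrite gram_dot; have := trace_gram U 1%:M; rewrite mul1mx => ->.
rewrite [leLHS]dotE mulr_suml; apply: ler_sum => k _.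
have -> : (U *m v) k 0 = dot (row k U)^T v by rewrite /dot trmxK -row_mul [RHS]mxE.
rewrite mul1mx -!sqr_enorm -expr2 -exprMn -[leLHS]real_normK ?num_real //.
by rewrite ler_pXn2r ?nnegrE ?mulr_ge0 ?enorm_ge0 ?dot_cauchy.
Qed.

Lemma gram_opb n d (U : 'M[R]_(n, d)) c : 0 <= c ->
  (forall v, dot v (U^T *m U *m v) <= c * dot v v) -> opb c (U^T *m U).
Proof.
move=> c0 h; apply: dot_opb => // u v u1 v1; rewrite gram_dot.
apply: le_trans (dot_cauchy _ _) _.
have hh w : enorm w = 1 -> enorm (U *m w) <= Num.sqrt c.
  move=> w1; rewrite enormE ler_sqrt // -gram_dot.
  by apply: le_trans (h w) _; rewrite -sqr_enorm w1 expr1n mulr1.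
rewrite -[leRHS]sqr_sqrtr // expr2.
by rewrite ler_pM ?enorm_ge0 ?hh.
Qed.

End euclidean.

(** * Measurability of matrix-valued functions *)

Section matrix_measurability.
Context {R : realType} {dT : measure_display} {T : measurableType dT}.

Lemma measurable_invr (f : T -> R) :
  measurable_fun setT f -> measurable_fun setT (fun w => (f w)^-1).
Proof.
move=> mf; apply: (@measurableT_comp _ _ _ _ _ _ (fun x : R => x^-1)) => //.
(* The convention [0^-1 = 0] leaves a function continuous on the open set of nonzero reals and
   constant on its complement. *)
rewrite (_ : (fun x : R => x^-1) = (fun x => if x == 0 then 0 else x^-1)); last first.
  by apply/funext => x; case: eqP => // ->; rewrite invr0.
apply: measurable_fun_if => //; first exact: measurable_fun_eqr.
rewrite setTI; apply: open_continuous_measurable_fun.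
  rewrite (_ : _ @^-1` _ = ~` [set 0]); first exact/closed_openC/closed_eq.
  by apply/seteqP; split => x /=; [move/eqP|move/eqP/negPf].
by move=> x; rewrite inE /= => /eqP /eqP x0; apply: inv_continuous.
Qed.

(** Entrywise, because every matrix operation used is an explicit formula in the entries;
    [measurable_mmx] identifies this with measurability for the product sigma-algebra. *)
Definition mmx p q (f : T -> 'M[R]_(p, q)) :=
  forall i j, measurable_fun setT (fun w => f w i j).

Lemma mmx_cst p q (M : 'M[R]_(p, q)) : mmx (fun=> M).
Proof. by move=> i j; apply: measurable_cst. Qed.

Lemma mmxD p q (f g : T -> 'M[R]_(p, q)) : mmx f -> mmx g -> mmx (fun w => f w + g w).
Proof.
by move=> mf mg i j; under eq_fun do rewrite mxE; apply: measurable_funD.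
Qed.

Lemma mmxZ p q (k : T -> R) (g : T -> 'M[R]_(p, q)) :
  measurable_fun setT k -> mmx g -> mmx (fun w => k w *: g w).
Proof.
by move=> mf mg i j; under eq_fun do rewrite mxE; apply: measurable_funM.
Qed.

Lemma mmxN p q (g : T -> 'M[R]_(p, q)) : mmx g -> mmx (fun w => - g w).
Proof.
by move=> mg i j; under eq_fun do rewrite mxE; apply: measurable_funN.
Qed.

Lemma mmxB p q (f g : T -> 'M[R]_(p, q)) : mmx f -> mmx g -> mmx (fun w => f w - g w).
Proof. by move=> mf mg; apply: mmxD => //; apply: mmxN. Qed.

Lemma mmxM p q r (f : T -> 'M[R]_(p, q)) (g : T -> 'M[R]_(q, r)) :
  mmx f -> mmx g -> mmx (fun w => f w *m g w).
Proof.
move=> mf mg i j; under eq_fun do rewrite mxE.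
by apply: measurable_sum => k; apply: measurable_funM.
Qed.

Lemma mmx_tr p q (f : T -> 'M[R]_(p, q)) : mmx f -> mmx (fun w => (f w)^T).
Proof. by move=> mf i j; under eq_fun do rewrite mxE; apply: mf. Qed.

Lemma mmx_row p q (f : T -> 'M[R]_(p, q)) k : mmx f -> mmx (fun w => row k (f w)).
Proof. by move=> mf i j; under eq_fun do rewrite mxE; apply: mf. Qed.

Lemma mmx_sum p q (I : Type) (r : seq I) (P : pred I) (f : I -> T -> 'M[R]_(p, q)) :
  (forall k, mmx (f k)) -> mmx (fun w => \sum_(k <- r | P k) f k w).
Proof.
move=> mf i j; under eq_fun do rewrite summxE big_mkcond.
by apply: measurable_sum => k; case: (P k) => //; apply: mf.
Qed.

Lemma measurable_tr p (f : T -> 'M[R]_p) :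
  mmx f -> measurable_fun setT (fun w => \tr (f w)).
Proof. by move=> mf; apply: measurable_sum => k; apply: mf. Qed.

Lemma measurable_dot p (f g : T -> 'cV[R]_p) :
  mmx f -> mmx g -> measurable_fun setT (fun w => dot (f w) (g w)).
Proof. by move=> mf mg; apply: mmxM => //; apply: mmx_tr. Qed.

Lemma measurable_det p (f : T -> 'M[R]_p) :
  mmx f -> measurable_fun setT (fun w => \det (f w)).
Proof.
move=> mf; rewrite /determinant; apply: measurable_sum => s.
by apply: measurable_funM => //; apply: measurable_prod => i _; apply: mf.
Qed.

(** [invmx] returns its argument on singular matrices, hence the split on a zero determinant;
    elsewhere the cofactor formula applies. *)
Lemma mmx_inv p (f : T -> 'M[R]_p) : mmx f -> mmx (fun w => invmx (f w)).
Proof.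
move=> mf i j; rewrite /invmx.
rewrite (_ : (fun w => _) = (fun w => if \det (f w) == 0 then f w i j
   else (\det (f w))^-1 * cofactor (f w) j i)); last first.
  apply/funext => w; rewrite unitmxE unitfE; case: eqP => //= _.
  by rewrite !mxE.
apply: measurable_fun_ifT.
- by apply: measurable_fun_eqr => //; apply: measurable_det.
- exact: mf.
apply: measurable_funM; first by apply: measurable_invr; apply: measurable_det.
rewrite /cofactor; apply: measurable_funM => //; apply: measurable_det => k l.
by under eq_fun do rewrite !mxE; apply: mf.
Qed.

End matrix_measurability.

Section matrix_sigma_algebra.
Context {R : realType} {dT : measure_display} {T : measurableType dT}.

Lemma mmx_id p q : mmx (@id 'M[R]_(p, q)).
Proof.
move=> i j _ B mB; rewrite setTI; apply: sub_sigma_algebra.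
by exists i, j, B.
Qed.

Lemma measurable_mmx p q (f : T -> 'M[R]_(p, q)) : measurable_fun setT f <-> mmx f.
Proof.
split=> [mf i j|mf].
  exact: (@measurableT_comp _ _ _ _ _ _ (fun M : 'M[R]_(p, q) => M i j) _ f (mmx_id i j) mf).
apply: (@measurability _ _ T 'M[R]_(p, q) setT f (@matrix_cylinders _ _ p q)) => //.
move=> _ [_ [i [j [B mB ->]]] <-].
by have := mf i j measurableT B mB.
Qed.

End matrix_sigma_algebra.

(** The minimum over [l] is at [l = sqrt (b / a)]. When [a] or [b] vanishes it may not be attained,
    and [l] is taken large or small instead. *)
Lemma sqrt_mul_optimal (R : realType) (a b x : R) : 0 <= a -> 0 <= b ->
  (forall l, 0 < l -> x <= (l * a + l^-1 * b) / 2) -> x <= Num.sqrt a * Num.sqrt b.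
Proof.
move=> a0 b0 h; have [aE|an] := eqVneq a 0.
  rewrite aE sqrtr0 mul0r; apply/ler_addgt0Pr => e e0; rewrite add0r.
  have l0 : 0 < b / e + 1 by rewrite ltr_wpDl // divr_ge0 // ltW.
  apply: le_trans (h _ l0) _; rewrite aE mulr0 add0r -mulrA.
  rewrite mulrC ler_pdivrMr //.
  have -> : e * (b / e + 1) = b + e by field; rewrite gt_eqF.
  lra.
have [bE|bn] := eqVneq b 0.
  rewrite bE sqrtr0 mulr0; apply/ler_addgt0Pr => e e0; rewrite add0r.
  have l0 : 0 < e / a by rewrite divr_gt0 // lt_neqAle eq_sym an.
  apply: le_trans (h _ l0) _; rewrite bE mulr0 addr0 divfK //; lra.
have sa : 0 < Num.sqrt a by rewrite sqrtr_gt0 lt_neqAle eq_sym an.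
have sb : 0 < Num.sqrt b by rewrite sqrtr_gt0 lt_neqAle eq_sym bn.
apply: le_trans (h _ (divr_gt0 sb sa)) _.
have := sqr_sqrtr a0; have := sqr_sqrtr b0.
move: (Num.sqrt a) (Num.sqrt b) sa sb => p q p0 q0 <- <-.
rewrite [leLHS](_ : _ = p * q) //.
by field; rewrite !gt_eqF.
Qed.

(** * Bounds on means *)

Section mean_bounds.
Context {R : realType} {dT : measure_display} {T : measurableType dT}.
Variable P : probability T R.

(** Nonnegativity and the extended-real mean allow domination and Tonelli with no separate
    integrability proof; integrability then follows from the finite bound. *)
Definition ub (h : T -> R) (c : R) :=
  [/\ measurable_fun setT h, forall w, 0 <= h w &
      (\int[P]_w (h w)%:E <= c%:E)%E].

Lemma ub_ge0 h c : ub h c -> 0 <= c.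
Proof.
case=> _ h0 hc; rewrite -lee_fin; apply: le_trans hc.
by apply: integral_ge0 => w _; rewrite lee_fin.
Qed.

Lemma ub_le h c c' : c <= c' -> ub h c -> ub h c'.
Proof. by move=> cc [? ? hc]; split=> //; apply: le_trans hc _; rewrite lee_fin. Qed.

Lemma ub_dom (h g : T -> R) c : measurable_fun setT g -> (forall w, 0 <= g w <= h w) ->
  ub h c -> ub g c.
Proof.
move=> mg gh [mh h0 hc]; split=> //; first by move=> w; case/andP: (gh w).
apply: le_trans hc; apply: ge0_le_integral => //.
- by move=> w _; rewrite lee_fin; case/andP: (gh w).
- exact/measurable_EFinP.
- exact/measurable_EFinP.
- by move=> w _; rewrite lee_fin; case/andP: (gh w).
Qed.

Lemma ubD h g a b : ub h a -> ub g b -> ub (fun w => h w + g w) (a + b).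
Proof.
move=> [mh h0 ha] [mg g0 gb]; split.
- exact: measurable_funD.
- by move=> w; rewrite addr_ge0.
under eq_integral do rewrite EFinD.
rewrite ge0_integralD // ?EFinD ?leeD //.
- by move=> w _; rewrite lee_fin.
- exact/measurable_EFinP.
- by move=> w _; rewrite lee_fin.
- exact/measurable_EFinP.
Qed.

Lemma ubZ k h a : 0 <= k -> ub h a -> ub (fun w => k * h w) (k * a).
Proof.
move=> k0 [mh h0 ha]; split.
- exact: measurable_funM.
- by move=> w; rewrite mulr_ge0.
under eq_integral do rewrite EFinM.
rewrite ge0_integralZl // ?EFinM ?lee_wpmul2l //.
- exact/measurable_EFinP.
- by move=> w _; rewrite lee_fin.
Qed.

Lemma ub_cst k : 0 <= k -> ub (fun=> k) k.
Proof.
move=> k0; split=> //; rewrite integral_cst //= probability_setT mule1 //.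
Qed.

Lemma ub_indic (A : set T) p : measurable A -> (P A <= p%:E)%E -> ub \1_A p.
Proof.
move=> mA Ap; split=> //.
by rewrite integral_indic // setIT.
Qed.

(** Cauchy-Schwarz, by averaging [|f g| <= (l f^2 + g^2 / l) / 2] and optimizing over [l]. *)
Lemma ub_cauchy (f g : T -> R) a b : measurable_fun setT f -> measurable_fun setT g ->
  ub (fun w => f w ^+ 2) a -> ub (fun w => g w ^+ 2) b ->
  ub (fun w => `|f w * g w|) (Num.sqrt a * Num.sqrt b).
Proof.
move=> mf mg fa gb.
have mfg : measurable_fun setT (fun w => `|f w * g w|).
  by apply: measurableT_comp => //; apply: measurable_funM.
have key l : 0 < l -> ub (fun w => `|f w * g w|) ((l * a + l^-1 * b) / 2).
  move=> l0; rewrite mulrC.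
  apply: ub_dom mfg _ (ubZ _ (ubD (ubZ _ fa) (ubZ _ gb))); rewrite ?invr_ge0 ?(ltW l0) //.
  move=> w; rewrite normr_ge0 /= normrM -[f w ^+ 2]real_normK ?num_real //.
  rewrite -[g w ^+ 2]real_normK ?num_real //.
  move: `|f w| `|g w| => x y; rewrite -subr_ge0.
  rewrite [leRHS](_ : _ = l * (x - l^-1 * y) ^+ 2 / 2).
    by rewrite divr_ge0 // mulr_ge0 ?sqr_ge0 // ltW.
  by field; rewrite gt_eqF.
have [_ h0 hI] := key 1 ltr01.
have fin : (\int[P]_w (`|f w * g w|)%:E)%E \is a fin_num.
  rewrite ge0_fin_numE ?(le_lt_trans hI) ?ltry //.
  by apply: integral_ge0 => w _; rewrite lee_fin.
split=> //; rewrite -(fineK fin) lee_fin.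
apply: sqrt_mul_optimal; [exact: ub_ge0 fa|exact: ub_ge0 gb|].
by move=> l l0; have [_ _] := key l l0; rewrite -{1}(fineK fin) lee_fin.
Qed.

Lemma ub_sqrt (f : T -> R) a : measurable_fun setT f -> ub (fun w => f w ^+ 2) a ->
  ub (fun w => `|f w|) (Num.sqrt a).
Proof.
move=> mf fa.
have h1 : ub (fun=> 1 ^+ 2) 1 by rewrite expr1n; exact: ub_cst.
have := @ub_cauchy f (fun=> 1) a 1 mf (measurable_cst _) fa h1.
by rewrite sqrtr1 mulr1; under eq_fun do rewrite mulr1.
Qed.

(** The signed counterpart of [ub]. Integrability is included because the real-valued integral would
    otherwise be a default value. *)
Definition mb (f : T -> R) (c : R) :=
  P.-integrable setT (EFin \o f) /\ `|\int[P]_w f w| <= c.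

Lemma mb_le f c c' : c <= c' -> mb f c -> mb f c'.
Proof. by move=> cc [? hc]; split=> //; apply: le_trans hc _. Qed.

Lemma mb_ge0 f c : mb f c -> 0 <= c.
Proof. by case=> _; apply: le_trans. Qed.

Lemma ub_integrable h c : ub h c -> P.-integrable setT (EFin \o h).
Proof.
move=> [mh h0 hc]; apply/integrableP; split; first exact/measurable_EFinP.
apply: le_lt_trans (ltry c); apply: le_trans hc; under eq_integral do rewrite /= ger0_norm //.
exact: lexx.
Qed.

Lemma ub_mean h c : ub h c -> \int[P]_w h w <= c.
Proof.
move=> hu; have [mh h0 hc] := hu; rewrite /Rintegral -lee_fin fineK //.
exact: (integrable_fin_num _ (ub_integrable hu)).
Qed.

Lemma mean_ub (h : T -> R) c : measurable_fun setT h -> (forall w, 0 <= h w) ->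
  P.-integrable setT (EFin \o h) -> \int[P]_w h w <= c -> ub h c.
Proof.
move=> mh h0 ih hc; split=> //.
by rewrite -[leLHS]fineK ?lee_fin //; exact: (integrable_fin_num _ ih).
Qed.

Lemma mb_ub (f h : T -> R) c : measurable_fun setT f -> (forall w, `|f w| <= h w) ->
  ub h c -> mb f c.
Proof.
move=> mf fh hu; have [mh h0 hc] := hu.
have ih := ub_integrable hu.
have fi : P.-integrable setT (EFin \o f).
  apply: le_integrable ih => //; first exact/measurable_EFinP.
  by move=> w _ /=; rewrite lee_fin (ger0_norm (h0 w)).
split=> //; apply: le_trans (le_normr_Rintegral measurableT fi) _.
apply: le_trans (ub_mean hu); apply: le_Rintegral => //.
exact: integrable_norm.
Qed.

Lemma eq_mb (f g : T -> R) c : (forall w, f w = g w) -> mb f c -> mb g c.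
Proof. by move=> /funext ->. Qed.

Lemma mbD f g a b : mb f a -> mb g b -> mb (fun w => f w + g w) (a + b).
Proof.
move=> [fi fa] [gi gb]; split.
  by have := integrableD measurableT fi gi; apply: eq_integrable.
rewrite RintegralD //; apply: le_trans (ler_normD _ _) _; exact: lerD.
Qed.

Lemma mbZ k f a : mb f a -> mb (fun w => k * f w) (`|k| * a).
Proof.
move=> [fi fa]; split.
  by have := integrableZl measurableT k fi; apply: eq_integrable.
by rewrite RintegralZl // normrM ler_wpM2l.
Qed.

Lemma mbN f a : mb f a -> mb (fun w => - f w) a.
Proof.
move=> /(mbZ (-1)); rewrite normrN1 mul1r; apply: eq_mb => w; exact: mulN1r.
Qed.

Lemma mb0 : mb (fun=> 0) 0.
Proof.
apply: (@mb_ub _ (fun=> 0)) => //; first by move=> w; rewrite normr0.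
exact: ub_cst.
Qed.

Lemma mb_sum (I : Type) (r : seq I) (F : I -> T -> R) c :
  (forall i, mb (F i) c) -> mb (fun w => \sum_(i <- r) F i w) ((size r)%:R * c).
Proof.
move=> h; elim: r => [|i r IH] /=.
  by rewrite mul0r; apply: eq_mb mb0 => w; rewrite big_nil.
rewrite -natr1 addrC mulrDl mul1r.
by apply: eq_mb (mbD (h i) IH) => w; rewrite big_cons.
Qed.

Lemma mb_mean m (F : 'I_m -> T -> R) c : (0 < m)%N ->
  (forall i, mb (F i) c) -> mb (fun w => m%:R^-1 * \sum_i F i w) c.
Proof.
move=> m0 h; have := mbZ m%:R^-1 (mb_sum (enum 'I_m) h).
rewrite size_enum_ord ger0_norm ?invr_ge0 // mulrA mulVf ?mul1r ?pnatr_eq0 -?lt0n //.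
by apply: eq_mb => w; rewrite big_enum.
Qed.

End mean_bounds.

(** * Laws of matrices with independent rows *)

Section row_rectangles.
Context {R : realType} (m n : nat).

Definition row_rect (B : 'I_m -> set 'rV[R]_n) : set 'M[R]_(m, n) :=
  [set M | forall i, B i (row i M)].

Definition row_rects : set (set 'M[R]_(m, n)) :=
  [set D | exists2 B, (forall i, measurable (B i)) & D = row_rect B].

Lemma measurable_row_rect d (T : measurableType d) (Z : T -> 'M[R]_(m, n)) B :
  mmx Z -> (forall i, measurable (B i)) -> measurable [set w | row_rect B (Z w)].
Proof.
move=> mZ mB.
rewrite (_ : [set w | _] = \bigcap_(i in [set: 'I_m]) ((fun w => row i (Z w)) @^-1` B i)).
  apply: fin_bigcap_measurable; first exact: finite_finset.
  move=> i _; rewrite -[X in measurable X]setTI.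
  by have /measurable_mmx := mmx_row i mZ; apply.
by apply/seteqP; split=> w h i; [move=> _; exact: h|exact: (h i I)].
Qed.

Lemma measurable_row_rects : (@measurable _ 'M[R]_(m, n)) = <<s row_rects >>.
Proof.
apply/seteqP; split.
  apply: smallest_sub; first exact: smallest_sigma_algebra.
  move=> _ [i [j [B mB ->]]]; apply: sub_sigma_algebra.
  exists (fun k => if k == i then [set r : 'rV[R]_n | B (r 0 j)] else setT).
    move=> k; case: eqP => // _.
    by have := @mmx_id R 1 n 0 j measurableT B mB; rewrite setTI.
  apply/seteqP; split=> M /=.
    by move=> h k /=; case: eqP => // ->; rewrite /= mxE.
  by move/(_ i); rewrite eqxx /= mxE.
apply: smallest_sub; first exact: sigma_algebra_measurable.
by move=> _ [B mB ->]; apply: measurable_row_rect => //; exact: mmx_id.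
Qed.

(** Row rectangles are closed under intersection and generate the sigma-algebra, so a finite measure
    is determined by its values on them. *)
Lemma row_rects_unique (m1 m2 : {measure set 'M[R]_(m, n) -> \bar R}) :
  (m1 setT < +oo)%E ->
  (forall B, (forall i, measurable (B i)) -> m1 (row_rect B) = m2 (row_rect B)) ->
  forall A, measurable A -> m1 A = m2 A.
Proof.
move=> fin h A mA.
have hT : row_rects setT.
  by exists (fun=> setT) => //; apply/seteqP; split.
apply: (@measure_unique _ R _ row_rects (fun=> setT)) => //.
- exact: measurable_row_rects.
- move=> _ _ [B mB ->] [B' mB' ->]; exists (fun i => B i `&` B' i).
    by move=> i; apply: measurableI.
  apply/seteqP; split=> M /=.
    by move=> [h1 h2] i; split; [exact: h1|exact: h2].
  by move=> h'; split=> i; case: (h' i).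
- by apply/seteqP; split=> // x _; exists 0%N.
by move=> _ [B mB ->]; apply: h.
Qed.

End row_rectangles.

Section same_law.
Context {R : realType} {d1 d2 : measure_display} {T1 : measurableType d1}
  {T2 : measurableType d2} (m1 : {measure set T1 -> \bar R})
  (m2 : {measure set T2 -> \bar R}) (m n : nat).
Variables (Z1 : T1 -> 'M[R]_(m, n)) (Z2 : T2 -> 'M[R]_(m, n)).
Hypotheses (mZ1 : mmx Z1) (mZ2 : mmx Z2) (m1fin : (m1 setT < +oo)%E).
Hypothesis rects : forall B, (forall i, measurable (B i)) ->
  m1 [set w | row_rect B (Z1 w)] = m2 [set w | row_rect B (Z2 w)].

Let f1 : measurable_fun setT Z1. Proof. exact/measurable_mmx. Qed.
Let f2 : measurable_fun setT Z2. Proof. exact/measurable_mmx. Qed.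
HB.instance Definition _ := isMeasurableFun.Build _ _ _ _ Z1 f1.
HB.instance Definition _ := isMeasurableFun.Build _ _ _ _ Z2 f2.

Lemma same_law_set A : measurable A ->
  m1 [set w | A (Z1 w)] = m2 [set w | A (Z2 w)].
Proof.
move=> mA.
exact: (row_rects_unique (m1 := pushforward m1 Z1) (m2 := pushforward m2 Z2)).
Qed.

Lemma same_law_integral (f : 'M[R]_(m, n) -> \bar R) :
  measurable_fun setT f -> (forall M, (0 <= f M)%E) ->
  (\int[m1]_w f (Z1 w) = \int[m2]_w f (Z2 w))%E.
Proof.
move=> mf f0.
have e1 := @ge0_integral_pushforward _ _ _ _ R Z1 f1 m1 setT f measurableT mf (fun x _ => f0 x).
have e2 := @ge0_integral_pushforward _ _ _ _ R Z2 f2 m2 setT f measurableT mf (fun x _ => f0 x).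
rewrite !preimage_setT in e1, e2.
rewrite -[LHS]e1 -[RHS]e2.
by apply: eq_measure_integral => A mA _; exact: same_law_set.
Qed.

End same_law.

Definition repl (R : realType) m n (i : 'I_m) (x : 'rV[R]_n) (M : 'M[R]_(m, n)) :=
  \matrix_(k < m, l < n) if k == i then x 0 l else M k l.

Section resampling.
Context {R : realType} {dT dT' : measure_display} {T : measurableType dT}
  {T' : measurableType dT'} {P : probability T R} {P' : probability T' R}
  {m n : nat}.
Variables (S : T -> 'M[R]_(m, n)) (v : T' -> 'rV[R]_n).
Hypotheses (mS : mmx S) (mv : mmx v) (iid : iid_rows P P' S v).

Lemma row_repl (i k : 'I_m) x (M : 'M[R]_(m, n)) :
  row k (repl i x M) = if k == i then x else row k M.
Proof. by apply/rowP => l; rewrite !mxE; case: eqP; rewrite ?mxE. Qed.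

Lemma iid_rect B : (forall i, measurable (B i)) ->
  P [set w | row_rect B (S w)] = (\prod_(i < m) P' [set w | B i (v w)])%E.
Proof.
move=> mB; case: iid => h1 h2; rewrite [LHS]h1 //.
by apply: eq_bigr => i _; apply: h2.
Qed.

(** Permuting i.i.d. rows only permutes the factors in the probability of a rectangle. This carries
    the assumption on the first third of the rows over to the other two. *)
Lemma iid_perm (s : 'S_m) (f : 'M[R]_(m, n) -> \bar R) :
  measurable_fun setT f -> (forall M, (0 <= f M)%E) ->
  (\int[P]_w f (row_perm s (S w)) = \int[P]_w f (S w))%E.
Proof.
move=> mf f0; apply: (same_law_integral (Z1 := fun w => row_perm s (S w))) => //.
- by move=> i j; under eq_fun do rewrite mxE; exact: mS.
- by rewrite /= probability_setT ltry.
move=> B mB; rewrite [RHS]iid_rect //.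
transitivity (P [set w | row_rect (fun k => B ((s^-1)%g k)) (S w)]); last first.
  rewrite iid_rect //; rewrite (reindex_inj (@perm_inj _ s)) /=.
  by apply: eq_bigr => i _; rewrite permK.
congr (P _).
apply/seteqP; split=> w /= h k.
  have := h (s^-1%g k); congr (B _ _); apply/rowP => l.
  by rewrite !mxE permKV.
have := h (s k); rewrite permK; congr (B _ _); apply/rowP => l.
by rewrite !mxE.
Qed.

(** Overwriting row [i] by an independent copy preserves the probability of every row rectangle,
    hence the law; Tonelli then makes the integral an iterated one. *)
Lemma resampling i (f : 'M[R]_(m, n) -> \bar R) :
  measurable_fun setT f -> (forall M, (0 <= f M)%E) ->
  (\int[P]_w f (S w) = \int[P]_w \int[P']_w' f (repl i (v w') (S w)))%E.
Proof.
move=> mf f0.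
pose Z (p : T * T') := repl i (v p.2) (S p.1).
have mZ : mmx Z.
  move=> k l; rewrite /Z; under eq_fun do rewrite mxE; case: eqP => _.
    exact: (measurableT_comp (mv 0 l) measurable_snd).
  exact: (measurableT_comp (mS k l) measurable_fst).
have mfZ : measurable_fun setT (f \o Z).
  by apply: measurableT_comp => //; exact/measurable_mmx.
have := @fubini_tonelli1 _ _ T T' R P P' (f \o Z) mfZ (fun x => f0 _).
rewrite /fubini_F => <-.
apply: (same_law_integral (Z1 := S) (Z2 := Z)) => //.
  by rewrite /= probability_setT ltry.
move=> B mB; rewrite [LHS](iid_rect mB).
(* Row [i] of [S] has been overwritten, so its constraint becomes [setT], and [B i] falls on the
   redrawn vector. *)
rewrite (_ : [set w | row_rect B (Z w)] =
  [set w | row_rect (fun k => if k == i then setT else B k) (S w)] `*`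
  [set w | B i (v w)]).
  have mvB : measurable [set w | B i (v w)].
    by move/measurable_mmx: mv => /(_ measurableT _ (mB i)); rewrite setTI.
  have mr : measurable [set w | row_rect (fun k => if k == i then setT else B k) (S w)].
    by apply: measurable_row_rect => // k; case: eqP.
  transitivity (P [set w | row_rect (fun k => if k == i then setT else B k) (S w)] *
    P' [set w | B i (v w)])%E; last exact/esym/product_measure1E.
  rewrite iid_rect; last by move=> k; case: eqP.
  rewrite (bigD1 i) //= [in RHS](bigD1 i) //= eqxx.
  rewrite (_ : [set w | setT (v w)] = setT); last by apply/seteqP; split.
  rewrite probability_setT mul1e muleC; congr (_ * _)%E.
  by apply: eq_bigr => k /negPf ->.
apply/seteqP; split=> [[w w'] /= h|[w w'] [/= h1 h2] k].
  split; last by have := h i; rewrite row_repl eqxx.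
  by move=> k; have := h k; rewrite row_repl; case: eqP.
by have := h1 k; rewrite row_repl /=; case: eqP => // ->.
Qed.

End resampling.

(** * Leave-one-out resolvents *)

Section coercive.
Variables (R : realType) (d : nat).
Implicit Types (M : 'M[R]_d) (x v w : 'cV[R]_d).

Lemma coercive_unit M c : 0 < c -> (forall v, c * dot v v <= dot v (M *m v)) ->
  M \in unitmx.
Proof.
move=> c0 h; rewrite -row_free_unit -kermx_eq0; apply/eqP/row_matrixP => i.
rewrite row0; set u := row i _.
have uM : u *m M = 0.
  by apply/sub_kermxP; exact: row_sub.
have := h u^T; rewrite {2}/dot trmxK mulmxA uM mul0mx mxE => h0.
suff : u^T = 0 by move/(congr1 trmx); rewrite trmxK trmx0.
apply: dot_eq0; apply/eqP; rewrite eq_le dot_ge0 andbT.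
by rewrite -(pmulr_rle0 _ c0).
Qed.

Lemma invmx_coercive M c : 0 < c -> (forall v, c * dot v v <= dot v (M *m v)) ->
  opb c^-1 (invmx M).
Proof.
move=> c0 h v; have uM := coercive_unit c0 h.
have := h (invmx M *m v); rewrite mulKVmx // -sqr_enorm.
have := dot_cauchy (invmx M *m v) v; have := ler_norm (dot (invmx M *m v) v).
have := enorm_ge0 (invmx M *m v); move: (enorm (invmx M *m v)) => a.
rewrite le_eqVlt => /predU1P[<- _ _ _|a0 h1 h2 h3].
  by rewrite mulr_ge0 ?enorm_ge0 // invr_ge0 ltW.
rewrite mulrC ler_pdivlMr // -(ler_pM2l a0); nra.
Qed.

Lemma invmx_ge0 M v : (forall v, 0 <= dot v (M *m v)) -> M \in unitmx ->
  0 <= dot v (invmx M *m v).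
Proof. by move=> h uM; have := h (invmx M *m v); rewrite mulKVmx // dotC. Qed.

Lemma invmx_sym M : M^T = M -> (invmx M)^T = invmx M.
Proof. by move=> h; rewrite trmx_inv h. Qed.

End coercive.

Section sherman_morrison.
Variables (R : realType) (d : nat) (A : 'M[R]_d) (k : R) (x : 'cV[R]_d).
Let B := A + k *: (x *m x^T).
Hypotheses (uA : A \in unitmx) (uB : B \in unitmx) (sA : A^T = A).
Let Qa := invmx A.
Let Qb := invmx B.
Let g := 1 + k * dot x (Qa *m x).

Lemma sherman_morrison_scal : g *: (Qb *m x) = Qa *m x.
Proof.
have : B *m (Qa *m x) = g *: x.
  rewrite /B mulmxDl mulmxA /Qa mulmxV // mul1mx -scalemxAl mul_outer.
  by rewrite scalerA /g scalerDl scale1r.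
by move/(congr1 (mulmx Qb)); rewrite /Qb mulKmx // -scalemxAr => ->.
Qed.

Hypothesis g0 : g != 0.

Lemma sherman_morrison_vec : Qb *m x = g^-1 *: (Qa *m x).
Proof. by rewrite -sherman_morrison_scal scalerA mulVf // scale1r. Qed.

Lemma sherman_morrison w :
  Qb *m w = Qa *m w - (k / g * dot x (Qa *m w)) *: (Qa *m x).
Proof.
have h : A *m (Qa *m w) = w by rewrite /Qa mulKVmx.
have : B *m (Qa *m w) = w + (k * dot x (Qa *m w)) *: x.
  by rewrite /B mulmxDl h -scalemxAl mul_outer scalerA.
move/(congr1 (mulmx Qb)); rewrite /Qb mulKmx // -/Qb mulmxDr -scalemxAr.
rewrite sherman_morrison_vec scalerA => e.
by apply/esym/eqP; rewrite subr_eq {1}e [k / g * _]mulrAC.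
Qed.

End sherman_morrison.

Section gram_sum.
Variables (R : realType) (d : nat).

Lemma dot_outer_sum (I : Type) (r : seq I) (P : pred I) (x : I -> 'cV[R]_d) v w :
  dot v ((\sum_(k <- r | P k) x k *m (x k)^T) *m w) =
  \sum_(k <- r | P k) dot v (x k) * dot (x k) w.
Proof.
rewrite mulmx_suml dot_sumr; apply: eq_bigr => k _.
by rewrite mul_outer dotZr mulrC.
Qed.

Lemma outer_sum_sym (I : Type) (r : seq I) (P : pred I) (x : I -> 'cV[R]_d) :
  (\sum_(k <- r | P k) x k *m (x k)^T)^T = \sum_(k <- r | P k) x k *m (x k)^T.
Proof.
by rewrite linear_sum; apply: eq_bigr => k _ /=; rewrite trmx_mul trmxK.
Qed.

End gram_sum.

Section sketch.
Variables (R : realType) (n d m q : nat) (U : 'M[R]_(n, d)) (N eta : R).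
Hypotheses (mq : m = (3 * q)%N) (q0 : (0 < q)%N) (N0 : 0 < N)
  (eta0 : 0 <= eta) (eta1 : eta <= 1 / 2).
Let G := U^T *m U.
Hypothesis G1 : forall v, dot v (G *m v) <= dot v v.
Implicit Types (X : 'M[R]_(m, d)) (i : 'I_m) (v w : 'cV[R]_d).

(* In the coordinates [x_k = U^T s_k] and with [N = m - deff], multiplying by
   [H^(-1/2)] on both sides turns [A^T S^T S A + C0] into [Wmx], hence [Q] into
   [Qr]; [Wloo], [Qloo] and [gam] are the leave-one-out [W_(-i)], [Q_(-i)] and
   [gamma_i = 1 + x_i^T Q_(-i) x_i / N]. *)
Definition smp X i : 'cV[R]_d := (row i X)^T.

Definition Wmx X : 'M[R]_d :=
  N^-1 *: (\sum_k smp X k *m (smp X k)^T) + (1%:M - G).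

Definition Wloo X i : 'M[R]_d :=
  N^-1 *: (\sum_(k | k != i) smp X k *m (smp X k)^T) + (1%:M - G).

Definition Qr X := invmx (Wmx X).

Definition Qloo X i := invmx (Wloo X i).

(** The factor 3 matches the scaling by [sqrt 3] in the hypothesis on the first third of the
    rows. *)
Definition third X (j : nat) : 'M[R]_d :=
  (3 / N) *: (\sum_(k < m | (k %/ q)%N == j) smp X k *m (smp X k)^T).

Definition good X (j : nat) := opb eta (third X j - G).

Definition good_all X := forall j : 'I_3, good X j.

(* Drops the third containing row [i], so that it is independent of that row. *)
Definition good_loo i X := forall j : 'I_3, (j : nat) != (i %/ q)%N -> good X j.

Definition gam X i := 1 + N^-1 * dot (smp X i) (Qloo X i *m smp X i).

Lemma block_lt3 i : (i %/ q < 3)%N.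
Proof. by rewrite ltn_divLR // -mq. Qed.

Lemma sum_blocks (V : nmodType) (F : 'I_m -> V) :
  \sum_k F k = \sum_(j < 3) \sum_(k < m | (k %/ q)%N == j) F k.
Proof.
rewrite (partition_big (fun k : 'I_m => Ordinal (block_lt3 k)) xpredT) //=.
Qed.

Lemma good_all_loo X i : good_all X -> good_loo i X.
Proof. by move=> h j _; exact: h. Qed.

Lemma G_sym : G^T = G.
Proof. by rewrite /G trmx_mul trmxK. Qed.

Lemma G_ge0 v : 0 <= dot v (G *m v).
Proof. by rewrite gram_dot dot_ge0. Qed.

Lemma Wmx_sym X : (Wmx X)^T = Wmx X.
Proof.
by rewrite /Wmx linearD linearZ /= outer_sum_sym linearB /= trmx1 G_sym.
Qed.

Lemma Wloo_sym X i : (Wloo X i)^T = Wloo X i.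
Proof.
by rewrite /Wloo linearD linearZ /= outer_sum_sym linearB /= trmx1 G_sym.
Qed.

Lemma Wmx_loo X i : Wmx X = Wloo X i + N^-1 *: (smp X i *m (smp X i)^T).
Proof.
by rewrite /Wmx /Wloo (bigD1 i) //= scalerDr -addrA addrC.
Qed.

Lemma Wmx_thirds X : Wmx X - 1%:M = 3^-1 *: \sum_(j < 3) (third X j - G).
Proof.
rewrite /third sumrB sumr_const card_ord -scaler_sumr -sum_blocks scalerBr scalerA.
rewrite mulrA mulVf ?pnatr_eq0 // mul1r -[G *+ 3]scaler_nat.
rewrite [3^-1 *: (_ *: G)]scalerA mulVf ?pnatr_eq0 // scale1r.
by rewrite /Wmx addrAC -addrA addKr.
Qed.

Lemma good_opb X : good_all X -> opb eta (Wmx X - 1%:M).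
Proof.
move=> h; rewrite Wmx_thirds.
have -> : eta = `|3^-1| * (eta + eta + eta).
  by rewrite ger0_norm ?invr_ge0 //; field.
apply: opbZ; rewrite !big_ord_recl big_ord0 addr0 addrA.
by do ![apply: opbD]; apply: h.
Qed.

Lemma good_form X j v : good X j ->
  dot v (G *m v) - eta * dot v v <= dot v (third X j *m v) <= dot v (G *m v) + eta * dot v v.
Proof.
move=> h; have := opb_dot v v h; rewrite mulmxBl dotBr ler_norml -mulrA -expr2 sqr_enorm.
lra.
Qed.

Lemma Wmx_coercive X v : good_all X -> 1 / 2 * dot v v <= dot v (Wmx X *m v).
Proof.
move=> /good_opb /opb_dot -/(_ v v); rewrite mulmxBl mul1mx dotBr ler_norml.
rewrite -mulrA -expr2 sqr_enorm => /andP[h1 _].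
have : eta * dot v v <= 1 / 2 * dot v v by rewrite ler_wpM2r ?dot_ge0.
lra.
Qed.

(** Each of the two thirds avoiding row [i] contributes at least [(G - eta) / 3]; the remaining rows
    of the third of [i] are nonnegative and dropped. Altogether [I - G / 3 - (2 / 3) eta >= 1 / 3],
    by [G <= I] and [eta <= 1 / 2]. *)
Lemma Wloo_coercive X i v : good_loo i X -> 3^-1 * dot v v <= dot v (Wloo X i *m v).
Proof.
move=> h; rewrite /Wloo mulmxDl dotDr -scalemxAl dotZr dot_outer_sum.
rewrite mulmxBl mul1mx dotBr.
pose F k := dot v (smp X k) * dot (smp X k) v.
have F0 k : 0 <= F k by rewrite /F dotC -expr2 sqr_ge0.
pose j0 := Ordinal (block_lt3 i).
have key : \sum_(j < 3 | j != j0) (3^-1 * (dot v (G *m v) - eta * dot v v)) <=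
    N^-1 * \sum_(k | k != i) F k.
  apply: (@le_trans _ _ (N^-1 * \sum_(j < 3 | j != j0) \sum_(k < m | (k %/ q)%N == j) F k)).
    rewrite mulr_sumr; apply: ler_sum => j jj.
    have /andP[+ _] := good_form v (h j jj).
    rewrite /third -scalemxAl dotZr dot_outer_sum -/(F _).
    move: (\sum_(k | _) _) => s hs.
    rewrite ler_pdivrMl //; apply: le_trans hs _.
    by rewrite mulrA.
  rewrite ler_pM2l ?invr_gt0 //.
  have -> : \sum_(j < 3 | j != j0) \sum_(k < m | (k %/ q)%N == j) F k =
     \sum_(k < m | (k %/ q)%N != (i %/ q)%N) F k.
    rewrite (partition_big (fun k : 'I_m => Ordinal (block_lt3 k)) (fun j => j != j0)) //=.
    apply: eq_bigr => j jj; apply: eq_bigl => k /=.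
    rewrite -val_eqE /=; case: eqP => [->|]; rewrite ?andbF // andbT.
    by rewrite -val_eqE /= in jj.
  rewrite big_mkcond [leRHS]big_mkcond /=; apply: ler_sum => k _.
  case: (eqVneq k i) => [->|_]; first by rewrite eqxx.
  by case: ifP => _ /=; [exact: lexx|exact: F0].
move: key; rewrite sumr_const cardC1 card_ord -/(F _) /F.
move: (\sum_(k | _) _) => s; have := dot_ge0 v; have := G_ge0 v; have := G1 v.
have : eta * dot v v <= 1 / 2 * dot v v by rewrite ler_wpM2r ?dot_ge0.
rewrite -[_ *+ 3.-1]mulr_natl /=; lra.
Qed.

Lemma Wmx_unit X : good_all X -> Wmx X \in unitmx.
Proof. by move=> h; apply: (@coercive_unit _ _ _ (1/2)) => [|v]; [lra|exact: Wmx_coercive]. Qed.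

Lemma Wloo_unit X i : good_loo i X -> Wloo X i \in unitmx.
Proof. by move=> h; apply: (@coercive_unit _ _ _ 3^-1) => [|v]; [lra|exact: Wloo_coercive]. Qed.

Lemma Qr_opb X : good_all X -> opb 2 (Qr X).
Proof.
move=> h; rewrite (_ : 2 = (1 / 2)^-1 :> R); last by field.
by apply: invmx_coercive => [|v]; [lra|exact: Wmx_coercive].
Qed.

Lemma Qloo_opb X i : good_loo i X -> opb 3 (Qloo X i).
Proof.
move=> h; rewrite (_ : 3 = 3^-1^-1 :> R); last by rewrite invrK.
by apply: invmx_coercive => [|v]; [lra|exact: Wloo_coercive].
Qed.

Lemma Qr_sym X : (Qr X)^T = Qr X.
Proof. exact/invmx_sym/Wmx_sym. Qed.

Lemma Qloo_sym X i : (Qloo X i)^T = Qloo X i.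
Proof. exact/invmx_sym/Wloo_sym. Qed.

Lemma Qloo_ge0 X i v : good_loo i X -> 0 <= dot v (Qloo X i *m v).
Proof.
move=> h; apply: invmx_ge0; last exact: Wloo_unit.
by move=> w; apply: le_trans (Wloo_coercive w h); rewrite mulr_ge0 ?dot_ge0 ?invr_ge0.
Qed.

Lemma gam_ge1 X i : good_loo i X -> 1 <= gam X i.
Proof. by move=> h; rewrite /gam lerDl mulr_ge0 ?Qloo_ge0 // invr_ge0 ltW. Qed.

Lemma Qr_smp X i : good_all X ->
  Qr X *m smp X i = (gam X i)^-1 *: (Qloo X i *m smp X i).
Proof.
move=> h; have hl := good_all_loo (i := i) h.
rewrite /Qr (Wmx_loo X i); apply: sherman_morrison_vec.
- exact: Wloo_unit.
- by rewrite -(Wmx_loo X i); exact: Wmx_unit.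
by rewrite gt_eqF // (lt_le_trans ltr01) //; exact: gam_ge1.
Qed.

Lemma Qr_loo X i w : good_all X ->
  Qr X *m w = Qloo X i *m w -
    (N^-1 / gam X i * dot (smp X i) (Qloo X i *m w)) *: (Qloo X i *m smp X i).
Proof.
move=> h; have hl := good_all_loo (i := i) h.
rewrite /Qr (Wmx_loo X i); apply: sherman_morrison.
- exact: Wloo_unit.
- by rewrite -(Wmx_loo X i); exact: Wmx_unit.
by rewrite gt_eqF // (lt_le_trans ltr01) //; exact: gam_ge1.
Qed.

(** The form at [x_i] of the third containing row [i] has the term [(3 / N) |x_i|^4], and is itself
    at most [(1 + eta) |x_i|^2]. So the rows are bounded surely on the good event. *)
Lemma smp_bound X i : good_all X -> dot (smp X i) (smp X i) <= N / 2.
Proof.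
move=> h; have := good_form (smp X i) (h (Ordinal (block_lt3 i))) => /andP[_].
rewrite /third -scalemxAl dotZr dot_outer_sum (bigD1 i) //=.
set s := \sum_(k | _) _; have s0 : 0 <= s.
  by apply: sumr_ge0 => k _; rewrite dotC -expr2 sqr_ge0.
have := G1 (smp X i); have := dot_ge0 (smp X i).
rewrite le_eqVlt => /predU1P[<- _ _|a0]; first by rewrite divr_ge0 // ltW.
move: (dot _ _) a0 (dot _ (G *m _)) => a a0 b hb hh.
have : 3 / N * (a * a) <= 3 / 2 * a.
  apply: (@le_trans _ _ (3 / N * (a * a + s))).
    by rewrite ler_pM2l ?divr_gt0 // lerDl.
  apply: le_trans hh _.
  have : eta * a <= 1 / 2 * a by rewrite ler_wpM2r // ltW.
  lra.
rewrite mulrA ler_pM2r // mulrAC ler_pdivrMr //; lra.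
Qed.

(** The identity [Q W = I] applied to [w], with [W] expanded. It turns [Q - I] into an average of
    terms indexed by the rows, to which Sherman-Morrison applies. *)
Lemma Qr_resid X v w : good_all X ->
  dot v (Qr X *m w) - dot v w =
  dot v (Qr X *m (G *m w)) -
  N^-1 * \sum_k dot v (Qr X *m smp X k) * dot (smp X k) w.
Proof.
move=> h; have e : Qr X *m (Wmx X *m w) = w by rewrite /Qr mulKmx // Wmx_unit.
rewrite -{2}e /Wmx mulmxDl mulmxBl mul1mx -scalemxAl.
rewrite !(mulmxDr, mulmxN) -scalemxAr !(dotDr, dotNr) dotZr.
have -> : dot v (Qr X *m ((\sum_k smp X k *m (smp X k)^T) *m w)) =
    \sum_k dot v (Qr X *m smp X k) * dot (smp X k) w.
  rewrite dot_mul dot_outer_sum; apply: eq_bigr => k _.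
  by rewrite -dot_mul.
ring.
Qed.

Lemma Qr_trace X (M : 'M[R]_d) : good_all X ->
  \tr (Qr X *m M) - \tr M =
  \tr (Qr X *m (G *m M)) - N^-1 * \sum_k dot (smp X k) (M *m (Qr X *m smp X k)).
Proof.
move=> h; have e : Qr X *m (Wmx X *m M) = M by rewrite /Qr mulKmx // Wmx_unit.
rewrite -{2}e /Wmx mulmxDl mulmxBl mul1mx -scalemxAl.
rewrite mulmxDr mulmxBr -scalemxAr !mxtraceD [\tr (- _)]raddfN /= mxtraceZ.
have -> : \tr (Qr X *m ((\sum_k smp X k *m (smp X k)^T) *m M)) =
    \sum_k dot (smp X k) (M *m (Qr X *m smp X k)).
  rewrite mulmx_suml mulmx_sumr linear_sum; apply: eq_bigr => k _ /=.
  by rewrite [Qr X *m _]mulmxA [Qr X *m (_ *m _)]mulmxA trace_outerM.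
ring.
Qed.

End sketch.

(** * Moments of quadratic forms *)

Section measurable_operator_bound.
Variable R : realType.

Lemma enorm_le_sum p (v : 'cV[R]_p) : enorm v <= \sum_i `|v i 0|.
Proof.
rewrite -(@ler_pXn2r _ 2) ?nnegrE ?enorm_ge0 ?sumr_ge0 // sqr_enorm dotE.
rewrite expr2 mulr_suml; apply: ler_sum => i _.
rewrite (bigD1 i) //= mulrDr -expr2 -normrM -expr2 ger0_norm ?sqr_ge0 // lerDl.
by rewrite mulr_ge0 ?sumr_ge0.
Qed.

Lemma rat_vector_dense p (v : 'cV[R]_p) e : 0 < e ->
  exists u : 'cV[rat]_p, enorm (v - map_mx ratr u) <= e.
Proof.
move=> e0; have he : 0 < e / p.+1%:R by rewrite divr_gt0.
have /choice[f hf] : forall i, exists r : rat, `|v i 0 - ratr r| <= e / p.+1%:R.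
  move=> i; have lt : v i 0 < v i 0 + e / p.+1%:R by rewrite ltrDl.
  have [r] := rat_in_itvoo lt.
  rewrite in_itv /= => /andP[h1 h2]; exists r.
  move: h1 h2; move: (e / _) (ratr r) => a b h1 h2.
  by rewrite ler_norml; apply/andP; split; lra.
exists (\col_i f i); apply: le_trans (enorm_le_sum _) _.
apply: (@le_trans _ _ (\sum_(i < p) (e / p.+1%:R))).
  by apply: ler_sum => i _; rewrite !mxE.
rewrite sumr_const card_ord -[_ *+ p]mulr_natl mulrA ler_pdivrMr ?ltr0n //.
by rewrite mulrC ler_pM2l // ler_nat.
Qed.

(** By continuity of both sides, a countable dense set of test vectors suffices; this makes the good
    events measurable. *)
Lemma opb_rat p k c (M : 'M[R]_(p, k)) : 0 <= c ->
  opb c M <-> forall u : 'cV[rat]_k,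
    enorm (M *m map_mx ratr u) <= c * enorm (map_mx ratr u : 'cV[R]_k).
Proof.
move=> c0; split=> [h u|h v]; first exact: h.
have [b b0 hb] := opb_frobenius M.
apply/ler_addgt0Pr => e e0.
(* The added 1 keeps the denominator positive when [b = c = 0]. *)
have he : 0 < e / (b + c + 1) by rewrite divr_gt0 // ltr_wpDl ?addr_ge0.
have [u hu] := rat_vector_dense v he.
move: (h u) hu; set z := map_mx ratr u => hz hu.
have h1 : enorm (M *m v) <= enorm (M *m z) + enorm (M *m (v - z)).
  by apply: le_trans (enormD _ _); rewrite mulmxBr addrC subrK.
have h2 := hb (v - z).
have h3 : enorm z <= enorm v + enorm (v - z).
  by apply: le_trans (enormB _ _); rewrite opprB addrC subrK.
have h4 : (b + c) * enorm (v - z) <= e.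
  apply: (@le_trans _ _ ((b + c) * (e / (b + c + 1)))).
    by rewrite ler_wpM2l ?addr_ge0.
  rewrite mulrA ler_pdivrMr ?ltr_wpDl ?addr_ge0 // mulrC ler_pM2l //.
  by rewrite lerDl.
have h5 : c * enorm z <= c * (enorm v + enorm (v - z)) by rewrite ler_wpM2l.
lra.
Qed.

Lemma measurable_opb dT (T : measurableType dT) p k c (f : T -> 'M[R]_(p, k)) :
  0 <= c -> mmx f -> measurable [set w | opb c (f w)].
Proof.
move=> c0 mf.
rewrite (_ : [set w | _] = \bigcap_(i in [set: nat])
  [set w | if unpickle i is Some u then
     enorm (f w *m map_mx ratr (u : 'cV[rat]_k)) <= c * enorm (map_mx ratr u : 'cV[R]_k)
     else true]).
  apply: bigcapT_measurable => i; case: (unpickle i) => [u|]; last first.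
    by rewrite (_ : [set _ | _] = setT) //; apply/seteqP; split.
  set b := (_ * _)%R.
  rewrite (_ : [set _ | _] =
    (fun w => dot (f w *m map_mx ratr u) (f w *m map_mx ratr u)) @^-1` `]-oo, b ^+ 2]).
    rewrite -[X in measurable X]setTI; apply: measurable_dot => //.
      by apply: mmxM => //; exact: mmx_cst.
    by apply: mmxM => //; exact: mmx_cst.
  apply/seteqP; split=> w /=; rewrite in_itv /= -sqr_enorm
    ler_pXn2r ?nnegrE ?enorm_ge0 ?mulr_ge0 ?enorm_ge0 //.
apply/seteqP; split=> w /=.
  by move=> /(opb_rat _ c0) h i _ /=; case: (unpickle i).
by move=> h; apply/(opb_rat _ c0) => u; have := h (pickle u) I; rewrite /= pickleK.
Qed.

End measurable_operator_bound.

(** * Second and fourth moments of one row *)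

Section moments.
Context {R : realType} {n d : nat} {U : 'M[R]_(n, d)} {dT' : measure_display}
  {T' : measurableType dT'} {P' : probability T' R}.
Let G := U^T *m U.
Let D := \tr G.
Variables (y : T' -> 'cV[R]_d) (L : R).
Hypotheses (L1 : 1 <= L) (my : mmx y)
  (G1 : forall v, dot v (G *m v) <= dot v v)
  (y_int : forall a b, P'.-integrable setT (EFin \o (fun w => y w a 0 * y w b 0)))
  (y_mean : forall a b, \int[P']_w (y w a 0 * y w b 0) = G a b)
  (y_var : forall B : 'M[R]_d, psd B ->
     ub P' (fun w => (dot (y w) (B *m y w) - \tr (B *m G)) ^+ 2)
       (L * \tr (B *m B *m G))).

Let G_sym : G^T = G. Proof. by rewrite /G trmx_mul trmxK. Qed.
Let D0 : 0 <= D. Proof. exact: trace_gram_ge0. Qed.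
Let L0 : 0 <= L. Proof. exact: le_trans ler01 L1. Qed.

Lemma measurable_quad (B : 'M[R]_d) :
  measurable_fun setT (fun w => dot (y w) (B *m y w)).
Proof. by apply: measurable_dot => //; apply: mmxM => //; exact: mmx_cst. Qed.

Lemma quad_mean (B : 'M[R]_d) :
  P'.-integrable setT (EFin \o (fun w => dot (y w) (B *m y w))) /\
  \int[P']_w dot (y w) (B *m y w) = \tr (B *m G).
Proof.
pose F (p : 'I_d * 'I_d) (w : T') := B p.1 p.2 * (y w p.1 0 * y w p.2 0).
have FE w : dot (y w) (B *m y w) = \sum_p F p w.
  rewrite dotE -(pair_bigA _ (fun a b => F (a, b) w)) /=.
  apply: eq_bigr => a _; rewrite mxE mulr_sumr; apply: eq_bigr => b _.
  by rewrite /F /=; ring.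
have Fi p : P'.-integrable setT (EFin \o F p).
  have := integrableZl measurableT (B p.1 p.2) (y_int p.1 p.2).
  by apply: eq_integrable.
have Fm p : \int[P']_w F p w = B p.1 p.2 * G p.1 p.2.
  by rewrite RintegralZl // y_mean.
have key (r : seq ('I_d * 'I_d)) :
  P'.-integrable setT (EFin \o (fun w => \sum_(p <- r) F p w)) /\
  \int[P']_w (\sum_(p <- r) F p w) = \sum_(p <- r) B p.1 p.2 * G p.1 p.2.
  elim: r => [|p r [IH1 IH2]].
    split; first by under eq_fun do rewrite big_nil; exact: integrable0.
    by under eq_Rintegral do rewrite big_nil; rewrite big_nil Rintegral_cst // mul0r.
  split.
    under eq_fun do rewrite big_cons.
    by have := integrableD measurableT (Fi p) IH1; apply: eq_integrable.
  under eq_Rintegral do rewrite big_cons.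
  by rewrite RintegralD // Fm IH2 big_cons.
have [k1 k2] := key (index_enum _).
split; first by under eq_fun do rewrite FE.
under eq_Rintegral do rewrite FE.
rewrite k2 -(pair_bigA _ (fun a b => B a b * G a b)) /=.
rewrite /mxtrace; apply: eq_bigr => a _; rewrite mxE; apply: eq_bigr => b _.
by rewrite -{1}G_sym mxE.
Qed.

Lemma quad_ub (B : 'M[R]_d) : (forall v, 0 <= dot v (B *m v)) ->
  ub P' (fun w => dot (y w) (B *m y w)) (\tr (B *m G)).
Proof.
move=> B0; have [h1 h2] := quad_mean B.
apply: mean_ub => //; first exact: measurable_quad.
by rewrite h2.
Qed.

Lemma second_moment (v : 'cV[R]_d) : ub P' (fun w => dot v (y w) ^+ 2) (dot v (G *m v)).
Proof.
have h := quad_ub (B := v *m v^T) _.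
rewrite -trace_outerM; suff <- : (fun w => dot (y w) ((v *m v^T) *m y w)) =
   (fun w => dot v (y w) ^+ 2).
  by apply: h => u; rewrite mul_outer dotZr dotC -expr2 sqr_ge0.
by apply/funext => w; rewrite mul_outer dotZr expr2 (dotC (y w)).
Qed.

Lemma scalar_psd (b : R) : 0 <= b -> psd (b%:M : 'M[R]_d).
Proof.
move=> b0; split; first exact: tr_scalar_mx.
move=> x; rewrite -[_ *m _ *m _]mulmxA mul_scalar_mx -scalemxAr mxE -/(dot x x).
by rewrite mulr_ge0 // dot_ge0.
Qed.

Lemma opb_scalar (b : R) : 0 <= b -> opb b (b%:M : 'M[R]_d).
Proof. by move=> b0 v; rewrite mul_scalar_mx enormZ ger0_norm. Qed.

(* The variance hypothesis covers only positive semidefinite matrices: the form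
   of [B] is that of the difference of [B1 = (B + B^T) / 2 + b I] and [b I]. *)
Lemma quad_var (B : 'M[R]_d) b : 0 <= b -> opb b B ->
  ub P' (fun w => (dot (y w) (B *m y w) - \tr (B *m G)) ^+ 2) (10 * L * b ^+ 2 * D).
Proof.
move=> b0 hB; pose B1 := 2^-1 *: (B + B^T) + b%:M.
have oB1 : opb (2 * b) B1.
  rewrite (_ : 2 * b = `|2^-1| * (b + b) + b); last by rewrite ger0_norm; [field|].
  apply: opbD; last exact: opb_scalar.
  by apply: opbZ; apply: opbD => //; apply: opb_tr.
have qB1 v : dot v (B1 *m v) = dot v (B *m v) + b * dot v v.
  rewrite /B1 mulmxDl -scalemxAl mulmxDl mul_scalar_mx !(dotDr, dotZr).
  rewrite [dot v (B^T *m v)]dot_mul trmxK [dot (B *m v) v]dotC.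
  by move: (dot v (B *m v)) (dot v v) => p1 p2; field.
have pB1 : psd B1.
  split.
    by rewrite /B1 linearD linearZ /= linearD /= trmxK tr_scalar_mx (addrC B).
  move=> x; rewrite -mulmxA -/(dot x (B1 *m x)) qB1.
  have := opb_dot x x hB; rewrite ler_norml -mulrA -expr2 sqr_enorm => /andP[h _].
  lra.
have tB1 : \tr (B1 *m G) = \tr (B *m G) + b * D.
  rewrite /B1 mulmxDl -scalemxAl mulmxDl mul_scalar_mx !(mxtraceD, mxtraceZ).
  have -> : \tr (B^T *m G) = \tr (B *m G).
    by rewrite -{1}G_sym -trmx_mul mxtrace_tr mxtrace_mulC.
  by rewrite -/D; field.
have v1 := y_var pB1; have v2 := y_var (scalar_psd b0).
have bound (C : 'M[R]_d) c : 0 <= c -> opb c C -> \tr (C *m C *m G) <= c ^+ 2 * D.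
  move=> c0 hC; apply: le_trans (ler_norm _) _; apply: trace_gram_le.
  by rewrite expr2; apply: opbM.
(* The square of a difference is at most twice the sum of the squares; with operator bounds [2 b]
   for [B1] and [b] for the scalar matrix, this gives [2 * 4 + 2 = 10]. *)
have hs := ubD (ubZ (ler0n R 2) v1) (ubZ (ler0n R 2) v2).
apply: ub_le (ub_dom _ _ hs).
- have := bound _ _ _ oB1; have := bound _ _ b0 (opb_scalar b0).
  rewrite mulr_ge0 // => h1 /(_ isT) h2.
  have : L * \tr (B1 *m B1 *m G) <= L * ((2 * b) ^+ 2 * D) by rewrite ler_wpM2l.
  have : L * \tr (b%:M *m b%:M *m G) <= L * (b ^+ 2 * D) by rewrite ler_wpM2l.
  by rewrite exprMn => k1 k2; lra.
- apply: measurable_funX; apply: measurable_funB => //; exact: measurable_quad.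
move=> w; rewrite sqr_ge0 /= qB1 tB1 mul_scalar_mx dotZr.
rewrite mul_scalar_mx mxtraceZ -/D.
move: (dot _ (B *m _)) (\tr _) (b * dot _ _) (b * D) => p1 p2 p3 p4.
have := sqr_ge0 (p1 + p3 - (p2 + p4) + (p3 - p4)); rewrite !expr2; lra.
Qed.

(** The variance assumption at the rank-one matrix [v v^T] controls the deviation of [(v . y)^2]
    from its mean [v^T G v]; adding the mean back is absorbed by [L >= 1]. *)
Lemma fourth_moment (v : 'cV[R]_d) :
  ub P' (fun w => dot v (y w) ^+ 4) (4 * L * dot v v ^+ 2).
Proof.
have pv : psd (v *m v^T).
  split; first by rewrite trmx_mul trmxK.
  move=> x; rewrite -mulmxA -/(dot x _) mul_outer dotZr dotC -expr2.
  exact: sqr_ge0.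
have h1 := y_var pv.
have vG0 : 0 <= dot v (G *m v) by rewrite gram_dot dot_ge0.
have vG := G1 v.
have h2 := ubD (ubZ (ler0n R 2) h1) (ub_cst P' (mulr_ge0 (ler0n R 2) (sqr_ge0 (dot v (G *m v))))).
apply: ub_le (ub_dom _ _ h2).
- rewrite [v *m v^T *m (v *m v^T)]mulmxA mul_outer -!scalemxAl mxtraceZ trace_outerM.
  have h3 : dot v v * dot v (G *m v) <= dot v v ^+ 2.
    by rewrite expr2 ler_wpM2l ?dot_ge0.
  have h4 : dot v (G *m v) ^+ 2 <= dot v v ^+ 2 by rewrite ler_pXn2r ?nnegrE ?dot_ge0.
  have h5 : L * (dot v v * dot v (G *m v)) <= L * dot v v ^+ 2 by rewrite ler_wpM2l.
  have h6 : 1 * dot v v ^+ 2 <= L * dot v v ^+ 2 by rewrite ler_wpM2r ?sqr_ge0.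
  lra.
- by apply: measurable_funX; apply: measurable_dot => //; exact: mmx_cst.
move=> w; rewrite exprn_even_ge0 //= mul_outer dotZr (dotC (y w)) trace_outerM.
move: (dot v (y w)) (dot v (G *m v)) => a b.
have := sqr_ge0 (a ^+ 2 - 2 * b); rewrite !exprS !expr0; lra.
Qed.

Lemma pair_moment (u v : 'cV[R]_d) c : dot u u <= c -> dot v v <= c ->
  ub P' (fun w => dot u (y w) ^+ 2 * dot v (y w) ^+ 2) (4 * L * c ^+ 2).
Proof.
move=> hu hv.
have h := ubZ (k := 2^-1) _ (ubD (fourth_moment u) (fourth_moment v)).
have c0 : 0 <= c by apply: le_trans hu; exact: dot_ge0.
apply: ub_le (ub_dom _ _ (h _)); last by rewrite invr_ge0.
- have h1 : L * dot u u ^+ 2 <= L * c ^+ 2.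
    by rewrite ler_wpM2l // ler_pXn2r ?nnegrE ?dot_ge0.
  have h2 : L * dot v v ^+ 2 <= L * c ^+ 2.
    by rewrite ler_wpM2l // ler_pXn2r ?nnegrE ?dot_ge0.
  lra.
- by apply: measurable_funM; apply: measurable_funX; apply: measurable_dot => //; exact: mmx_cst.
move=> w; rewrite mulr_ge0 ?sqr_ge0 //=.
move: (dot _ _) (dot _ _) => a b.
have := sqr_ge0 (a ^+ 2 - b ^+ 2); rewrite !exprS !expr0; lra.
Qed.

End moments.

(* The law [P] of the [m] rows, in the coordinates [x = U^T s]: each row can be
   redrawn independently with the law of [y]. *)
Record sketch_model (R : realType) (n d m q : nat) (U : 'M[R]_(n, d))
    (N eta L : R) (dT' : measure_display) (T' : measurableType dT')
    (P' : probability T' R) (y : T' -> 'cV[R]_d)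
    (P : probability 'M[R]_(m, d) R) : Prop := SketchModel {
  model_rows : m = (3 * q)%N;
  model_rows_gt0 : (0 < q)%N;
  model_N : N = m%:R - \tr (U^T *m U);
  model_deff : 2 * \tr (U^T *m U) <= m%:R;
  model_eta_ge0 : 0 <= eta;
  model_eta : eta <= 1 / 2;
  model_gram : forall v, dot v (U^T *m U *m v) <= dot v v;
  model_L : 1 <= L;
  model_meas : mmx y;
  model_int : forall a b,
    P'.-integrable setT (EFin \o (fun w => y w a 0 * y w b 0));
  model_mean : forall a b, \int[P']_w (y w a 0 * y w b 0) = (U^T *m U) a b;
  model_var : forall B : 'M[R]_d, psd B ->
     ub P' (fun w => (dot (y w) (B *m y w) - \tr (B *m (U^T *m U))) ^+ 2)
       (L * \tr (B *m B *m (U^T *m U)));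
  model_resample : forall i (f : 'M[R]_(m, d) -> \bar R),
    measurable_fun setT f -> (forall M, (0 <= f M)%E) ->
    (\int[P]_M f M = \int[P]_M \int[P']_w f (repl i (y w)^T M))%E;
  model_good : (P (~` [set M : 'M[R]_(m, d) | good_all q U N eta M]) <= (m%:R ^- 3)%:E)%E
}.

(** * Redrawing one row: bounds on conditional means *)

Section model_facts.
Context {R : realType} {n d m q : nat} {U : 'M[R]_(n, d)} {N eta L : R}
  {dT' : measure_display} {T' : measurableType dT'} {P' : probability T' R}
  {y : T' -> 'cV[R]_d} {P : probability 'M[R]_(m, d) R}.
Hypothesis H : sketch_model q U N eta L P' y P.
Local Notation G := (U^T *m U).
Local Notation D := (\tr G).
Local Notation x := (@smp R d m).
Local Notation Q := (@Qr R n d m U N).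
Local Notation Qi M i := (@Qloo R n d m U N M i).
Local Notation A := [set M : 'M[R]_(m, d) | good_all q U N eta M].
Local Notation A' i := [set M : 'M[R]_(m, d) | good_loo q U N eta i M].

Implicit Types (i : 'I_m) (M : 'M[R]_(m, d)) (v : 'cV[R]_d).

Lemma model_m_gt0 : 0 < m%:R :> R.
Proof.
by rewrite ltr0n (model_rows H) muln_gt0 /= (model_rows_gt0 H).
Qed.

Lemma model_D_ge0 : 0 <= D.
Proof. exact: trace_gram_ge0. Qed.

Lemma model_N_half : m%:R <= 2 * N.
Proof. have := model_deff H; have := model_N H; lra. Qed.

Lemma model_N_gt0 : 0 < N.
Proof. have := model_N_half; have := model_m_gt0; lra. Qed.

Lemma model_L_ge0 : 0 <= L.
Proof. exact: le_trans ler01 (model_L H). Qed.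

Lemma G_opb1 : opb 1 G.
Proof. by apply: gram_opb => // v; rewrite mul1r (model_gram H). Qed.

Lemma D_le_sqrt (a : R) : 0 <= a -> a <= 1 -> a <= D -> a <= Num.sqrt D.
Proof.
move=> a0 a1 aD; rewrite -(@ler_pXn2r _ 2) ?nnegrE ?sqrtr_ge0 //.
by rewrite sqr_sqrtr ?model_D_ge0 //; nra.
Qed.

(** [min (1, D) <= sqrt D] treats [D <= 1] and [D > 1] together. It is the source of [sqrt deff] in
    the terms bounded by second moments alone. *)
Lemma gram_sqrt v : dot v (G *m v) <= Num.sqrt D * dot v v.
Proof.
have := model_gram H v; have := gram_le_trace U v; have := dot_ge0 v.
have [D1 _ h _|D1 _ _ h] := leP D 1.
  apply: le_trans h _; rewrite ler_wpM2r ?dot_ge0 //.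
  by apply: D_le_sqrt => //; exact: model_D_ge0.
apply: le_trans h _; rewrite ler_peMl ?dot_ge0 //.
by rewrite -sqrtr1 ler_sqrt ?model_D_ge0 // ltW.
Qed.

Lemma measurable_smp i : mmx (fun M => x M i).
Proof. by apply: mmx_tr; apply: mmx_row; exact: mmx_id. Qed.

Lemma measurable_outer_sum (p : pred 'I_m) :
  mmx (fun M => \sum_(k | p k) x M k *m (x M k)^T).
Proof.
apply: mmx_sum => k; apply: mmxM; first exact: measurable_smp.
by apply: mmx_tr; exact: measurable_smp.
Qed.

Lemma measurable_Qr : mmx Q.
Proof.
apply: mmx_inv; apply: mmxD; last exact: mmx_cst.
by apply: mmxZ => //; exact: (measurable_outer_sum xpredT).
Qed.

Lemma measurable_Qloo i : mmx (fun M => Qi M i).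
Proof.
apply: mmx_inv; apply: mmxD; last exact: mmx_cst.
by apply: mmxZ => //; exact: (measurable_outer_sum (fun k => k != i)).
Qed.

Lemma measurable_gam i : measurable_fun setT (fun M => gam U N M i).
Proof.
apply: measurable_funD => //; apply: measurable_funM => //.
apply: measurable_dot; first exact: measurable_smp.
by apply: mmxM; [exact: measurable_Qloo|exact: measurable_smp].
Qed.

Lemma measurable_good j : measurable [set M | @good R n d m q U N eta M j].
Proof.
apply: measurable_opb; first exact: model_eta_ge0 H.
apply: mmxB; last exact: mmx_cst.
by apply: mmxZ => //; exact: (measurable_outer_sum (fun k => (k %/ q)%N == j)).
Qed.

Lemma measurable_good_all : measurable A.
Proof.
rewrite (_ : A = \bigcap_(j in [set: 'I_3]) [set M : 'M[R]_(m, d) | good q U N eta M j]).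
  by apply: fin_bigcap_measurable => [|j _]; [exact: finite_finset|exact: measurable_good].
by apply/seteqP; split=> M h j; [move=> _; exact: h|exact: (h j I)].
Qed.

Lemma measurable_good_loo i : measurable (A' i).
Proof.
rewrite (_ : A' i = \bigcap_(j in [set j : 'I_3 | (j : nat) != (i %/ q)%N])
   [set M : 'M[R]_(m, d) | good q U N eta M j]).
  by apply: fin_bigcap_measurable => [|j _]; [exact: finite_finset|exact: measurable_good].
by apply/seteqP; split=> M h j jj; exact: (h j jj).
Qed.

Lemma measurable_indic_all : measurable_fun setT (\1_A : _ -> R).
Proof. by apply: measurable_indic; exact: measurable_good_all. Qed.

Lemma measurable_indic_loo i : measurable_fun setT (\1_(A' i) : _ -> R).
Proof. by apply: measurable_indic; exact: measurable_good_loo. Qed.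

Lemma smp_repl i (r : 'rV[R]_d) M k :
  x (repl i r M) k = if k == i then r^T else x M k.
Proof. by rewrite /smp row_repl; case: eqP. Qed.

Lemma Qloo_repl i (r : 'rV[R]_d) M : Qi (repl i r M) i = Qi M i.
Proof.
rewrite /Qloo /Wloo; congr (invmx (_ *: _ + _)); apply: eq_bigr => k /negPf ki.
by rewrite smp_repl ki.
Qed.

Lemma good_loo_repl i (r : 'rV[R]_d) M :
  good_loo q U N eta i (repl i r M) <-> good_loo q U N eta i M.
Proof.
suff e (j : 'I_3) : (j : nat) != (i %/ q)%N -> third q N (repl i r M) j = third q N M j.
  by split=> h j ji; have := h j ji; rewrite /good e.
move=> ji; rewrite /third; congr (_ *: _); apply: eq_bigr => k /eqP kj.
rewrite smp_repl; case: eqP => // ki; by rewrite -kj ki eqxx in ji.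
Qed.

Lemma indic_good (B : set 'M[R]_(m, d)) M : B M -> (\1_B M : R) = 1.
Proof. by move=> h; rewrite indicE mem_set. Qed.

Lemma indic_bad (B : set 'M[R]_(m, d)) M : ~ B M -> (\1_B M : R) = 0.
Proof. by move=> h; rewrite indicE memNset. Qed.

Lemma indic_loo_repl i (r : 'rV[R]_d) M :
  (\1_(A' i) (repl i r M) : R) = \1_(A' i) M.
Proof.
have [h1 h2] := good_loo_repl i r M.
have [h|h] := pselect (A' i M).
  by rewrite (indic_good h) (indic_good (B := A' i) (h2 h)).
by rewrite (indic_bad h) (indic_bad (B := A' i) (fun k => h (h1 k))).
Qed.

Lemma measurable_repl i : measurable_fun setT (fun p : 'M[R]_(m, d) * T' => repl i (y p.2)^T p.1).
Proof.
apply/measurable_mmx => k l; under eq_fun do rewrite mxE; case: eqP => _.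
  under eq_fun do rewrite mxE.
  exact: (measurableT_comp (model_meas H l 0) measurable_snd).
exact: (measurableT_comp (@mmx_id R m d k l) measurable_fst).
Qed.

(** A bound given the other rows passes to the mean: [A' i] ignores row [i], so redrawing that row
    leaves the indicator fixed, and [k M] bounds the inner integral. *)
Lemma cond_ub i (h k : 'M[R]_(m, d) -> R) c :
  measurable_fun setT h ->
  (forall M, A' i M -> 0 <= h M) ->
  (forall M, A' i M -> ub P' (fun w => h (repl i (y w)^T M)) (k M)) ->
  ub P (fun M => \1_(A' i) M * k M) c ->
  ub P (fun M => \1_(A' i) M * h M) c.
Proof.
move=> mh h0 hk [mk k0 kc].
have mF : measurable_fun setT (fun M => \1_(A' i) M * h M).
  apply: measurable_funM => //; exact: measurable_indic_loo.
have F0 M : 0 <= \1_(A' i) M * h M.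
  have [hM|hM] := pselect (A' i M); last by rewrite (indic_bad hM) mul0r.
  by rewrite mulr_ge0 // h0.
split=> //; apply: le_trans kc.
rewrite (model_resample H i); last 2 first.
- exact/measurable_EFinP.
- by move=> M; rewrite lee_fin.
apply: ge0_le_integral => //.
- by move=> M _; apply: integral_ge0 => w _; rewrite lee_fin.
- have mf : measurable_fun setT (fun p : 'M[R]_(m, d) * T' =>
     (\1_(A' i) (repl i (y p.2)^T p.1) * h (repl i (y p.2)^T p.1))%:E).
    apply/measurable_EFinP; apply: (measurableT_comp mF); exact: measurable_repl.
  by have := @measurable_fun_fubini_tonelli_F _ _ _ _ R P' _ mf (fun p => F0 _).
- exact/measurable_EFinP.
move=> M _; have [hM|hM] := pselect (A' i M).
  rewrite (indic_good hM) mul1r; have [_ _] := hk M hM.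
  apply: le_trans; rewrite le_eqVlt; apply/orP; left; apply/eqP.
  apply: eq_integral => w _; congr EFin.
  by rewrite indic_loo_repl (indic_good hM) mul1r.
rewrite (indic_bad hM) mul0r (eq_integral (cst 0%E)) ?integral0 // => w _ /=.
by rewrite indic_loo_repl (indic_bad hM) mul0r.
Qed.

Lemma cond_ub_cst i (h : 'M[R]_(m, d) -> R) c : 0 <= c ->
  measurable_fun setT h ->
  (forall M, A' i M -> 0 <= h M) ->
  (forall M, A' i M -> ub P' (fun w => h (repl i (y w)^T M)) c) ->
  ub P (fun M => \1_(A' i) M * h M) c.
Proof.
move=> c0 mh h0 hk; apply: (cond_ub mh h0 hk).
apply: ub_dom (ub_cst P c0).
  by apply: measurable_funM => //; exact: measurable_indic_loo.
move=> M; rewrite mulr_ge0 //= -[leRHS]mul1r ler_wpM2r //.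
Qed.

(** Invariance under [repl i] encodes independence of row [i]. The norm is bounded only on [A' i],
    where the leave-one-out inverse is controlled. *)
Definition loo_vec i c (a : 'M[R]_(m, d) -> 'cV[R]_d) :=
  [/\ mmx a, forall r M, a (repl i r M) = a M & forall M, A' i M -> enorm (a M) <= c].

Lemma loo_vec_cst i (v : 'cV[R]_d) c : enorm v <= c -> loo_vec i c (fun=> v).
Proof. by move=> vc; split=> //; exact: mmx_cst. Qed.

Lemma loo_vec_Q i c a : loo_vec i c a -> loo_vec i (3 * c) (fun M => Qi M i *m a M).
Proof.
move=> [ma ra ca]; split.
- by apply: mmxM => //; exact: measurable_Qloo.
- by move=> r M; rewrite Qloo_repl ra.
move=> M hM; apply: le_trans (Qloo_opb (model_rows H) (model_rows_gt0 H)
  model_N_gt0 (model_eta H) (model_gram H) hM _) _.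
by rewrite ler_pM2l // ca.
Qed.

Lemma loo_vec_le i c c' a : c <= c' -> loo_vec i c a -> loo_vec i c' a.
Proof. by move=> cc [? ? ca]; split=> // M /ca h; exact: le_trans h cc. Qed.

Lemma measurable_loo_dot i c a : loo_vec i c a ->
  measurable_fun setT (fun M => dot (a M) (x M i)).
Proof. by case=> ma _ _; apply: measurable_dot => //; exact: measurable_smp. Qed.

Lemma enorm_sqr_le (v : 'cV[R]_d) c : enorm v <= c -> dot v v <= c ^+ 2.
Proof.
move=> h; rewrite -sqr_enorm ler_pXn2r ?nnegrE ?enorm_ge0 //.
by apply: le_trans h; exact: enorm_ge0.
Qed.

Lemma ub_loo_sqr i c a : loo_vec i c a ->
  ub P (fun M => \1_(A' i) M * dot (a M) (x M i) ^+ 2) (Num.sqrt D * c ^+ 2).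
Proof.
move=> la; have [ma ra ca] := la; apply: cond_ub_cst.
- by rewrite mulr_ge0 ?sqrtr_ge0 ?sqr_ge0.
- by apply: measurable_funX; exact: measurable_loo_dot la.
- by move=> M _; exact: sqr_ge0.
move=> M hM; under eq_fun do rewrite ra smp_repl eqxx trmxK.
apply: ub_le (second_moment (model_meas H) (model_int H) (model_mean H) (a M)).
apply: le_trans (gram_sqrt _) _; rewrite ler_wpM2l ?sqrtr_ge0 //.
by apply: enorm_sqr_le; exact: ca.
Qed.

Lemma ub_loo_pair i c a b : loo_vec i c a -> loo_vec i c b ->
  ub P (fun M => \1_(A' i) M * (dot (a M) (x M i) ^+ 2 * dot (b M) (x M i) ^+ 2))
    (4 * L * c ^+ 4).
Proof.
move=> la lb; have [ma ra ca] := la; have [mb rb cb] := lb.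
apply: cond_ub_cst.
- by apply: mulr_ge0; [apply: mulr_ge0 => //; exact: model_L_ge0|exact: exprn_even_ge0].
- by apply: measurable_funM; apply: measurable_funX;
    [exact: measurable_loo_dot la|exact: measurable_loo_dot lb].
- by move=> M _; rewrite mulr_ge0 ?sqr_ge0.
move=> M hM; under eq_fun do rewrite ra rb smp_repl eqxx trmxK.
rewrite (_ : c ^+ 4 = (c ^+ 2) ^+ 2); last by rewrite -exprM.
apply: (pair_moment (model_L H) (model_meas H) (model_gram H) (model_var H));
  apply: enorm_sqr_le; [exact: ca|exact: cb].
Qed.

Definition loo_mx i b (B : 'M[R]_(m, d) -> 'M[R]_d) :=
  [/\ mmx B, forall r M, B (repl i r M) = B M & forall M, A' i M -> opb b (B M)].

(** When [B] does not depend on row [i], this has mean zero given the other rows, since [x_i] has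
    second moment [G]. *)
Definition fluct (B : 'M[R]_(m, d) -> 'M[R]_d) i M :=
  dot (x M i) (B M *m x M i) - \tr (B M *m G).

Lemma measurable_form i B : mmx B ->
  measurable_fun setT (fun M => dot (x M i) (B M *m x M i)).
Proof.
move=> mB; apply: measurable_dot; first exact: measurable_smp.
by apply: mmxM => //; exact: measurable_smp.
Qed.

Lemma measurable_fluct i B : mmx B -> measurable_fun setT (fluct B i).
Proof.
move=> mB; apply: measurable_funB; first exact: measurable_form.
by apply: measurable_tr; apply: mmxM => //; exact: mmx_cst.
Qed.

Lemma ub_fluct i b B : 0 <= b -> loo_mx i b B ->
  ub P (fun M => \1_(A' i) M * fluct B i M ^+ 2) (10 * L * b ^+ 2 * D).
Proof.
move=> b0 [mB rB hB]; apply: cond_ub_cst.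
- by rewrite !mulr_ge0 ?sqr_ge0 ?model_L_ge0 ?model_D_ge0.
- by apply: measurable_funX; exact: measurable_fluct.
- by move=> M _; exact: sqr_ge0.
move=> M hM; rewrite /fluct; under eq_fun do rewrite rB smp_repl eqxx trmxK.
by apply: (quad_var (model_L H) (model_meas H) (model_var H)) => //; exact: hB.
Qed.

Lemma resample_form i (B : 'M[R]_(m, d) -> 'M[R]_d) : mmx B ->
  (forall r M, B (repl i r M) = B M) ->
  (forall M v, A' i M -> 0 <= dot v (B M *m v)) ->
  (\int[P]_M (\1_(A' i) M * dot (x M i) (B M *m x M i))%:E =
   \int[P]_M (\1_(A' i) M * \tr (B M *m G))%:E)%E.
Proof.
move=> mB rB B0; rewrite (model_resample H i); last 2 first.
- apply/measurable_EFinP; apply: measurable_funM; last exact: measurable_form.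
  exact: measurable_indic_loo.
- move=> M; rewrite lee_fin.
  have [hM|hM] := pselect (A' i M); last by rewrite (indic_bad hM) mul0r.
  by rewrite mulr_ge0 // B0.
apply: eq_integral => M _.
under eq_integral do rewrite indic_loo_repl rB smp_repl eqxx trmxK.
have [hM|hM] := pselect (A' i M); last first.
  rewrite (indic_bad hM) mul0r.
  by under eq_integral do rewrite mul0r; rewrite integral0.
rewrite (indic_good hM) mul1r; under eq_integral do rewrite mul1r.
have [h1 h2] := quad_mean (model_int H) (model_mean H) (B M).
by rewrite -h2 /Rintegral fineK //; exact: (integrable_fin_num _ h1).
Qed.

(** [resample_form] rests on Tonelli and needs a nonnegative form, so it is applied to [B + b I] and
    to [b I], and the two identities are subtracted. *)
Lemma fluct_mean i b B : 0 <= b -> loo_mx i b B ->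
  mb P (fun M => \1_(A' i) M * fluct B i M) 0.
Proof.
move=> b0 [mB rB hB].
have mI : measurable_fun setT (\1_(A' i) : _ -> R) by exact: measurable_indic_loo.
pose B1 M : 'M[R]_d := B M + b%:M.
have mB1 : mmx B1 by apply: mmxD => //; exact: mmx_cst.
have rB1 r M : B1 (repl i r M) = B1 M by rewrite /B1 rB.
have qB1 M v : dot v (B1 M *m v) = dot v (B M *m v) + b * dot v v.
  by rewrite /B1 mulmxDl mul_scalar_mx dotDr dotZr.
have pB1 M v : A' i M -> 0 <= dot v (B1 M *m v).
  move=> hM; rewrite qB1; have := opb_dot v v (hB M hM).
  by rewrite ler_norml -mulrA -expr2 sqr_enorm => /andP[+ _]; lra.
have pb M v : A' i M -> 0 <= dot v (b%:M *m v).
  by move=> _; rewrite mul_scalar_mx dotZr mulr_ge0 ?dot_ge0.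
have bI M : (\1_(A' i) M : R) <= 1 by rewrite indicE; case: (_ \in _).
have I0 M : 0 <= (\1_(A' i) M : R) by [].
have tb M : A' i M -> `|\tr (B M *m G)| <= b * D by move=> hM; apply: trace_gram_le; exact: hB.
have tB1 M : \tr (B1 M *m G) = \tr (B M *m G) + b * D.
  by rewrite /B1 mulmxDl mxtraceD mul_scalar_mx mxtraceZ.
have bD0 : 0 <= b * D by rewrite mulr_ge0 ?model_D_ge0.
have ubT : ub P (fun M => \1_(A' i) M * \tr (B1 M *m G)) (2 * (b * D)).
  apply: ub_dom (ub_cst P (mulr_ge0 (ler0n R 2) bD0)).
    apply: measurable_funM => //; apply: measurable_tr.
    by apply: mmxM => //; exact: (mmx_cst G).
  move=> M; have [hM|hM] := pselect (A' i M); last first.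
    by rewrite (indic_bad hM) mul0r lexx mulr_ge0.
  rewrite (indic_good hM) mul1r tB1; have := tb M hM; rewrite ler_norml; lra.
have ub1 : ub P (fun M => \1_(A' i) M * dot (x M i) (B1 M *m x M i)) (2 * (b * D)).
  split.
  - by apply: measurable_funM => //; exact: measurable_form.
  - move=> M; have [hM|hM] := pselect (A' i M); last by rewrite (indic_bad hM) mul0r.
    by rewrite mulr_ge0 // pB1.
  by rewrite resample_form //; case: ubT.
have mcst : mmx (fun _ : 'M[R]_(m, d) => b%:M : 'M[R]_d) by exact: mmx_cst.
have ubT2 : ub P (fun M => \1_(A' i) M * \tr ((b%:M : 'M[R]_d) *m G)) (b * D).
  apply: ub_dom (ub_cst P bD0).
    by apply: measurable_funM.
  move=> M; rewrite mul_scalar_mx mxtraceZ mulr_ge0 //=.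
  by rewrite -[leRHS]mul1r ler_wpM2r.
have ub2 : ub P (fun M => \1_(A' i) M * dot (x M i) (b%:M *m x M i)) (b * D).
  split.
  - by apply: measurable_funM => //; exact: (measurable_form i mcst).
  - by move=> M; rewrite mulr_ge0 // mul_scalar_mx dotZr mulr_ge0 // dot_ge0.
  by rewrite (@resample_form i (fun=> b%:M)) //; case: ubT2.
have e1 := congr1 fine (resample_form mB1 rB1 pB1).
have e2 := congr1 fine (@resample_form i (fun=> b%:M) mcst (fun _ _ => erefl) pb).
have i1 := ub_integrable ub1; have i2 := ub_integrable ub2.
have iT := ub_integrable ubT; have iT2 := ub_integrable ubT2.
have E : (fun M => \1_(A' i) M * fluct B i M) = (fun M =>
   (\1_(A' i) M * dot (x M i) (B1 M *m x M i) - \1_(A' i) M * \tr (B1 M *m G)) -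
   (\1_(A' i) M * dot (x M i) (b%:M *m x M i) - \1_(A' i) M * \tr ((b%:M : 'M[R]_d) *m G))).
  apply/funext => M; rewrite qB1 tB1 mul_scalar_mx dotZr mul_scalar_mx mxtraceZ.
  by rewrite /fluct; ring.
have iA : P.-integrable setT (EFin \o (fun M =>
    \1_(A' i) M * dot (x M i) (B1 M *m x M i) - \1_(A' i) M * \tr (B1 M *m G))).
  by have := integrableB measurableT i1 iT; apply: eq_integrable.
have iB : P.-integrable setT (EFin \o (fun M =>
    \1_(A' i) M * dot (x M i) (b%:M *m x M i) - \1_(A' i) M * \tr ((b%:M : 'M[R]_d) *m G))).
  by have := integrableB measurableT i2 iT2; apply: eq_integrable.
rewrite E; split.
  by have := integrableB measurableT iA iB; apply: eq_integrable.
rewrite RintegralB // RintegralB // RintegralB //.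
by rewrite /Rintegral e1 e2 !subrr normr0.
Qed.

Lemma bad_event i : (P (A' i `\` A) <= (m%:R ^- 3)%:E)%E.
Proof.
apply: le_trans (model_good H); apply: le_measure; rewrite ?inE.
- exact: measurableD (measurable_good_loo i) measurable_good_all.
- exact: measurableC measurable_good_all.
by move=> M [].
Qed.

(* The fluctuation is centred on [A' i], which is independent of row [i];
   passing to the smaller event [A] costs a factor [P (A' i \ A) ^ (1/2)]. *)
Lemma mb_fluct i b B : 0 <= b -> loo_mx i b B ->
  mb P (fun M => \1_A M * fluct B i M) (4 * L * b * (Num.sqrt D / m%:R)).
Proof.
move=> b0 lB; have h0 := fluct_mean b0 lB; have [mB _ _] := lB.
have mF := measurable_fluct i mB.
have mA := measurable_good_all; have mAi := measurable_good_loo i.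
have mAD : measurable (A' i `\` A) by exact: measurableD.
have mI' : measurable_fun setT (\1_(A' i) : _ -> R) by exact: measurable_indic.
have mID : measurable_fun setT (\1_(A' i `\` A) : _ -> R) by exact: measurable_indic.
have u1 : ub P (fun M => (\1_(A' i `\` A) M : R) ^+ 2) (m%:R ^- 3).
  have -> : (fun M => (\1_(A' i `\` A) M : R) ^+ 2) = \1_(A' i `\` A).
    by apply/funext => M; rewrite indicE; case: (_ \in _); rewrite ?expr1n ?expr0n.
  exact: ub_indic mAD (bad_event i).
have u2 : ub P (fun M => (\1_(A' i) M * fluct B i M) ^+ 2) (10 * L * b ^+ 2 * D).
  have -> : (fun M => (\1_(A' i) M * fluct B i M) ^+ 2) =
     (fun M => \1_(A' i) M * fluct B i M ^+ 2).
    by apply/funext => M; rewrite exprMn indicE; case: (_ \in _); rewrite ?expr1n ?expr0n.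
  exact: ub_fluct.
have mF' : measurable_fun setT (fun M => \1_(A' i) M * fluct B i M) by exact: measurable_funM.
have u3 := ub_cauchy mID mF' u1 u2.
have h3 := mb_ub (measurable_funM mID mF') (fun w => lexx _) u3.
have := mbD h0 (mbN h3); rewrite add0r => h4.
apply: mb_le (eq_mb _ h4).
  have m1 : 1 <= m%:R :> R by rewrite ler1n -(@ltr0n R) model_m_gt0.
  have -> : 4 * L * b * (Num.sqrt D / m%:R) = m%:R^-1 * (4 * L * b * Num.sqrt D) by ring.
  have q1 : 0 <= Num.sqrt (m%:R ^- 3) * Num.sqrt (10 * L * b ^+ 2 * D).
    by rewrite mulr_ge0 ?sqrtr_ge0.
  have q2 : 0 <= m%:R^-1 * (4 * L * b * Num.sqrt D).
    by rewrite !mulr_ge0 ?sqrtr_ge0 ?model_L_ge0 // invr_ge0 ltW ?model_m_gt0.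
  (* The squares are compared factor by factor: [m^-3 <= m^-2] and [10 L <= 16 L^2]. *)
  suff : (Num.sqrt (m%:R ^- 3) * Num.sqrt (10 * L * b ^+ 2 * D)) ^+ 2 <=
      (m%:R^-1 * (4 * L * b * Num.sqrt D)) ^+ 2 by rewrite ler_pXn2r.
  have p1 : 0 <= m%:R ^- 3 :> R by rewrite invr_ge0 exprn_ge0.
  have p2 : 0 <= 10 * L * b ^+ 2 * D.
    by rewrite !mulr_ge0 ?sqr_ge0 ?model_L_ge0 ?model_D_ge0.
  rewrite [leLHS]exprMn (sqr_sqrtr p1) (sqr_sqrtr p2).
  rewrite !exprMn (sqr_sqrtr model_D_ge0).
  apply: ler_pM.
  - by rewrite invr_ge0 exprn_ge0.
  - by rewrite !mulr_ge0 ?sqr_ge0 ?model_L_ge0 ?model_D_ge0.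
  - by rewrite exprVn lef_pV2 ?posrE ?exprn_gt0 ?model_m_gt0 // ler_weXn2l.
  apply: ler_wpM2r; first exact: model_D_ge0.
  apply: ler_wpM2r; first exact: sqr_ge0.
  have := model_L H; rewrite expr2; nra.
move=> M /=; have [hM|hM] := pselect (A' i M); last first.
  rewrite (indic_bad hM) !(mul0r, mulr0, oppr0, addr0) indic_bad ?mul0r //.
  by move=> h; apply: hM; exact: good_all_loo.
rewrite (indic_good hM) !mul1r.
have [h|h] := pselect (A M).
  by rewrite (indic_good h) indic_bad ?mul0r ?subr0 ?mul1r // => -[].
by rewrite (indic_bad h) mul0r indic_good ?mul1r ?subrr.
Qed.

Lemma loo_mx_outer i ca cb a b : loo_vec i ca a -> loo_vec i cb b ->
  loo_mx i (ca * cb) (fun M => a M *m (b M)^T).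
Proof.
move=> [ma ra ha] [mb rb hb]; split.
- by apply: mmxM => //; exact: mmx_tr.
- by move=> r M; rewrite ra rb.
move=> M hM; apply: opb_le (opb_outer _ _).
by rewrite ler_pM ?enorm_ge0 ?ha ?hb.
Qed.

Lemma mb_fluct_vec i ca cb a b : 0 <= ca -> 0 <= cb ->
  loo_vec i ca a -> loo_vec i cb b ->
  mb P (fun M => \1_A M * (dot (b M) (x M i) * dot (x M i) (a M) - dot (b M) (G *m a M)))
    (4 * L * (ca * cb) * (Num.sqrt D / m%:R)).
Proof.
move=> ca0 cb0 la lb.
apply: eq_mb (mb_fluct (mulr_ge0 ca0 cb0) (loo_mx_outer la lb)) => M.
by rewrite /fluct mul_outer dotZr trace_outerM.
Qed.

End model_facts.

Lemma mxtraceB (R : nzRingType) d (B C : 'M[R]_d) : \tr (B - C) = \tr B - \tr C.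
Proof. exact: linearB. Qed.

(** * Concentration of the leave-one-out traces *)

Section trace_deviation.
Context {R : realType} {n d m q : nat} {U : 'M[R]_(n, d)} {N eta L : R}
  {dT' : measure_display} {T' : measurableType dT'} {P' : probability T' R}
  {y : T' -> 'cV[R]_d} {P : probability 'M[R]_(m, d) R}.
Hypothesis H : sketch_model q U N eta L P' y P.
Local Notation G := (U^T *m U).
Local Notation D := (\tr G).
Local Notation x := (@smp R d m).
Local Notation Q := (@Qr R n d m U N).
Local Notation Qi M i := (@Qloo R n d m U N M i).
Local Notation A := [set M : 'M[R]_(m, d) | good_all q U N eta M].
Local Notation A' i := [set M : 'M[R]_(m, d) | good_loo q U N eta i M].
Implicit Types (i : 'I_m) (M : 'M[R]_(m, d)) (v : 'cV[R]_d).

Let mq := model_rows H.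
Let q0 := model_rows_gt0 H.
Let N0 : 0 < N := model_N_gt0 H.
Let eta1 := model_eta H.
Let G1 := model_gram H.
Let D0 : 0 <= D := model_D_ge0.
Let L0 : 0 <= L := model_L_ge0 H.
Let L1 : 1 <= L := model_L H.

Lemma mulmx_ext p k (B C : 'M[R]_(p, k)) : (forall v : 'cV_k, B *m v = C *m v) -> B = C.
Proof.
move=> h; apply/matrixP => a b; have := h (delta_mx b 0).
by rewrite -!colE => /colP/(_ a); rewrite !mxE.
Qed.

Lemma Qr_loo_mx M i : A M ->
  Q M = Qi M i - (N^-1 / gam U N M i) *: ((Qi M i *m x M i) *m (Qi M i *m x M i)^T).
Proof.
move=> hM; apply: mulmx_ext => v; rewrite (Qr_loo mq q0 N0 eta1 G1 i v hM).
rewrite mulmxBl -scalemxAl mul_outer scalerA.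
by rewrite [dot (_ *m x M i) v]dotC dot_mul Qloo_sym [dot _ (x M i)]dotC.
Qed.

(** On the good event [|Qi x_i|^2 <= 9 N / 2] and [gamma_i >= 1], so the factor [1 / N] leaves
    [9 / 2]. Deleting one row therefore changes a trace by [O(1)], whatever the dimension. *)
Lemma loo_form_bound M i c (C : 'M[R]_d) : 0 <= c -> A M -> opb c C ->
  `|N^-1 / gam U N M i * dot (Qi M i *m x M i) (C *m (Qi M i *m x M i))| <= 9 / 2 * c.
Proof.
move=> c0 hM hC; have hM' := @good_all_loo _ _ _ _ _ _ _ _ _ i hM.
have g1 := gam_ge1 mq q0 N0 eta1 G1 hM'.
have g0 : 0 < gam U N M i by exact: lt_le_trans ltr01 g1.
have h1 := opb_dot (Qi M i *m x M i) (Qi M i *m x M i) hC.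
have h2 := Qloo_opb mq q0 N0 eta1 G1 hM' (x M i).
have h3 := smp_bound mq q0 N0 eta1 G1 i hM.
have h4 : enorm (Qi M i *m x M i) ^+ 2 <= 9 * (N / 2).
  apply: (@le_trans _ _ (9 * dot (x M i) (x M i))); last by rewrite ler_pM2l.
  rewrite -sqr_enorm (_ : 9 = 3 ^+ 2 :> R); last by rewrite expr2; ring.
  by rewrite -exprMn ler_pXn2r ?nnegrE ?mulr_ge0 ?enorm_ge0.
rewrite normrM ger0_norm; last by rewrite divr_ge0 ?invr_ge0 // ltW.
apply: (@le_trans _ _ (N^-1 * (c * (9 * (N / 2))))); last first.
  by rewrite [leLHS](_ : _ = 9 / 2 * c) //; field; rewrite gt_eqF.
apply: ler_pM => //.
- by rewrite divr_ge0 ?invr_ge0 // ltW.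
- by rewrite ler_pdivrMr // ler_peMr ?invr_ge0 // ltW.
apply: le_trans h1 _; rewrite -mulrA -expr2; exact: ler_wpM2l.
Qed.

Lemma trace_loo_diff M i c (C : 'M[R]_d) : 0 <= c -> A M -> opb c C ->
  `|\tr (Q M *m C) - \tr (Qi M i *m C)| <= 9 / 2 * c.
Proof.
move=> c0 hM hC; rewrite (Qr_loo_mx i hM) mulmxBl -scalemxAl mxtraceB mxtraceZ.
rewrite trace_outerM addrAC subrr add0r normrN; exact: loo_form_bound.
Qed.

Lemma gam_diff M i : gam U N M i - m%:R / N = N^-1 * (dot (x M i) (Qi M i *m x M i) - D).
Proof.
have -> : m%:R = N + D by rewrite (model_N H); ring.
by rewrite /gam; field; rewrite gt_eqF.
Qed.

Lemma Qi_opb M i : A' i M -> opb 3 (Qi M i).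
Proof. by move=> hM; exact: (@Qloo_opb _ _ _ _ _ _ _ _ mq q0 N0 eta1 G1 M i hM). Qed.

Lemma Q_opb M : A M -> opb 2 (Q M).
Proof. by move=> hM; exact: (@Qr_opb _ _ _ _ _ _ _ _ mq q0 eta1 M hM). Qed.

Lemma loo_mx_Q i : @loo_mx _ _ _ _ q U N eta i 3 (fun M => Qi M i).
Proof.
split.
- exact: measurable_Qloo.
- by move=> r M; rewrite Qloo_repl.
by move=> M hM; exact: Qi_opb.
Qed.

Lemma ler_sqrt_id (a : R) : 1 <= a -> Num.sqrt a <= a.
Proof.
move=> a1; have a0 : 0 <= a by exact: le_trans ler01 a1.
rewrite -[leRHS]sqr_sqrtr // expr2 ler_peMr ?sqrtr_ge0 //.
by rewrite -sqrtr1 ler_sqrt.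
Qed.

Section weight.
Variable M0 : 'M[R]_d.
Hypotheses (oM0 : opb 1 M0)
  (tM0 : forall (B : 'M[R]_d) b, 0 <= b -> opb b B -> `|\tr (B *m M0)| <= b * D).

(** The weight [M0] stays abstract because the estimate is run for [G] and for [G *m G]. *)
Definition tdev M := \tr (Q M *m M0) - \tr M0.
Definition tdev_loo M i := \tr (Qi M i *m M0) - \tr M0.

Lemma measurable_tdev : measurable_fun setT tdev.
Proof.
apply: measurable_funB => //; apply: measurable_tr; apply: mmxM; last exact: mmx_cst.
exact: measurable_Qr.
Qed.

Lemma measurable_tdev_loo i : measurable_fun setT (tdev_loo^~ i).
Proof.
apply: measurable_funB => //; apply: measurable_tr; apply: mmxM; last exact: mmx_cst.
exact: measurable_Qloo.
Qed.

Lemma tdev_loo_le M i : A' i M -> `|tdev_loo M i| <= 4 * D.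
Proof.
move=> hM; rewrite /tdev_loo -{2}[M0]mul1mx -mxtraceB -mulmxBl.
apply: tM0 => //; rewrite (_ : 4 = 3 + 1 :> R); last by ring.
by apply: opbB; [exact: Qi_opb|exact: opb1].
Qed.

Lemma tdev_diff M i : A M -> `|tdev M - tdev_loo M i| <= 9 / 2.
Proof.
move=> hM; have := trace_loo_diff i ler01 hM oM0.
by rewrite mulr1 /tdev /tdev_loo opprB addrA subrK.
Qed.

Lemma tdev_le M : A M -> `|tdev M| <= 3 * D.
Proof.
move=> hM; rewrite /tdev -{2}[M0]mul1mx -mxtraceB -mulmxBl.
apply: tM0 => //; rewrite (_ : 3 = 2 + 1 :> R); last by ring.
by apply: opbB; [exact: Q_opb|exact: opb1].
Qed.

Definition sqdev : R := \int[P]_M (\1_A M * tdev M ^+ 2).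

(** The crude bound [|t| <= 3 D] only ensures that [sqdev] is a finite mean, so that a fraction of
    it can later be moved to the left-hand side. *)
Lemma ub_tdev : ub P (fun M => \1_A M * tdev M ^+ 2) sqdev.
Proof.
have h : ub P (fun M => \1_A M * tdev M ^+ 2) ((3 * D) ^+ 2).
  apply: ub_dom (ub_cst P (sqr_ge0 (3 * D))).
    apply: measurable_funM; first exact: measurable_indic_all H.
    by apply: measurable_funX; exact: measurable_tdev.
  move=> M; have [hM|hM] := pselect (A M); last first.
    by rewrite (indic_bad hM) mul0r lexx sqr_ge0.
  rewrite (indic_good hM) mul1r sqr_ge0 /= -[leLHS]real_normK ?num_real //.
  by rewrite ler_pXn2r ?nnegrE ?mulr_ge0 ?tdev_le.
have [mh h0 _] := h; apply: mean_ub => //; exact: ub_integrable h.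
Qed.

Lemma sqdev_ge0 : 0 <= sqdev.
Proof. exact: ub_ge0 ub_tdev. Qed.

Lemma D_le_m : D <= m%:R.
Proof. by have := model_deff H; have := D0; lra. Qed.

Lemma m_ge1 : 1 <= m%:R :> R.
Proof. by rewrite ler1n -(@ltr0n R) (model_m_gt0 H). Qed.

Hypothesis D1 : 1 <= D.

(** On [A] the two deviations differ by at most [9 / 2], which gives [2 sqdev + 41]. Off [A] the
    bound [4 D] is paid with probability [m^-3], which gives at most 16. With [D >= 1] the constants
    add up to [57 D]. *)
Lemma ub_tdev_loo i :
  ub P (fun M => \1_(A' i) M * tdev_loo M i ^+ 2) (2 * sqdev + 57 * D).
Proof.
have mAD : measurable (A' i `\` A).
  exact: measurableD (measurable_good_loo H i) (measurable_good_all H).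
have u1 := ub_indic mAD (bad_event H i).
have hc : 0 <= 16 * D ^+ 2 by rewrite mulr_ge0 ?sqr_ge0.
have u2 := ubD (ubD (ubZ (ler0n R 2) ub_tdev) (ub_cst P (ler0n R 41))) (ubZ hc u1).
apply: ub_le (ub_dom _ _ u2).
- have : 16 * D ^+ 2 * m%:R ^- 3 <= 16.
    rewrite ler_pdivrMr ?exprn_gt0 ?(model_m_gt0 H) // ler_pM2l //.
    apply: (@le_trans _ _ (m%:R ^+ 2)).
      by rewrite ler_pXn2r ?nnegrE ?D_le_m.
    by rewrite ler_weXn2l // m_ge1.
  move: D1; lra.
- apply: measurable_funM; first exact: measurable_indic_loo H i.
  by apply: measurable_funX; exact: measurable_tdev_loo.
move=> M; have [hM'|hM'] := pselect (A' i M); last first.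
  rewrite (indic_bad hM') mul0r lexx /= (indic_bad (B := A)); last first.
    by move=> h; apply: hM'; exact: good_all_loo.
  by rewrite (indic_bad (B := A' i `\` A)) ?mul0r ?mulr0 ?addr0 ?add0r // => -[].
rewrite (indic_good hM') mul1r sqr_ge0 /=.
have [hM|hM] := pselect (A M).
  rewrite (indic_good hM) (indic_bad (B := A' i `\` A)); last by move=> [].
  rewrite mul1r mulr0 addr0; have := tdev_diff i hM.
  rewrite ler_norml => /andP[]; move: (tdev M) (tdev_loo M i) => a b h1 h2.
  have := sqr_ge0 (b - 2 * a).
  have : (a - b) ^+ 2 <= (9 / 2) ^+ 2.
    by rewrite -[leLHS]real_normK ?num_real // ler_pXn2r ?nnegrE // ler_norml h1.
  rewrite !expr2; lra.
rewrite (indic_bad hM) (indic_good (B := A' i `\` A)) // mul0r mulr0 add0r mulr1.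
have := tdev_loo_le hM'; move: (tdev_loo M i) => b h.
apply: (@le_trans _ _ (16 * D ^+ 2)); last by rewrite lerDr.
rewrite (_ : 16 * D ^+ 2 = (4 * D) ^+ 2); last by rewrite exprMn; ring.
by rewrite -[leLHS]real_normK ?num_real // ler_pXn2r ?nnegrE ?mulr_ge0.
Qed.

Local Notation bfl i := (@fluct R n d m U (fun M : 'M[R]_(m, d) => M0 *m Qi M i) i).
Local Notation zfl i := (@fluct R n d m U (fun M : 'M[R]_(m, d) => Qi M i) i).
Local Notation tG M i := (\tr (Qi M i *m G) - D).

Lemma loo_mx_b i : @loo_mx _ _ _ _ q U N eta i 3 (fun M => M0 *m Qi M i).
Proof.
split.
- by apply: mmxM; [exact: mmx_cst|exact: measurable_Qloo].
- by move=> r M; rewrite Qloo_repl.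
move=> M hM; rewrite -[3]mul1r; apply: opbM => //.
exact: Qi_opb.
Qed.

(** The error of replacing the weight [(m / N) / gamma_i] by 1. *)
Definition tcross M i := (gam U N M i - m%:R / N) / gam U N M i *
  dot (x M i) (M0 *m (Qi M i *m x M i)).

Lemma measurable_tcross i : measurable_fun setT (tcross^~ i).
Proof.
apply: measurable_funM.
  apply: measurable_funM; first by apply: measurable_funB => //; exact: measurable_gam.
  by apply: measurable_invr; exact: measurable_gam.
apply: measurable_dot; first exact: measurable_smp.
apply: mmxM; first exact: mmx_cst.
by apply: mmxM; [exact: measurable_Qloo|exact: measurable_smp].
Qed.

(** Sherman-Morrison gives row [i] the weight [(m / N) / gamma_i = 1 - (gamma_i - m / N) / gamma_i].
    The part 1 yields a form fluctuating around [tr (Qi G M0)], which nearly cancels [tr (Q G M0)];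
    the rest is [tcross]. *)
Lemma tdev_expand M : A M -> tdev M = m%:R^-1 * \sum_i
  (\tr (Q M *m (G *m M0)) - \tr (Qi M i *m (G *m M0)) - bfl i M + tcross M i).
Proof.
move=> hM; rewrite /tdev (Qr_trace mq q0 eta1 M0 hM).
have m0 : m%:R != 0 :> R by rewrite gt_eqF ?(model_m_gt0 H).
transitivity (m%:R^-1 * \sum_(i < m) (\tr (Q M *m (G *m M0)) -
    m%:R / N * dot (x M i) (M0 *m (Q M *m x M i)))).
  rewrite sumrB sumr_const card_ord -(mulr_natl (\tr (Q M *m (G *m M0))) m) -mulr_sumr.
  by field; rewrite m0 gt_eqF.
congr (_ * _).
apply: eq_bigr => i _.
have hM' := @good_all_loo _ _ _ _ _ _ _ _ _ i hM.
have g1 := gam_ge1 mq q0 N0 eta1 G1 hM'.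
rewrite (Qr_smp mq q0 N0 eta1 G1 i hM) -scalemxAr dotZr /fluct /tcross
  -[M0 *m Qi M i *m x M i]mulmxA.
have -> : \tr (M0 *m Qi M i *m G) = \tr (Qi M i *m (G *m M0)).
  by rewrite -mulmxA mxtrace_mulC [in RHS]mulmxA.
field; rewrite ?m0 !gt_eqF //; exact: lt_le_trans ltr01 g1.
Qed.

(** With the other rows fixed, both fluctuations have standard deviation at most [10 L sqrt D]. The
    dominant products are [z b], of mean at most [90 L D], and [3 D z], of mean at most
    [30 L D sqrt D]; as [D >= 1] they add up to the constant 120. *)
Lemma inner_cross i M : A' i M ->
  ub P' (fun w => (`|zfl i (repl i (y w)^T M)| + `|tG M i|) *
                  (`|bfl i (repl i (y w)^T M)| + 3 * D))
    (120 * L * D * (Num.sqrt D + `|tG M i|)).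
Proof.
move=> hM.
pose z w := dot (y w) (Qi M i *m y w) - \tr (Qi M i *m G).
pose b w := dot (y w) (M0 *m Qi M i *m y w) - \tr (M0 *m Qi M i *m G).
have zE w : zfl i (repl i (y w)^T M) = z w.
  by rewrite /fluct Qloo_repl smp_repl eqxx trmxK.
have bE w : bfl i (repl i (y w)^T M) = b w.
  by rewrite /fluct Qloo_repl smp_repl eqxx trmxK.
have -> : (fun w => (`|zfl i (repl i (y w)^T M)| + `|tG M i|) *
                  (`|bfl i (repl i (y w)^T M)| + 3 * D)) =
  (fun w => (`|z w * b w| + 3 * D * `|z w|) + (`|tG M i| * `|b w| + 3 * D * `|tG M i|)).
  by apply/funext => w; rewrite zE bE normrM; ring.
have h3 : opb 3 (Qi M i) by exact: Qi_opb.
have h4 : opb 3 (M0 *m Qi M i) by rewrite -[3]mul1r; exact: opbM.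
have var := fun B b => @quad_var _ _ _ _ _ _ P' y L L1 (model_meas H) (model_var H) B b.
have uz : ub P' (fun w => z w ^+ 2) (10 * L * 3 ^+ 2 * D) by exact: var.
have ub' : ub P' (fun w => b w ^+ 2) (10 * L * 3 ^+ 2 * D) by exact: var.
have mz : measurable_fun setT z.
  by apply: measurable_funB => //; exact: measurable_quad (model_meas H) _.
have mb' : measurable_fun setT b.
  by apply: measurable_funB => //; exact: measurable_quad (model_meas H) _.
have hs : Num.sqrt (10 * L * 3 ^+ 2 * D) <= 10 * L * Num.sqrt D.
  suff : Num.sqrt (10 * L * 3 ^+ 2 * D) ^+ 2 <= (10 * L * Num.sqrt D) ^+ 2.
    by rewrite ler_pXn2r ?nnegrE ?mulr_ge0 ?sqrtr_ge0.
  rewrite [leRHS]exprMn !sqr_sqrtr ?mulr_ge0 ?sqr_ge0 //.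
  by rewrite ler_wpM2r // !expr2; move: L1 L0; nra.
have t0 : 0 <= `|tG M i| by [].
have D30 : 0 <= 3 * D by rewrite mulr_ge0.
have := ubD (ubD (ub_cauchy mz mb' uz ub') (ubZ D30 (ub_sqrt mz uz)))
  (ubD (ubZ t0 (ub_sqrt mb' ub')) (ub_cst P' (mulr_ge0 D30 t0))).
apply: ub_le; rewrite -expr2 sqr_sqrtr ?mulr_ge0 ?sqr_ge0 //.
move: (`|tG M i|) t0 => t t0.
set s := Num.sqrt (_ * _) in hs *.
have r1 : 1 <= Num.sqrt D by rewrite -sqrtr1 ler_sqrt.
have k1 : 3 * D * s <= 3 * D * (10 * L * Num.sqrt D) by rewrite ler_wpM2l.
have k2 : t * s <= t * (10 * L * Num.sqrt D) by rewrite ler_wpM2l.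
have rD := ler_sqrt_id D1.
have LD0 : 0 <= L * D by rewrite mulr_ge0.
have k3 : L * D <= L * D * Num.sqrt D by rewrite ler_peMr.
have k4 : t * (10 * L * Num.sqrt D) <= t * (10 * L * D).
  by rewrite ler_wpM2l // ler_wpM2l ?mulr_ge0.
have k5 : D * t <= L * D * t by rewrite ler_wpM2r // ler_peMl.
have k6 : 0 <= L * D * t by rewrite mulr_ge0.
rewrite expr2; move: k1 k2 k3 k4 k5 k6; move: (Num.sqrt D) => r; lra.
Qed.

(** The origin of the constant in [m >= C deff]: [N >= m / 2] and [3840 = 120 * 2 * 16], so that the
    cross term re-enters the estimate with factor [1 / 16]. *)
Lemma D_over_N : 3840 * L * D <= m%:R -> 120 * L * D / N <= 16^-1.
Proof. by move=> HC; rewrite ler_pdivrMr //; have := model_N_half H; lra. Qed.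

Lemma ub_cross i g : 3840 * L * D <= m%:R ->
  ub P (fun M => \1_(A' i) M * tG M i ^+ 2) g ->
  ub P (fun M => \1_(A' i) M * ((`|tdev_loo M i| + 9 / 2) *
     (N^-1 * ((`|zfl i M| + `|tG M i|) * (`|bfl i M| + 3 * D)))))
    (16^-1 * (2 * sqdev + 57 * D + (22 * D + g))).
Proof.
move=> HC hg.
have Ni : 0 <= N^-1 by rewrite invr_ge0 ltW.
have mz : measurable_fun setT (zfl i) by apply: measurable_fluct; exact: measurable_Qloo.
have mb' : measurable_fun setT (bfl i).
  by apply: measurable_fluct; apply: mmxM; [exact: mmx_cst|exact: measurable_Qloo].
have mtG : measurable_fun setT (fun M => tG M i).
  apply: measurable_funB => //; apply: measurable_tr; apply: mmxM; last exact: mmx_cst.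
  exact: measurable_Qloo.
have absm (f : 'M[R]_(m, d) -> R) : measurable_fun setT f -> measurable_fun setT (fun M => `|f M|).
  by move=> mf; exact: measurableT_comp.
apply: (cond_ub H (k := fun M => (`|tdev_loo M i| + 9 / 2) *
   (N^-1 * (120 * L * D * (Num.sqrt D + `|tG M i|))))).
- apply: measurable_funM.
    by apply: measurable_funD => //; apply: absm; exact: measurable_tdev_loo.
  apply: measurable_funM => //; apply: measurable_funM.
    by apply: measurable_funD; exact: absm.
  by apply: measurable_funD => //; exact: absm.
- by move=> M _; rewrite !mulr_ge0 ?addr_ge0 // mulr_ge0.
- move=> M hM; have := inner_cross hM => /(ubZ Ni).
  have t0 : 0 <= `|tdev_loo M i| + 9 / 2 by rewrite addr_ge0.
  move=> /(ubZ t0).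
  congr (ub _ _ _); apply/funext => w.
  by rewrite /tdev_loo !Qloo_repl.
have hD : 0 <= 22 * D by rewrite mulr_ge0.
have c0 : 0 <= 120 * L * D / N by rewrite divr_ge0 ?mulr_ge0 // ltW.
have u := ubZ c0 (ubD (ub_tdev_loo i) (ubD (ub_cst P hD) hg)).
apply: ub_le (ub_dom _ _ u).
- apply: ler_wpM2r; last exact: D_over_N.
  by rewrite !addr_ge0 ?mulr_ge0 ?sqdev_ge0 ?(ub_ge0 hg).
- apply: measurable_funM; first exact: measurable_indic_loo H i.
  apply: measurable_funM.
    by apply: measurable_funD => //; apply: absm; exact: measurable_tdev_loo.
  apply: measurable_funM => //; apply: measurable_funM => //.
  by apply: measurable_funD => //; exact: absm.
move=> M; have [hM|hM] := pselect (A' i M); last first.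
  by rewrite (indic_bad hM) !mul0r lexx add0r addr0 mulr_ge0.
rewrite (indic_good hM) !mul1r; apply/andP; split.
  by rewrite !mulr_ge0 ?addr_ge0 ?sqrtr_ge0.
rewrite (_ : (`|tdev_loo M i| + 9 / 2) * (N^-1 * (120 * L * D * (Num.sqrt D + `|tG M i|))) =
   120 * L * D / N * ((`|tdev_loo M i| + 9 / 2) * (Num.sqrt D + `|tG M i|))); last by ring.
apply: ler_wpM2l => //.
rewrite -[tdev_loo M i ^+ 2]real_normK ?num_real // -[tG M i ^+ 2]real_normK ?num_real //.
have hr := sqr_sqrtr D0; have h1 := D1; move: hr h1.
move: (Num.sqrt D) (`|tdev_loo M i|) (`|tG M i|) => r a b hr h1.
(* These squares give [(a + 9 / 2) (r + b) <= a^2 + b^2 + r^2 + 81 / 4], where [r^2 = D] and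
   [81 / 4 <= 21 D]. *)
have := sqr_ge0 (a + 9 / 2 - (r + b)); have := sqr_ge0 (a - 9 / 2); have := sqr_ge0 (r - b).
move: hr; rewrite !expr2; lra.
Qed.

Lemma tcross_le i M : A M -> `|tdev M * tcross M i| <=
  (`|tdev_loo M i| + 9 / 2) *
     (N^-1 * ((`|zfl i M| + `|tG M i|) * (`|bfl i M| + 3 * D))).
Proof.
move=> hM; have hM' := @good_all_loo _ _ _ _ _ _ _ _ _ i hM.
have g1 := gam_ge1 mq q0 N0 eta1 G1 hM'.
have g0 : 0 < gam U N M i by exact: lt_le_trans ltr01 g1.
rewrite normrM; apply: ler_pM => //.
  have := tdev_diff i hM; have := ler_normD (tdev M - tdev_loo M i) (tdev_loo M i).
  by rewrite subrK; lra.
rewrite /tcross gam_diff !normrM -!mulrA; apply: ler_pM => //.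
  by rewrite ger0_norm // invr_ge0 ltW.
apply: ler_pM => //.
- have -> : dot (x M i) (Qi M i *m x M i) - D = zfl i M + tG M i by rewrite /fluct; ring.
  exact: ler_normD.
rewrite normfV (ger0_norm (ltW g0)) ler_pdivrMl //.
apply: (@le_trans _ _ (1 * (`|bfl i M| + 3 * D))); last first.
  by rewrite ler_wpM2r // addr_ge0 // mulr_ge0.
rewrite mul1r.
have h := ler_normD (bfl i M) (\tr (M0 *m Qi M i *m G)).
rewrite {1}/fluct subrK -[M0 *m Qi M i *m x M i]mulmxA in h; apply: le_trans h _; rewrite lerD2l.
apply: trace_gram_le; rewrite -[3]mul1r; apply: opbM => //.
exact: Qi_opb.
Qed.

(** Multiplies the expansion of [t] by [t] and takes means. The bound [g] for the weight [G] is a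
    parameter because for [M0 = G] it is the very quantity being estimated; the coefficient of
    [sqdev] on the right is then [1 / 8 + 2 / 16 + 2 / 16 < 1]. *)
Lemma trace_step g : 3840 * L * D <= m%:R ->
  (forall i, ub P (fun M => \1_(A' i) M * tG M i ^+ 2) g) ->
  sqdev <= sqdev / 8 + 270 * L * D + 16^-1 * (2 * sqdev + 57 * D + (22 * D + g)).
Proof.
move=> HC hg.
have LD : 1 <= L * D by rewrite mulr_ege1.
have mI := measurable_indic_all H.
have mt := measurable_tdev.
suff h i : mb P (fun M => \1_A M * (tdev M *
   (\tr (Q M *m (G *m M0)) - \tr (Qi M i *m (G *m M0)) - bfl i M + tcross M i)))
   (sqdev / 8 + 270 * L * D + 16^-1 * (2 * sqdev + 57 * D + (22 * D + g))).
  have m0 : (0 < m)%N by rewrite -(@ltr0n R) (model_m_gt0 H).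
  have [_] := mb_mean m0 h; apply: le_trans.
  apply: le_trans (ler_norm _); rewrite /sqdev le_eqVlt; apply/orP; left; apply/eqP.
  apply: eq_Rintegral => M _.
  have [hM|hM] := pselect (A M); last first.
    rewrite (indic_bad hM) mul0r big1 ?mulr0 // => i _.
    by cbv beta; rewrite ?(indic_bad hM) mul0r.
  rewrite (indic_good hM) mul1r expr2 {2}(tdev_expand hM).
  rewrite mulrCA mulr_sumr; congr (_ * _); apply: eq_bigr => i _.
  by cbv beta; rewrite ?(indic_good hM) mul1r.
have mb' : measurable_fun setT (bfl i).
  by apply: measurable_fluct; apply: mmxM; [exact: mmx_cst|exact: measurable_Qloo].
have mC (C : 'M[R]_d) : measurable_fun setT (fun M => \tr (Q M *m C) - \tr (Qi M i *m C)).
  apply: measurable_funB; apply: measurable_tr; apply: mmxM; try exact: mmx_cst.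
    exact: measurable_Qr.
  exact: measurable_Qloo.
(* The trace difference is at most [9 / 2], and [(9 / 2) |t| <= t^2 / 8 + 81 / 2]. *)
have h1 : mb P (fun M => \1_A M * (tdev M * (\tr (Q M *m (G *m M0)) - \tr (Qi M i *m (G *m M0)))))
   (sqdev / 8 + 41).
  have e0 : 0 <= (8^-1 : R) by rewrite invr_ge0.
  have u := ubD (ubZ e0 ub_tdev) (ub_cst P (ler0n R 41)).
  rewrite (mulrC 8^-1) in u.
  apply: mb_ub u.
    by apply: measurable_funM => //; apply: measurable_funM.
  move=> M; have [hM|hM] := pselect (A M); last first.
    by rewrite (indic_bad hM) !mul0r normr0 mulr0 add0r.
  rewrite (indic_good hM) !mul1r normrM -[tdev M ^+ 2]real_normK ?num_real //.
  have oGM : opb 1 (G *m M0) by rewrite -[1]mul1r; apply: opbM => //; exact: G_opb1 H.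
  have := trace_loo_diff i ler01 hM oGM; rewrite mulr1.
  move: (`|tdev M|) (normr_ge0 (tdev M)) (`|_ - _|) => a a0 b hb.
  apply: (@le_trans _ _ (a * (9 / 2))); first by rewrite ler_wpM2l.
  have := sqr_ge0 (a - 18); rewrite !expr2; lra.
(* [t] depends on row [i], so its product with the fluctuation is split: [t - t_i] is bounded, and
   [t_i] times the fluctuation is again the fluctuation of a matrix free of row [i]. *)
have h2 : mb P (fun M => \1_A M * ((tdev M - tdev_loo M i) * bfl i M)) (9 / 4 * (90 * L * D + 1)).
  have e0 : 0 <= (9 / 4 : R) by rewrite divr_ge0.
  have b3 : 10 * L * 3 ^+ 2 * D = 90 * L * D by rewrite expr2; ring.
  have := ub_fluct H (ler0n R 3) (loo_mx_b i); rewrite b3 => u0.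
  have u := ubZ e0 (ubD u0 (ub_cst P (ler01))).
  apply: mb_ub u.
    apply: measurable_funM => //; apply: measurable_funM => //.
    by apply: measurable_funB => //; exact: measurable_tdev_loo.
  move=> M; have [hM|hM] := pselect (A M); last first.
    by rewrite (indic_bad hM) !mul0r normr0 mulr_ge0 // addr_ge0 // mulr_ge0 ?sqr_ge0.
  have hM' : A' i M by exact: good_all_loo.
  rewrite (indic_good hM) (indic_good (B := A' i) hM') !mul1r normrM.
  apply: (@le_trans _ _ (9 / 2 * `|bfl i M|)).
    by rewrite ler_wpM2r // tdev_diff.
  rewrite -[bfl i M ^+ 2]real_normK ?num_real //.
  move: (`|bfl i M|) => b; have := sqr_ge0 (b - 1); rewrite !expr2; lra.
have h3 : mb P (fun M => \1_A M * (tdev_loo M i * bfl i M)) (24 * L * D).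
  have lB : @loo_mx _ _ _ _ q U N eta i (4 * D * 3)
      (fun M => tdev_loo M i *: (M0 *m Qi M i)).
    split.
    - apply: mmxZ; first exact: measurable_tdev_loo.
      by apply: mmxM; [exact: mmx_cst|exact: measurable_Qloo].
    - by move=> r M; rewrite /tdev_loo Qloo_repl.
    move=> M hM; apply: opb_le (opbZ _ _); last first.
      have [_ _] := loo_mx_b i; exact.
    by rewrite ler_wpM2r // tdev_loo_le.
  have b0 : 0 <= 4 * D * 3 by rewrite !mulr_ge0.
  apply: mb_le (eq_mb _ (mb_fluct H b0 lB)).
    apply: (@le_trans _ _ (4 * L * (4 * D * 3) * 2^-1)); last by lra.
    apply: ler_wpM2l; first by rewrite !mulr_ge0.
    rewrite ler_pdivrMr ?(model_m_gt0 H) //; have := ler_sqrt_id D1.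
    by have := model_deff H; lra.
  move=> M; congr (_ * _); rewrite /fluct -!scalemxAl dotZr mxtraceZ.
  by rewrite mulrBr.
have h4 : mb P (fun M => \1_A M * (tdev M * tcross M i))
     (16^-1 * (2 * sqdev + 57 * D + (22 * D + g))).
  apply: mb_ub (ub_cross HC (hg i)).
    apply: measurable_funM => //; apply: measurable_funM => //.
    exact: measurable_tcross.
  move=> M; have [hM|hM] := pselect (A M); last first.
    rewrite (indic_bad hM) !mul0r normr0 !mulr_ge0 ?addr_ge0 ?mulr_ge0 ?invr_ge0 //.
    exact: ltW.
  have hM' : A' i M by exact: good_all_loo.
  by rewrite (indic_good hM) (indic_good (B := A' i) hM') !mul1r; exact: tcross_le.
have := mbD (mbD h1 (mbN (mbD h2 h3))) h4.
move=> /mb_le h; apply: eq_mb (h _ _) => [M|]; first by ring.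
move: LD; rewrite -!(mulrA _ L D); move: (L * D) => LD; lra.
Qed.

End weight.

End trace_deviation.

Lemma eq_ler (R : numDomainType) (a b : R) : a = b -> a <= b.
Proof. by move=> ->. Qed.

(** * First moment of the resolvent *)

Section resolvent_means.
Context {R : realType} {n d m q : nat} {U : 'M[R]_(n, d)} {N eta L : R}
  {dT' : measure_display} {T' : measurableType dT'} {P' : probability T' R}
  {y : T' -> 'cV[R]_d} {P : probability 'M[R]_(m, d) R}.
Hypothesis H : sketch_model q U N eta L P' y P.
Local Notation G := (U^T *m U).
Local Notation D := (\tr G).
Local Notation D2 := (\tr (G *m G)).
Local Notation x := (@smp R d m).
Local Notation Q := (@Qr R n d m U N).
Local Notation Qi M i := (@Qloo R n d m U N M i).
Local Notation A := [set M : 'M[R]_(m, d) | good_all q U N eta M].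
Local Notation A' i := [set M : 'M[R]_(m, d) | good_loo q U N eta i M].
Local Notation loo i := (@loo_vec R n d m q U N eta i).
Hypothesis HC : 3840 * L * D <= m%:R.
Implicit Types (i : 'I_m) (M : 'M[R]_(m, d)) (v w : 'cV[R]_d).

Let mq := model_rows H.
Let q0 := model_rows_gt0 H.
Let N0 : 0 < N := model_N_gt0 H.
Let eta1 := model_eta H.
Let G1 := model_gram H.
Let D0 : 0 <= D := model_D_ge0.
Let L0 : 0 <= L := model_L_ge0 H.
Let L1 : 1 <= L := model_L H.
Let m0 : 0 < m%:R :> R := model_m_gt0 H.
Let sG : G^T = G := G_sym U.
Let oG : opb 1 G := G_opb1 H.

Lemma tr_G_le (B : 'M[R]_d) b : 0 <= b -> opb b B -> `|\tr (B *m G)| <= b * D.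
Proof. by move=> _; exact: trace_gram_le. Qed.

Lemma GG_opb : opb 1 (G *m G).
Proof. by rewrite -[1]mul1r; apply: opbM. Qed.

Lemma tr_GG_le (B : 'M[R]_d) b : 0 <= b -> opb b B -> `|\tr (B *m (G *m G))| <= b * D.
Proof.
move=> b0 hB; rewrite mulmxA; apply: tr_G_le => //.
by rewrite -[b]mulr1; apply: opbM.
Qed.

Lemma D2_ge0 : 0 <= D2.
Proof.
by have := trace_gram_ge0 G; rewrite sG.
Qed.

Lemma D2_le : D2 <= D.
Proof. by apply: le_trans (ler_norm _) _; rewrite -[leRHS]mul1r; exact: tr_G_le. Qed.

(** For [D < 1] the [O(1)] errors of [trace_step] are not [O(D)], but [|t_i| <= 4 D] gives
    [16 D^2 <= 16 D] at once. *)
Lemma tdev_small (M0 : 'M[R]_d) i :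
  (forall (B : 'M[R]_d) b, 0 <= b -> opb b B -> `|\tr (B *m M0)| <= b * D) ->
  D < 1 -> ub P (fun M => \1_(A' i) M * tdev_loo (U := U) (N := N) M0 M i ^+ 2) (1000 * L * D).
Proof.
move=> h3 D1.
have LD : D <= L * D by rewrite ler_peMl.
have c0 : 0 <= 1000 * L * D := mulr_ge0 (mulr_ge0 (ler0n R 1000) L0) D0.
apply: ub_dom (ub_cst P c0).
  apply: measurable_funM; first exact: measurable_indic_loo H i.
  by apply: measurable_funX; exact: measurable_tdev_loo.
move=> M; have [hM|hM] := pselect (A' i M); last first.
  by rewrite (indic_bad hM) mul0r lexx.
rewrite (indic_good hM) mul1r sqr_ge0 /=.
apply: (@le_trans _ _ ((4 * D) ^+ 2)).
  rewrite -[leLHS]real_normK ?num_real // ler_pXn2r ?nnegrE ?mulr_ge0 //.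
  exact: (tdev_loo_le H h3).
have : D * D <= D by rewrite ler_piMl // ltW.
rewrite exprMn !expr2 -mulrA; move: D0 LD; lra.
Qed.

(** Here [g] is [2 sqdev + 57 D] itself, and [trace_step] leaves [5 / 8] of [sqdev] on the left. *)
Lemma trace_dev_G i : ub P (fun M => \1_(A' i) M * (\tr (Qi M i *m G) - D) ^+ 2) (1000 * L * D).
Proof.
have [D1|D1] := leP 1 D; last exact: (tdev_small i tr_G_le D1).
have h := ub_tdev_loo H oG tr_G_le D1.
have := trace_step H oG tr_G_le D1 HC h.
have := sqdev_ge0 H tr_G_le; move: (sqdev _) (h i) => a hi a0 ha.
have LD : D <= L * D by rewrite ler_peMl.
apply: ub_le hi; rewrite -!(mulrA _ L D) in ha *; move: LD ha D1; move: (L * D) D => LD E.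
lra.
Qed.

(** [gamma_i] still involves the weight [G], so the estimate just proved serves as [g]. *)
Lemma trace_dev_GG i :
  ub P (fun M => \1_(A' i) M * (\tr (Qi M i *m (G *m G)) - D2) ^+ 2) (1000 * L * D).
Proof.
have [D1|D1] := leP 1 D; last exact: (tdev_small i tr_GG_le D1).
have h := ub_tdev_loo H GG_opb tr_GG_le D1.
have := trace_step H GG_opb tr_GG_le D1 HC trace_dev_G.
have := sqdev_ge0 H tr_GG_le; move: (sqdev _) (h i) => a hi a0 ha.
have LD : D <= L * D by rewrite ler_peMl.
apply: ub_le hi; rewrite -!(mulrA _ L D) in ha *; move: LD ha D1; move: (L * D) D => LD E.
lra.
Qed.

(** Mean square of order [D]; the constant covers [2 (90 + 1000)], from a fluctuation and a trace
    deviation. *)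
Definition small i (f : 'M[R]_(m, d) -> R) :=
  measurable_fun setT f /\ ub P (fun M => \1_(A' i) M * f M ^+ 2) (2500 * L * D).

Lemma small_fluct i (B : 'M[R]_(m, d) -> 'M[R]_d) (t : 'M[R]_(m, d) -> R) :
  @loo_mx _ _ _ _ q U N eta i 3 B -> measurable_fun setT t ->
  ub P (fun M => \1_(A' i) M * t M ^+ 2) (1000 * L * D) ->
  small i (fun M => @fluct R n d m U B i M + t M).
Proof.
move=> lB mt ut; have [mB _ _] := lB.
have mf : measurable_fun setT (@fluct R n d m U B i) by exact: measurable_fluct.
split; first exact: measurable_funD.
have u := ubD (ubZ (ler0n R 2) (ub_fluct H (ler0n R 3) lB)) (ubZ (ler0n R 2) ut).
apply: ub_le (ub_dom _ _ u).
- by rewrite expr2; have := mulr_ge0 L0 D0; lra.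
- apply: measurable_funM; first exact: measurable_indic_loo H i.
  by apply: measurable_funX; exact: measurable_funD.
move=> M; rewrite mulr_ge0 ?sqr_ge0 //=.
rewrite [2 * (_ * fluct _ _ _ ^+ 2)]mulrCA [2 * (_ * t M ^+ 2)]mulrCA -mulrDr.
apply: ler_wpM2l => //; move: (fluct B i M) (t M) => a b.
by have := sqr_ge0 (a - b); rewrite !expr2; lra.
Qed.

Definition sdev M i := dot (x M i) (Qi M i *m x M i) - D.
(** The form that Sherman-Morrison leaves in [x_i^T G Q v]; it concentrates at [tr (G^2)]. *)
Definition pform M i := dot (x M i) (Qi M i *m G *m x M i).

Lemma small_sdev i : small i (sdev^~ i).
Proof.
have mt : measurable_fun setT (fun M => \tr (Qi M i *m G) - D).
  apply: measurable_funB => //; apply: measurable_tr; apply: mmxM; last exact: mmx_cst.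
  exact: measurable_Qloo.
have := small_fluct (loo_mx_Q H i) mt (trace_dev_G i).
by congr small; apply/funext => M; rewrite /fluct /sdev; ring.
Qed.

Lemma small_pform i : small i (fun M => pform M i - D2).
Proof.
have mt : measurable_fun setT (fun M => \tr (Qi M i *m (G *m G)) - D2).
  apply: measurable_funB => //; apply: measurable_tr; apply: mmxM; last exact: mmx_cst.
  exact: measurable_Qloo.
have lB : @loo_mx _ _ _ _ q U N eta i 3 (fun M => Qi M i *m G).
  have [h1 h2 h3] := loo_mx_Q H i; split.
  - by apply: mmxM => //; exact: mmx_cst.
  - by move=> r M; rewrite h2.
  by move=> M hM; rewrite -[3]mulr1; apply: opbM => //; exact: h3.
have := small_fluct lB mt (trace_dev_GG i).
congr small; apply/funext => M; rewrite /fluct /pform (mulmxA (Qi M i) G G).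
ring.
Qed.

Lemma loo_vec_C i c a (C : 'M[R]_d) : opb 1 C -> loo i c a -> loo i c (fun M => C *m a M).
Proof.
move=> hC [ma ra ca]; split.
- by apply: mmxM => //; exact: mmx_cst.
- by move=> r M; rewrite ra.
by move=> M hM; apply: le_trans (hC _) _; rewrite mul1r ca.
Qed.

Let S : R := Num.sqrt D / m%:R.

Lemma S_ge0 : 0 <= S.
Proof. by rewrite /S divr_ge0 ?sqrtr_ge0 // ltW. Qed.

Lemma sqrt_over_N : N^-1 * Num.sqrt D <= 2 * S.
Proof.
rewrite /S mulrC mulrCA; apply: ler_wpM2l; first exact: sqrtr_ge0.
rewrite -[leLHS]mul1r ler_pdivrMr // mulrAC ler_pdivlMr // mul1r.
exact: model_N_half H.
Qed.

(** Cauchy-Schwarz against the fourth moments: [sqrt (2500 L D) sqrt (4 L c^4) = 100 L c^2 sqrt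
    D]. *)
Lemma ub_cs i (c : R) a b (f : 'M[R]_(m, d) -> R) : 0 <= c -> loo i c a -> loo i c b -> small i f ->
  ub P (fun M => \1_(A' i) M * (`|f M| * (`|dot (a M) (x M i)| * `|dot (b M) (x M i)|)))
    (100 * L * c ^+ 2 * Num.sqrt D).
Proof.
move=> c0 la lb [mf uf].
have mI := measurable_indic_loo H i.
have ma := measurable_loo_dot la; have mb' := measurable_loo_dot lb.
have u := ub_loo_pair H la lb.
pose g M := dot (a M) (x M i) * dot (b M) (x M i).
have mg : measurable_fun setT g by exact: measurable_funM.
have I2 M : (\1_(A' i) M : R) ^+ 2 = \1_(A' i) M.
  by rewrite indicE; case: (_ \in _); rewrite ?expr1n ?expr0n.
have u1 : ub P (fun M => (\1_(A' i) M * f M) ^+ 2) (2500 * L * D).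
  by under eq_fun do rewrite exprMn I2.
have u2 : ub P (fun M => (\1_(A' i) M * g M) ^+ 2) (4 * L * c ^+ 4).
  by under eq_fun do rewrite exprMn I2 /g exprMn.
have u3 := ub_cauchy (measurable_funM mI mf) (measurable_funM mI mg) u1 u2.
have E : (fun M => \1_(A' i) M * (`|f M| * (`|dot (a M) (x M i)| * `|dot (b M) (x M i)|))) =
   (fun M => `|\1_(A' i) M * f M * (\1_(A' i) M * g M)|).
  apply/funext => M; rewrite (_ : _ * f M * _ = \1_(A' i) M ^+ 2 * (f M * g M)); last by ring.
  by rewrite I2 !normrM; congr (_ * _); rewrite ger0_norm.
rewrite E; apply: ub_le u3.
have p1 : 0 <= 2500 * L * D := mulr_ge0 (mulr_ge0 (ler0n R 2500) L0) D0.
have p2 : 0 <= 4 * L * c ^+ 4 by rewrite !mulr_ge0 ?exprn_ge0.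
have q1 : 0 <= Num.sqrt (2500 * L * D) * Num.sqrt (4 * L * c ^+ 4) by rewrite mulr_ge0 ?sqrtr_ge0.
have q2 : 0 <= 100 * L * c ^+ 2 * Num.sqrt D by rewrite !mulr_ge0 ?sqrtr_ge0 ?exprn_ge0.
suff : (Num.sqrt (2500 * L * D) * Num.sqrt (4 * L * c ^+ 4)) ^+ 2 <=
      (100 * L * c ^+ 2 * Num.sqrt D) ^+ 2 by rewrite ler_pXn2r.
rewrite [leLHS]exprMn (sqr_sqrtr p1) (sqr_sqrtr p2) [leRHS]exprMn (sqr_sqrtr D0).
rewrite [leLHS](_ : _ = (100 * L * c ^+ 2) ^+ 2 * D) //.
by rewrite !exprS !expr0; ring.
Qed.

Lemma ub_two i c a b : loo i c a -> loo i c b ->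
  ub P (fun M => \1_(A' i) M * (`|dot (a M) (x M i)| * `|dot (b M) (x M i)|))
    (Num.sqrt D * c ^+ 2).
Proof.
move=> la lb.
have mI := measurable_indic_loo H i.
have ma := measurable_loo_dot la; have mb' := measurable_loo_dot lb.
have e0 : 0 <= (2^-1 : R) by rewrite invr_ge0.
have u := ubZ e0 (ubD (ub_loo_sqr H la) (ub_loo_sqr H lb)).
apply: ub_le (ub_dom _ _ u); first by lra.
- by apply: measurable_funM => //; apply: measurable_funM; exact: measurableT_comp.
move=> M; rewrite !mulr_ge0 //=.
rewrite -[dot (a M) _ ^+ 2]real_normK ?num_real // -[dot (b M) _ ^+ 2]real_normK ?num_real //.
rewrite -mulrDr [leRHS]mulrCA; apply: ler_wpM2l => //.
move: (`|_|) (`|_|) => s t; have := sqr_ge0 (s - t); rewrite !expr2; lra.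
Qed.

(** Terms with a factor [1 / N] and two linear forms in [x_i] need no cancellation: the second
    moments of the forms already give [sqrt D / N]. *)
Lemma mb_two i (c k : R) a b (f : 'M[R]_(m, d) -> R) : measurable_fun setT f -> 0 <= c -> 0 <= k ->
  loo i c a -> loo i c b ->
  (forall M, A M -> `|f M| <= N^-1 * (k * (`|dot (a M) (x M i)| * `|dot (b M) (x M i)|))) ->
  mb P (fun M => \1_A M * f M) (2 * k * c ^+ 2 * S).
Proof.
move=> mf c0 k0 la lb hf.
have Nk : 0 <= N^-1 * k by rewrite mulr_ge0 // invr_ge0 ltW.
apply: mb_le (mb_ub _ _ (ubZ Nk (ub_two la lb))).
- apply: (@le_trans _ _ (k * c ^+ 2 * (N^-1 * Num.sqrt D))); first by apply: eq_ler; ring.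
  apply: (@le_trans _ _ (k * c ^+ 2 * (2 * S))); last by lra.
  by rewrite ler_wpM2l ?sqrt_over_N // mulr_ge0 ?sqr_ge0.
- by apply: measurable_funM => //; exact: measurable_indic_all H.
move=> M; have [hM|hM] := pselect (A M); last first.
  by rewrite (indic_bad hM) mul0r normr0 !mulr_ge0 // invr_ge0 ltW.
have hM' : A' i M by exact: good_all_loo.
by rewrite (indic_good hM) (indic_good (B := A' i) hM') !mul1r -mulrA hf.
Qed.

Lemma mb_cs i (c k : R) a b (g f : 'M[R]_(m, d) -> R) : measurable_fun setT f -> 0 <= c -> 0 <= k ->
  loo i c a -> loo i c b -> small i g ->
  (forall M, A M -> `|f M| <=
     N^-1 * (k * (`|g M| * (`|dot (a M) (x M i)| * `|dot (b M) (x M i)|)))) ->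
  mb P (fun M => \1_A M * f M) (200 * L * k * c ^+ 2 * S).
Proof.
move=> mf c0 k0 la lb sg hf.
have Nk : 0 <= N^-1 * k by rewrite mulr_ge0 // invr_ge0 ltW.
apply: mb_le (mb_ub _ _ (ubZ Nk (ub_cs c0 la lb sg))).
- apply: (@le_trans _ _ (100 * L * k * c ^+ 2 * (N^-1 * Num.sqrt D))); first by apply: eq_ler; ring.
  apply: (@le_trans _ _ (100 * L * k * c ^+ 2 * (2 * S))); last by lra.
  by rewrite ler_wpM2l ?sqrt_over_N // !mulr_ge0 ?sqr_ge0.
- by apply: measurable_funM => //; exact: measurable_indic_all H.
move=> M; have [hM|hM] := pselect (A M); last first.
  by rewrite (indic_bad hM) mul0r normr0 !mulr_ge0 // invr_ge0 ltW.
have hM' : A' i M by exact: good_all_loo.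
by rewrite (indic_good hM) (indic_good (B := A' i) hM') !mul1r -mulrA hf.
Qed.

Lemma mb_sumA (F : 'I_m -> 'M[R]_(m, d) -> R) (f : 'M[R]_(m, d) -> R) c :
  (forall i, mb P (fun M => \1_A M * F i M) c) ->
  (forall M, A M -> f M = m%:R^-1 * \sum_i F i M) ->
  mb P (fun M => \1_A M * f M) c.
Proof.
move=> h hf.
have mn0 : (0 < m)%N by rewrite -(@ltr0n R).
apply: eq_mb (mb_mean mn0 h) => M; have [hM|hM] := pselect (A M); last first.
  rewrite (indic_bad hM) mul0r big1 ?mulr0 // => i _.
  by rewrite ?(indic_bad hM) mul0r.
rewrite (indic_good hM) mul1r hf //; congr (_ * _); apply: eq_bigr => i _.
by rewrite ?(indic_good hM) mul1r.
Qed.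

Lemma gam_pos M i : A M -> 1 <= gam U N M i.
Proof.
by move=> hM; apply: (gam_ge1 mq q0 N0 eta1 G1); exact: good_all_loo.
Qed.

Lemma dot_Qloo M i v w : dot v (Qi M i *m w) = dot (Qi M i *m v) w.
Proof. by rewrite dot_sym // Qloo_sym. Qed.

Lemma dot_Qr M v w : dot v (Q M *m w) = dot (Q M *m v) w.
Proof. by rewrite dot_sym // Qr_sym. Qed.

Lemma ratio_le (g t : R) : 1 <= g -> 1 <= t -> `|(t - g) / t| <= `|t - g|.
Proof.
move=> g1 t1; have t0 : 0 < t by exact: lt_le_trans ltr01 t1.
by rewrite normrM normfV (ger0_norm (ltW t0)) ler_pdivrMr // ler_peMr.
Qed.

(** Serves the terms where [gamma_i] enters squared. The difference is [(t - g) (t + g) / (g t^2)],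
    and both [t] and [g] are at most [g t^2]. *)
Lemma ratio2_le (g t : R) : 1 <= g -> 1 <= t -> `|g^-1 - g / t ^+ 2| <= 2 * `|t - g|.
Proof.
move=> g1 t1; have t0 : 0 < t by exact: lt_le_trans ltr01 t1.
have g0 : 0 < g by exact: lt_le_trans ltr01 g1.
have -> : g^-1 - g / t ^+ 2 = (t - g) * ((t + g) / (g * t ^+ 2)).
  by field; rewrite !gt_eqF.
rewrite normrM mulrC ler_wpM2r // ger0_norm; last first.
  by rewrite divr_ge0 ?addr_ge0 ?mulr_ge0 ?sqr_ge0 // ltW.
rewrite ler_pdivrMr ?mulr_gt0 ?exprn_gt0 //.
have h1 : t <= g * t ^+ 2.
  apply: (@le_trans _ _ (1 * (1 * t))); first by rewrite !mul1r.
  by rewrite expr2 ler_pM ?mulr_ge0 ?(ltW t0) // ler_wpM2r // ltW.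
have h2 : g <= g * t ^+ 2 by rewrite ler_peMr ?(ltW g0) // expr2 mulr_ege1.
lra.
Qed.

Lemma mN_ge1 : 1 <= m%:R / N.
Proof. by rewrite ler_pdivlMr // mul1r (model_N H) gerBl. Qed.

Lemma gam_sdev M i : gam U N M i - m%:R / N = N^-1 * sdev M i.
Proof. exact: gam_diff H M i. Qed.

(** * Second moment of the resolvent *)

Section bilinear.
Variables v w : 'cV[R]_d.
Hypotheses (v1 : enorm v <= 1) (w1 : enorm w <= 1).

Let al M i := dot (Qi M i *m v) (x M i).

Lemma loo_Qv i u : enorm u <= 1 -> loo i 3 (fun M => Qi M i *m u).
Proof.
by move=> u1; rewrite -[3]mulr1; apply: (loo_vec_Q H); exact: loo_vec_cst.
Qed.

Lemma measurable_bil (f g : 'M[R]_(m, d) -> 'cV[R]_d) :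
  mmx f -> mmx g -> measurable_fun setT (fun M => dot (f M) (g M)).
Proof. exact: measurable_dot. Qed.

Lemma mmx_Q (f : 'M[R]_(m, d) -> 'cV[R]_d) : mmx f -> mmx (fun M => Q M *m f M).
Proof. by move=> mf; apply: mmxM => //; exact: measurable_Qr. Qed.

Lemma mmx_Qi i (f : 'M[R]_(m, d) -> 'cV[R]_d) : mmx f -> mmx (fun M => Qi M i *m f M).
Proof. by move=> mf; apply: mmxM => //; exact: measurable_Qloo. Qed.

Lemma mmx_C (C : 'M[R]_d) (f : 'M[R]_(m, d) -> 'cV[R]_d) : mmx f -> mmx (fun M => C *m f M).
Proof. by move=> mf; apply: mmxM => //; exact: mmx_cst. Qed.

Lemma resolvent_first :
  mb P (fun M => \1_A M * (dot v (Q M *m w) - dot v w)) (2000 * L * S).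
Proof.
(* Three errors: [Q] against [Qi], the centred form in [x_i], and [gamma_i] against [m / N]. Their
   constants are 18, [36 L] and [1800 L]. *)
pose F i M := (dot v (Q M *m (G *m w)) - dot v (Qi M i *m (G *m w)))
  - (al M i * dot (x M i) w - dot (Qi M i *m v) (G *m w))
  + (gam U N M i - m%:R / N) / gam U N M i * (al M i * dot (x M i) w).
apply: (mb_sumA (F := F)); last first.
  move=> M hM; rewrite (Qr_resid mq q0 eta1 v w hM).
  transitivity (m%:R^-1 * \sum_(i < m) (dot v (Q M *m (G *m w)) -
      m%:R / N * (dot v (Q M *m x M i) * dot (x M i) w))).
    rewrite sumrB sumr_const card_ord -(mulr_natl (dot v (Q M *m (G *m w))) m) -mulr_sumr.
    by field; rewrite !gt_eqF.
  congr (_ * _); apply: eq_bigr => i _; have g1 := gam_pos i hM.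
  rewrite (Qr_smp mq q0 N0 eta1 G1 i hM) dotZr (dot_Qloo M i v (x M i)) /F /al.
  rewrite (dot_Qloo M i v (G *m w)).
  by field; rewrite !gt_eqF //; exact: lt_le_trans ltr01 g1.
move=> i.
have la := loo_Qv i v1.
have lw : loo i 3 (fun=> w) by apply: loo_vec_cst; apply: le_trans w1 _; rewrite ler1n.
have Gw1 : enorm (G *m w) <= 1 by apply: le_trans (oG w) _; rewrite mul1r.
have lG := loo_Qv i Gw1.
have mal : measurable_fun setT (al^~ i) by exact: measurable_loo_dot la.
have mw : measurable_fun setT (fun M => dot (x M i) w).
  by apply: measurable_dot; [exact: measurable_smp|exact: mmx_cst].
have mg := @measurable_gam R n d m U N i.
have h1 : mb P (fun M => \1_A M *
    (dot v (Q M *m (G *m w)) - dot v (Qi M i *m (G *m w)))) (2 * 1 * 3 ^+ 2 * S).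
  apply: (mb_two _ _ _ la lG) => //.
    by apply: measurable_funB; apply: measurable_bil; try exact: mmx_cst;
      [apply: mmx_Q|apply: mmx_Qi]; exact: mmx_cst.
  move=> M hM; have g1 := gam_pos i hM.
  rewrite (Qr_loo mq q0 N0 eta1 G1 i _ hM) dotBr addrAC subrr add0r normrN dotZr.
  rewrite mul1r (dot_Qloo M i v (x M i)) [dot (x M i) _]dotC !normrM -/(al M i) -!mulrA.
  rewrite ger0_norm ?invr_ge0 ?(ltW N0) //; apply: ler_wpM2l; first by rewrite invr_ge0 ltW.
  rewrite mulrA [leRHS]mulrC; apply: ler_wpM2r => //.
  rewrite ler_piMl // normfV invf_le1 ?normr_gt0 ?gt_eqF ?(lt_le_trans ltr01) //.
  by apply: le_trans g1 (ler_norm _).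
have h2 : mb P (fun M => \1_A M *
    (al M i * dot (x M i) w - dot (Qi M i *m v) (G *m w))) (4 * L * (3 * 3) * S).
  exact: (mb_fluct_vec H (ler0n R 3) (ler0n R 3) lw la).
have h3 : mb P (fun M => \1_A M *
    ((gam U N M i - m%:R / N) / gam U N M i * (al M i * dot (x M i) w)))
    (200 * L * 1 * 3 ^+ 2 * S).
  apply: (mb_cs _ _ _ la lw (small_sdev i)) => //.
    apply: measurable_funM; last exact: measurable_funM.
    by apply: measurable_funM; [exact: measurable_funB|exact: measurable_invr].
  move=> M hM; rewrite mul1r !normrM [dot (x M i) w]dotC -/(al M i) [leRHS]mulrA.
  apply: ler_wpM2r; first by rewrite mulr_ge0.
  rewrite -normrM; apply: le_trans (ratio_le mN_ge1 (gam_pos i hM)) _.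
  by rewrite gam_sdev normrM ger0_norm // invr_ge0 ltW.
apply: mb_le (eq_mb _ (mbD (mbD h1 (mbN h2)) h3)).
  rewrite expr2; have := S_ge0; have := mulr_ge0 L0 S_ge0.
  have : S <= L * S by rewrite ler_peMl ?S_ge0.
  lra.
by move=> M; rewrite /F; ring.
Qed.

End bilinear.

End resolvent_means.

(** * Means of [Q^2] and of [Q G Q] *)

Section second_moment_means.
Context {R : realType} {n d m q : nat} {U : 'M[R]_(n, d)} {N eta L : R}
  {dT' : measure_display} {T' : measurableType dT'} {P' : probability T' R}
  {y : T' -> 'cV[R]_d} {P : probability 'M[R]_(m, d) R}.
Hypothesis H : sketch_model q U N eta L P' y P.
Local Notation G := (U^T *m U).
Local Notation D := (\tr G).
Local Notation D2 := (\tr (G *m G)).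
Local Notation x := (@smp R d m).
Local Notation Q := (@Qr R n d m U N).
Local Notation Qi M i := (@Qloo R n d m U N M i).
Local Notation A := [set M : 'M[R]_(m, d) | good_all q U N eta M].
Local Notation loo i := (@loo_vec R n d m q U N eta i).
Local Notation gm M i := (@gam R n d m U N M i).
Local Notation S := (Num.sqrt D / m%:R).
Hypothesis HC : 3840 * L * D <= m%:R.
Implicit Types (i : 'I_m) (M : 'M[R]_(m, d)) (v w : 'cV[R]_d).

Let mq := model_rows H.
Let q0 := model_rows_gt0 H.
Let N0 : 0 < N := model_N_gt0 H.
Let eta1 := model_eta H.
Let G1 := model_gram H.
Let D0 : 0 <= D := model_D_ge0.
Let L0 : 0 <= L := model_L_ge0 H.
Let L1 : 1 <= L := model_L H.
Let m0 : 0 < m%:R :> R := model_m_gt0 H.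
Let sG : G^T = G := G_sym U.
Let oG : opb 1 G := G_opb1 H.
Let S0 : 0 <= S. Proof. exact: S_ge0. Qed.

Lemma GG_sym : (G *m G)^T = G *m G.
Proof. by rewrite trmx_mul sG. Qed.

Lemma loo_factor_le M i : A M -> `|N^-1 / gm M i| <= N^-1.
Proof.
move=> hM; have g1 := gam_pos H i hM; have g0 : 0 < gm M i by exact: lt_le_trans ltr01 g1.
rewrite ger0_norm ?divr_ge0 ?invr_ge0 ?(ltW N0) ?(ltW g0) //.
by rewrite ler_pdivrMr // ler_peMr ?invr_ge0 // ltW.
Qed.

Lemma measurable_loo_factor i : measurable_fun setT (fun M => N^-1 / gm M i).
Proof. by apply: measurable_funM => //; apply: measurable_invr; exact: measurable_gam. Qed.

(** Sherman-Morrison on both sides. The two terms linear in the correction carry one factor [1 / N];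
    in the quadratic term [loo_form_bound] absorbs the second one. The constant is
    [162 + 162 + 729]. *)
Lemma QCQ_diff (C : 'M[R]_d) i v w : C^T = C -> opb 1 C ->
  enorm v <= 1 -> enorm w <= 1 ->
  mb P (fun M => \1_A M * (dot v (Q M *m (C *m (Q M *m w))) -
                          dot v (Qi M i *m (C *m (Qi M i *m w))))) (1053 * S).
Proof.
move=> sC oC v1 w1.
have c39 : (3 : R) <= 9 by rewrite ler_nat.
have lv := loo_Qv H i v1; have lw := loo_Qv H i w1.
have lv9 := loo_vec_le c39 lv; have lw9 := loo_vec_le c39 lw.
have e9 : 3 * 3 = 9 :> R by ring.
have lCv : loo i 9 (fun M => Qi M i *m (C *m (Qi M i *m v))).
  by rewrite -e9; apply: (loo_vec_Q H); exact: loo_vec_C.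
have lCw : loo i 9 (fun M => Qi M i *m (C *m (Qi M i *m w))).
  by rewrite -e9; apply: (loo_vec_Q H); exact: loo_vec_C.
pose k M := N^-1 / gm M i.
pose al M := dot (Qi M i *m v) (x M i).
pose be M := dot (Qi M i *m w) (x M i).
pose ev M := dot (Qi M i *m (C *m (Qi M i *m v))) (x M i).
pose ew M := dot (Qi M i *m (C *m (Qi M i *m w))) (x M i).
pose u M := Qi M i *m x M i.
have mk : measurable_fun setT k by exact: measurable_loo_factor.
have mal : measurable_fun setT al by exact: measurable_loo_dot lv.
have mbe : measurable_fun setT be by exact: measurable_loo_dot lw.
have mev : measurable_fun setT ev by exact: measurable_loo_dot lCv.
have mew : measurable_fun setT ew by exact: measurable_loo_dot lCw.
have mu : mmx u by apply: mmx_Qi; exact: measurable_smp.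
have n9 : 0 <= (9 : R) by [].
have h1 : mb P (fun M => \1_A M * (k M * (be M * ev M))) (2 * 1 * 9 ^+ 2 * S).
  apply: (mb_two H _ n9 ler01 lw9 lCv).
    by apply: measurable_funM => //; exact: measurable_funM.
  move=> M hM; rewrite mul1r normrM [`|be M * _|]normrM.
  apply: ler_wpM2r; first by rewrite mulr_ge0.
  exact: loo_factor_le.
have h2 : mb P (fun M => \1_A M * (k M * (al M * ew M))) (2 * 1 * 9 ^+ 2 * S).
  apply: (mb_two H _ n9 ler01 lv9 lCw).
    by apply: measurable_funM => //; exact: measurable_funM.
  move=> M hM; rewrite mul1r normrM [`|al M * _|]normrM.
  apply: ler_wpM2r; first by rewrite mulr_ge0.
  exact: loo_factor_le.
have h3 : mb P (fun M => \1_A M * (k M * ((k M * dot (u M) (C *m u M)) * (al M * be M))))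
    (2 * (9 / 2) * 9 ^+ 2 * S).
  have n92 : 0 <= (9 / 2 : R) by rewrite divr_ge0.
  apply: (mb_two H _ n9 n92 lv9 lw9).
    apply: measurable_funM => //; apply: measurable_funM; last exact: measurable_funM.
    by apply: measurable_funM => //; apply: measurable_bil => //; exact: mmx_C.
  move=> M hM; rewrite normrM; apply: ler_pM => //; first exact: loo_factor_le.
  rewrite normrM [`|al M * be M|]normrM; apply: ler_wpM2r; first by rewrite mulr_ge0.
  by have := loo_form_bound H i ler01 hM oC; rewrite mulr1.
apply: mb_le (eq_mb _ (mbD (mbD (mbN h1) (mbN h2)) h3)).
  rewrite expr2; lra.
move=> M; have [hM|hM] := pselect (A M); last first.
  by rewrite (indic_bad hM) !mul0r oppr0 !addr0.
rewrite (indic_good hM) !mul1r.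
rewrite (dot_Qr M v) (dot_Qloo M i v) (Qr_loo mq q0 N0 eta1 G1 i v hM).
rewrite (Qr_loo mq q0 N0 eta1 G1 i w hM) -/(u M) -/(k M).
rewrite [dot (x M i) (Qi M i *m v)]dotC [dot (x M i) (Qi M i *m w)]dotC -/(al M) -/(be M).
rewrite mulmxBr -scalemxAr !(dotBl, dotBr, dotZl, dotZr).
have -> : dot (Qi M i *m v) (C *m u M) = ev M.
  by rewrite dot_sym // /u dot_Qloo.
have -> : dot (u M) (C *m (Qi M i *m w)) = ew M.
  by rewrite dotC /u dot_Qloo.
ring.
Qed.

(** [Qr_resid] at [Q w], where row [i] enters with weight [g / gamma_i^2], close to [1 / g = N / m].
    What remains of [Q G Q] has coefficient [1 - N / m = D / m]. *)
Lemma resolvent_second v w : enorm v <= 1 -> enorm w <= 1 ->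
  mb P (fun M => \1_A M * (dot v (Q M *m (Q M *m w)) - dot v (Q M *m w) -
     D / m%:R * dot v (Q M *m (G *m (Q M *m w))))) (5000 * L * S).
Proof.
move=> v1 w1.
pose al M i := dot (Qi M i *m v) (x M i).
pose be M i := dot (Qi M i *m w) (x M i).
pose g := m%:R / N.
have g1 : 1 <= g := mN_ge1 H.
have g0 : 0 < g by exact: lt_le_trans ltr01 g1.
have gi0 : 0 <= g^-1 by rewrite invr_ge0 ltW.
have gi1 : g^-1 <= 1 by rewrite invf_le1.
pose F i M := g^-1 * (dot v (Q M *m (G *m (Q M *m w))) - dot v (Qi M i *m (G *m (Qi M i *m w))))
  - g^-1 * (al M i * dot (x M i) (Qi M i *m w) - dot (Qi M i *m v) (G *m (Qi M i *m w)))
  + (g^-1 - g / gm M i ^+ 2) * (al M i * be M i).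
apply: (mb_sumA H (F := F)); last first.
  move=> M hM; rewrite (Qr_resid mq q0 eta1 v (Q M *m w) hM).
  transitivity (m%:R^-1 * \sum_(i < m) (g^-1 * dot v (Q M *m (G *m (Q M *m w))) -
      g * (dot v (Q M *m x M i) * dot (x M i) (Q M *m w)))).
    rewrite sumrB sumr_const card_ord -(mulr_natl (g^-1 * _) m) -mulr_sumr.
    have -> : D = m%:R - N by rewrite (model_N H); ring.
    by rewrite /g; field; rewrite !gt_eqF.
  congr (_ * _); apply: eq_bigr => i _; have t1 := gam_pos H i hM.
  rewrite (dot_Qr M (x M i)) (Qr_smp mq q0 N0 eta1 G1 i hM) dotZr dotZl.
  rewrite (dot_Qloo M i v (x M i)) [dot (Qi M i *m x M i) w]dotC (dot_Qloo M i w (x M i)).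
  rewrite /F /al /be (dot_Qloo M i v (G *m _)) [dot (x M i) (Qi M i *m w)]dotC.
  by field; rewrite !gt_eqF //; exact: lt_le_trans ltr01 t1.
move=> i.
have la := loo_Qv H i v1; have lw := loo_Qv H i w1.
have mal : measurable_fun setT (al^~ i) by exact: measurable_loo_dot la.
have mbe : measurable_fun setT (be^~ i) by exact: measurable_loo_dot lw.
have mg := @measurable_gam R n d m U N i.
have n3 : 0 <= (3 : R) by [].
have n2 : 0 <= (2 : R) by [].
have h1 := mbZ g^-1 (QCQ_diff i sG oG v1 w1).
have h2 := mbZ g^-1 (mb_fluct_vec H n3 n3 lw la).
have h3 : mb P (fun M => \1_A M * ((g^-1 - g / gm M i ^+ 2) * (al M i * be M i)))
    (200 * L * 2 * 3 ^+ 2 * S).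
  apply: (mb_cs H _ n3 n2 la lw (small_sdev H HC i)).
    apply: measurable_funM; last exact: measurable_funM.
    apply: measurable_funB => //; apply: measurable_funM => //.
    by apply: measurable_invr; exact: measurable_funX.
  move=> M hM; rewrite normrM [`|al M i * _|]normrM.
  rewrite [leRHS](_ : _ = 2 * (N^-1 * `|@sdev R n d m U N M i|) * (`|al M i| * `|be M i|)); last first.
    by rewrite /al /be; ring.
  apply: ler_wpM2r; first by rewrite mulr_ge0.
  apply: le_trans (ratio2_le g1 (gam_pos H i hM)) _; rewrite ler_pM2l //.
  by rewrite (gam_sdev H) normrM ger0_norm // invr_ge0 ltW.
rewrite (ger0_norm gi0) in h1 h2.
apply: mb_le (eq_mb _ (mbD (mbD h1 (mbN h2)) h3)).
  have k1 : g^-1 * S <= S by rewrite ler_piMl.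
  have k2 : g^-1 * (L * S) <= L * S by rewrite ler_piMl ?mulr_ge0.
  have := S0; have := mulr_ge0 L0 S0; have : S <= L * S by rewrite ler_peMl.
  move: k1 k2; rewrite expr2; move: (g^-1) S => gi s; lra.
by move=> M; rewrite /F /al; ring.
Qed.

(** Crude, but its factor [N] cancels against the extra [1 / N] that accompanies the form in
    [resolvent_gram]. *)
Lemma pform_le M i : A M -> `|@pform R n d m U N M i| <= 3 / 2 * N.
Proof.
move=> hM; have hM' := @good_all_loo _ _ _ _ _ _ _ _ _ i hM.
have o3 : opb 3 (Qi M i *m G).
  by rewrite -[3]mulr1; apply: opbM => //; exact: (Qi_opb H).
have := opb_dot (x M i) (x M i) o3; rewrite -mulrA -expr2 sqr_enorm.
have := smp_bound mq q0 N0 eta1 G1 i hM; rewrite /pform; lra.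
Qed.

(** [Qr_resid] at [G Q v]. Sherman-Morrison in [x_i^T G Q v] gives a leading term, which cancels
    [Q G^2 Q], and a correction containing [pform / N]; replacing that form by [D2] makes the
    correction [(D2 / m) Q G Q]. *)
Lemma resolvent_gram v w : enorm v <= 1 -> enorm w <= 1 ->
  mb P (fun M => \1_A M * ((1 - D2 / m%:R) * dot w (Q M *m (G *m (Q M *m v))) -
     dot w (G *m (Q M *m v)))) (12000 * L * S).
Proof.
move=> v1 w1.
pose al M i := dot (Qi M i *m v) (x M i).
pose be M i := dot (Qi M i *m w) (x M i).
pose ep M i := dot (G *m (Qi M i *m v)) (x M i).
pose p M i := @pform R n d m U N M i.
pose g := m%:R / N.
have g1 : 1 <= g := mN_ge1 H.
have g0 : 0 < g by exact: lt_le_trans ltr01 g1.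
pose r := D2 / m%:R.
have r0 : 0 <= r by rewrite divr_ge0 ?D2_ge0 // ltW.
have r1 : r <= 1.
  rewrite ler_pdivrMr // mul1r; apply: le_trans (D2_le H) _.
  by have := model_deff H; have := D0; lra.
(* The first three terms compare [Q G^2 Q] with the leading term, the next two replace the weight
   and [pform] in the correction, and the last two bring it back to [(D2 / m) Q G Q]. *)
pose F i M :=
  (dot w (Q M *m ((G *m G) *m (Q M *m v))) - dot w (Qi M i *m ((G *m G) *m (Qi M i *m v))))
  - (dot (Qi M i *m w) (x M i) * dot (x M i) (G *m (Qi M i *m v))
      - dot (Qi M i *m w) (G *m (G *m (Qi M i *m v))))
  + (gm M i - g) / gm M i * (be M i * ep M i)
  - N^-1 * ((g^-1 - g / gm M i ^+ 2) * p M i * (al M i * be M i))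
  + m%:R^-1 * ((p M i - D2) * (al M i * be M i))
  + r * (dot (Qi M i *m w) (x M i) * dot (x M i) (Qi M i *m v)
      - dot (Qi M i *m w) (G *m (Qi M i *m v)))
  - r * (dot w (Q M *m (G *m (Q M *m v))) - dot w (Qi M i *m (G *m (Qi M i *m v)))).
apply: (mb_sumA H (F := F)); last first.
  move=> M hM.
  have e := Qr_resid mq q0 eta1 w (G *m (Q M *m v)) hM.
  transitivity (m%:R^-1 * \sum_(i < m) (dot w (Q M *m (G *m (G *m (Q M *m v)))) -
      r * dot w (Q M *m (G *m (Q M *m v))) -
      g * (dot w (Q M *m x M i) * dot (x M i) (G *m (Q M *m v))))).
    rewrite sumrB sumr_const card_ord -(mulr_natl (_ - r * _) m) -mulr_sumr.
    rewrite mulrBl mul1r addrAC e /r /g.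
    by field; rewrite !gt_eqF.
  congr (_ * _); apply: eq_bigr => i _; have t1 := gam_pos H i hM.
  rewrite (Qr_smp mq q0 N0 eta1 G1 i hM) dotZr (dot_Qloo M i w (x M i)).
  rewrite [dot (x M i) (G *m (Q M *m v))]dot_sym // -/(be M i).
  have -> : dot (G *m x M i) (Q M *m v) = ep M i - N^-1 / gm M i * al M i * p M i.
    rewrite (Qr_loo mq q0 N0 eta1 G1 i v hM).
    rewrite dotBr dotZr [dot (x M i) (Qi M i *m v)]dotC -/(al M i).
    have -> : dot (G *m x M i) (Qi M i *m v) = ep M i.
      by rewrite -dot_sym // dotC.
    suff -> : dot (G *m x M i) (Qi M i *m x M i) = p M i by [].
    by rewrite dot_Qloo mulmxA dotC.
  rewrite /F -!(mulmxA G G) -/(be M i) [dot (x M i) (G *m (Qi M i *m v))]dotC -/(ep M i).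
  rewrite [dot (x M i) (Qi M i *m v)]dotC -/(al M i).
  rewrite (dot_Qloo M i w (G *m (G *m (Qi M i *m v)))) (dot_Qloo M i w (G *m (Qi M i *m v))).
  rewrite /r (_ : m%:R = g * N); last by rewrite /g divfK // gt_eqF.
  by field; rewrite !gt_eqF //; exact: lt_le_trans ltr01 t1.
move=> i.
have la := loo_Qv H i v1; have lw := loo_Qv H i w1.
have lG := loo_vec_C oG la.
have mal : measurable_fun setT (al^~ i) by exact: measurable_loo_dot la.
have mbe : measurable_fun setT (be^~ i) by exact: measurable_loo_dot lw.
have mep : measurable_fun setT (ep^~ i) by exact: measurable_loo_dot lG.
have mg := @measurable_gam R n d m U N i.
have n3 : 0 <= (3 : R) by [].
have [mp2 _] := small_pform H HC i.
have mp : measurable_fun setT (p^~ i).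
  have -> : (p^~ i) = (fun M => (@pform R n d m U N M i - D2) + D2).
    by apply/funext => M; rewrite subrK.
  exact: measurable_funD.
have Ni : 0 <= N^-1 by rewrite invr_ge0 ltW.
have h1 := QCQ_diff i GG_sym (GG_opb H) w1 v1.
have h2 := mb_fluct_vec H n3 n3 lG lw.
have h3 : mb P (fun M => \1_A M * ((gm M i - g) / gm M i * (be M i * ep M i)))
    (200 * L * 1 * 3 ^+ 2 * S).
  apply: (mb_cs H _ n3 ler01 lw lG (small_sdev H HC i)).
    apply: measurable_funM; last exact: measurable_funM.
    by apply: measurable_funM; [exact: measurable_funB|exact: measurable_invr].
  move=> M hM; rewrite mul1r normrM [`|be M i * _|]normrM [leRHS]mulrA.
  apply: ler_wpM2r; first by rewrite mulr_ge0.
  apply: le_trans (ratio_le g1 (gam_pos H i hM)) _.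
  by rewrite (gam_sdev H) normrM ger0_norm.
have h4 : mb P (fun M => \1_A M * (N^-1 * ((g^-1 - g / gm M i ^+ 2) * p M i * (al M i * be M i))))
    (200 * L * 3 * 3 ^+ 2 * S).
  apply: (mb_cs H _ n3 n3 la lw (small_sdev H HC i)).
    apply: measurable_funM => //; apply: measurable_funM; last exact: measurable_funM.
    apply: measurable_funM => //.
    apply: measurable_funB => //; apply: measurable_funM => //.
    by apply: measurable_invr; exact: measurable_funX.
  move=> M hM; rewrite normrM (ger0_norm Ni); apply: ler_wpM2l => //.
  rewrite normrM [`|al M i * _|]normrM [leRHS]mulrA.
  apply: ler_wpM2r; first by rewrite mulr_ge0.
  have := ratio2_le g1 (gam_pos H i hM); rewrite (gam_sdev H) normrM (ger0_norm Ni) => k1.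
  rewrite normrM.
  apply: (@le_trans _ _ (2 * (N^-1 * `|@sdev R n d m U N M i|) * (3 / 2 * N))).
    by apply: ler_pM => //; exact: pform_le.
  by apply: eq_ler; field; rewrite gt_eqF.
have h5 : mb P (fun M => \1_A M * (m%:R^-1 * ((p M i - D2) * (al M i * be M i))))
    (200 * L * 1 * 3 ^+ 2 * S).
  apply: (mb_cs H _ n3 ler01 la lw (small_pform H HC i)).
    apply: measurable_funM => //; apply: measurable_funM; last exact: measurable_funM.
    exact: measurable_funB.
  move=> M hM; rewrite mul1r normrM ger0_norm ?invr_ge0 ?(ltW m0) //.
  rewrite normrM [`|al M i * _|]normrM; apply: ler_wpM2r; first by rewrite !mulr_ge0.
  rewrite lef_pV2 ?posrE // (model_N H) gerBl; exact: D0.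
have h6 := mbZ r (mb_fluct_vec H n3 n3 la lw).
have h7 := mbZ r (QCQ_diff i sG oG w1 v1).
rewrite (ger0_norm r0) in h6 h7.
have hs := mbD (mbD (mbD (mbD (mbD (mbD h1 (mbN h2)) h3) (mbN h4)) h5) h6) (mbN h7).
apply: mb_le (eq_mb _ hs).
  have k1 : r * S <= S by rewrite ler_piMl.
  have k2 : r * (L * S) <= L * S by rewrite ler_piMl ?mulr_ge0.
  have := S0; have := mulr_ge0 L0 S0; have : S <= L * S by rewrite ler_peMl.
  rewrite expr2; lra.
by move=> M; rewrite /F; ring.
Qed.

Lemma resolvent_square v w : enorm v <= 1 -> enorm w <= 1 ->
  mb P (fun M => \1_A M * (dot v (Q M *m (Q M *m w)) - dot v w -
     D / (m%:R - D2) * dot v (G *m w))) (21000 * L * S).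
Proof.
move=> v1 w1.
have Gv1 : enorm (G *m v) <= 1 by apply: le_trans (oG v) _; rewrite mul1r.
have hmD : D2 <= m%:R - D.
  by apply: le_trans (D2_le H) _; have := model_deff H; lra.
have p0 : 0 < m%:R - D2 by have := D2_le H; have := model_N H; move: N0; lra.
(* Chosen so that [c (1 - D2 / m) = D / m]: adding [c] times [resolvent_gram] eliminates [Q G Q],
   and the remaining [G Q] is close to [G] by [resolvent_first]. *)
pose c := D / (m%:R - D2).
have c0 : 0 <= c by rewrite divr_ge0 // ltW.
have c1 : c <= 1 by rewrite ler_pdivrMr // mul1r; move: hmD; lra.
have h1 := resolvent_second v1 w1.
have h2 := resolvent_first H HC v1 w1.
have h3 := mbZ c (resolvent_gram w1 v1).
have h4 := mbZ c (resolvent_first H HC Gv1 w1).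
rewrite (ger0_norm c0) in h3 h4.
apply: mb_le (eq_mb _ (mbD (mbD (mbD h1 h2) h3) h4)).
  have LS0 := mulr_ge0 L0 S0.
  have k1 : c * (L * S) <= L * S by rewrite ler_piMl.
  lra.
move=> M; rewrite (dot_sym v (Q M *m w) sG) (dot_sym v w sG) /c.
by field; rewrite !gt_eqF.
Qed.

End second_moment_means.

Lemma interpolation (F : fieldType) (s : seq F) (f : F -> F) : uniq s ->
  exists p : {poly F}, forall a, a \in s -> p.[a] = f a.
Proof.
elim: s => [_|a s IH /= /andP[as' us]]; first by exists 0.
have [p hp] := IH us; pose w := \prod_(b <- s) ('X - b%:P).
have wa : w.[a] != 0 by rewrite -/(root w a) root_prod_XsubC.
exists (p + ((f a - p.[a]) / w.[a])%:P * w) => b; rewrite inE !hornerE.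
case/predU1P => [->|bs]; first by rewrite divfK // addrC subrK.
have /eqP -> : root w b by rewrite root_prod_XsubC.
by rewrite mulr0 addr0 hp.
Qed.

Lemma trmx_horner (R : comNzRingType) d (M : 'M[R]_d.+1) (p : {poly R}) :
  (horner_mx M p)^T = horner_mx M^T p.
Proof.
elim/poly_ind: p => [|p c IH]; first by rewrite !rmorph0 trmx0.
rewrite !rmorphD !rmorphM /= !horner_mx_X !horner_mx_C linearD /= tr_scalar_mx.
congr (_ + _); rewrite -[in RHS]IH -!mulmxE trmx_mul.
have := comm_horner_mx2 M p 'X; rewrite horner_mx_X /GRing.comm -!mulmxE => /(congr1 trmx).
by rewrite !trmx_mul.
Qed.

(** * Reduction to normalized coordinates *)

Section psd_root.
Variable R : realType.

Local Notation C := (complex R).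
Local Notation rc := (real_complex R).

Lemma psd_eigenvalue_ge0 d (M : 'M[R]_d) a : psd M -> eigenvalue M a -> 0 <= a.
Proof.
move=> [_ h] /eigenvalueP[v vM v0].
have := h v^T; rewrite trmxK vM -scalemxAl mxE -{1}(trmxK v) -/(dot v^T v^T).
have vp : 0 < dot v^T v^T.
  rewrite lt_neqAle dot_ge0 andbT eq_sym; apply: contra v0 => /eqP /dot_eq0.
  by move/(congr1 trmx); rewrite trmxK trmx0 => ->.
by rewrite pmulr_lge0.
Qed.

(* The spectral theorem over [R[i]] turns an interpolation polynomial of the
   fourth root on the spectrum into a real symmetric fourth root. *)
Lemma psd_sqrt_exists d (M : 'M[R]_d) : psd M -> exists X : 'M[R]_d, psd X /\ X *m X = M.
Proof.
case: d M => [|d] M pM.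
  exists 0; split; last by apply/matrixP => -[].
  by split=> [|x]; [apply/matrixP => -[]|rewrite mulmx0 mul0mx mxE].
have [sM _] := pM.
pose Mc : 'M[C]_d.+1 := map_mx rc M.
have hMc : Mc \is hermsymmx.
  apply: realsym_hermsym.
    apply/is_hermitianmxP; rewrite expr0 scale1r; apply/matrixP => i j.
    by rewrite !mxE -{1}sM mxE.
  by apply/mxOverP => i j; rewrite mxE complex_real.
have /hermitian_normalmx/orthomx_spectralP := hMc.
have uP := spectral_unit Mc; have /mxOverP rsp := hermitian_spectral_diag_real hMc.
move: (spectralmx Mc) (spectral_diag Mc) uP rsp => Pm sp uP rsp eM.
have McE : map_mx rc M = Mc by [].
clearbody Mc.
pose lam i : R := complex.Re (sp 0 i).
have lamE i : sp 0 i = rc (lam i) by rewrite /lam RRe_real.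
have lam0 i : 0 <= lam i.
  apply: (psd_eigenvalue_ge0 pM); rewrite eigenvalue_root_char.
  suff : eigenvalue Mc (sp 0 i).
    by rewrite eigenvalue_root_char lamE -McE -map_char_poly fmorph_root.
  apply/eigenvalueP; exists (row i Pm).
    by rewrite {1}eM -row_mul !mulmxA mulmxV // mul1mx row_mul row_diag_mx -scalemxAl -rowE.
  apply/eqP => /(congr1 (mulmx^~ (invmx Pm))); rewrite mul0mx -row_mul mulmxV //.
  by move/rowP/(_ i); rewrite !mxE eqxx => /eqP; rewrite oner_eq0.
(* With a symmetric fourth root [Y], the square root [Y Y = Y^T Y] is positive semidefinite with no
   look at its spectrum. Duplicates are removed since interpolation needs distinct nodes. *)
have [p hp] := interpolation (fun a => Num.sqrt (Num.sqrt a))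
  (undup_uniq [seq lam i | i <- enum 'I_d.+1]).
have hpl i : p.[lam i] ^+ 4 = lam i.
  rewrite hp; last by rewrite mem_undup map_f // mem_enum.
  rewrite -[4%N]/(2 * 2)%N exprM sqr_sqrtr ?sqrtr_ge0 // sqr_sqrtr //.
pose Y := horner_mx M p.
have sY : Y^T = Y by rewrite /Y trmx_horner sM.
have Y4 : Y *m Y *m (Y *m Y) = M.
  have -> : Y *m Y *m (Y *m Y) = horner_mx M (p ^+ 4).
    by rewrite rmorphXn /= !exprS expr0 mulr1 -!mulmxE !mulmxA.
  apply: (map_mx_inj (f := rc)); rewrite McE.
  transitivity (horner_mx Mc (map_poly rc (p ^+ 4))).
    by rewrite -McE; exact: map_horner_mx.
  rewrite eM.
  rewrite (horner_mx_uconjC _ _ uP).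
  rewrite (horner_mx_diag sp).
  suff -> : map_mx (horner (map_poly rc (p ^+ 4))) sp = sp by [].
  by apply/rowP => i; rewrite mxE lamE horner_map /= horner_exp hpl.
exists (Y *m Y); split=> //; split.
  by rewrite trmx_mul sY.
by move=> x; rewrite mulmxA -{1}sY -trmx_mul -mulmxA -/(dot _ _) dot_ge0.
Qed.

Lemma mxsqrtP d (M : 'M[R]_d) : psd M -> psd (mxsqrt M) /\ mxsqrt M *m mxsqrt M = M.
Proof.
move=> /psd_sqrt_exists[X hX]; rewrite /mxsqrt.
by apply: (@xgetPex _ 0 [set X | psd X /\ X *m X = M]); exists X.
Qed.

End psd_root.

Section normalization.
Context {R : realType} {n d : nat} (A : 'M[R]_(n, d)) (C0 : 'M[R]_d).
Hypotheses (pC0 : psd C0) (uH : Hmx A C0 \in unitmx).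
Local Notation H := (Hmx A C0).
Local Notation Rt := (mxsqrt H).
Local Notation U := (Umx A C0).
Local Notation G := (U^T *m U).

Lemma psd_Hmx : psd H.
Proof.
have [s0 h0] := pC0; split; first by rewrite /Hmx linearD /= trmx_mul trmxK s0.
move=> x; rewrite -mulmxA -/(dot x _) /Hmx mulmxDl dotDr addr_ge0 //.
  by rewrite gram_dot dot_ge0.
by have := h0 x; rewrite -mulmxA.
Qed.

Lemma Rt_sym : Rt^T = Rt.
Proof. by have [[]] := mxsqrtP psd_Hmx. Qed.

Lemma Rt_sqr : Rt *m Rt = H.
Proof. by have [] := mxsqrtP psd_Hmx. Qed.

Lemma Rt_unit : Rt \in unitmx.
Proof. by have e := uH; rewrite -Rt_sqr unitmx_mul in e; case/andP: e. Qed.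

Lemma Umx_Rt : U *m Rt = A.
Proof. by rewrite /Umx mulmxKV // Rt_unit. Qed.

Lemma C0_normalized : C0 = Rt *m (1%:M - G) *m Rt.
Proof.
rewrite mulmxBr mulmx1 mulmxBl Rt_sqr.
have -> : Rt *m G *m Rt = A^T *m A.
  transitivity ((U *m Rt)^T *m (U *m Rt)); last by rewrite Umx_Rt.
  by rewrite (trmx_mul U Rt) Rt_sym !mulmxA.
by rewrite /Hmx addrC addKr.
Qed.

(** [I - G] is [C0] conjugated by the inverse of [Rt], hence positive semidefinite. *)
Lemma Umx_gram_le v : dot v (G *m v) <= dot v v.
Proof.
have [_ h0] := pC0; pose w := invmx Rt *m v.
have wE : Rt *m w = v by rewrite /w mulKVmx // Rt_unit.
have := h0 w; rewrite -mulmxA -/(dot w _) [X in dot w (X *m w)]C0_normalized -!mulmxA.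
rewrite dot_sym ?Rt_sym // wE mulmxBl mul1mx dotBr subr_ge0.
by rewrite !mulmxA.
Qed.

Section resolvent.
Variables (m : nat) (S : 'M[R]_(m, n)).
Local Notation W := (U^T *m S^T *m S *m U + (1%:M - G)).

Lemma sketched_normalized : sketched_Hmx A C0 S = Rt *m W *m Rt.
Proof.
rewrite mulmxDr mulmxDl -C0_normalized /sketched_Hmx; congr (_ + _).
transitivity ((U *m Rt)^T *m S^T *m S *m (U *m Rt)); first by rewrite Umx_Rt.
by rewrite (trmx_mul U Rt) Rt_sym !mulmxA.
Qed.

Lemma sketched_unit : W \in unitmx -> sketched_Hmx A C0 S \in unitmx.
Proof. by move=> uW; rewrite sketched_normalized !unitmx_mul Rt_unit uW. Qed.

Lemma Qmx_normalized : W \in unitmx -> Qmx A C0 S = invmx W.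
Proof.
move=> uW; have uS := sketched_unit uW.
have e : Rt *m (W *m Qmx A C0 S) = Rt.
  rewrite /Qmx -(mulmxA Rt (invmx _) Rt) !(mulmxA W) (mulmxA Rt) (mulmxA Rt W Rt).
  by rewrite -sketched_normalized mulKVmx.
rewrite -[LHS](mulKmx uW) -(mulKmx Rt_unit (W *m Qmx A C0 S)) e.
by rewrite (mulVmx Rt_unit) mulmx1.
Qed.

End resolvent.

End normalization.

(** * Rows of the sketch in normalized coordinates *)

Section rows.
Variable R : realType.

Lemma sum_row_outer m d (M : 'M[R]_(m, d)) (p : pred 'I_m) :
  \sum_(k | p k) (row k M)^T *m row k M = \matrix_(i, j) \sum_(k | p k) M k i * M k j.
Proof.
apply/matrixP => i j; rewrite summxE mxE; apply: eq_bigr => k _.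
by rewrite mxE big_ord1 !mxE.
Qed.

Lemma gram_rows m d (M : 'M[R]_(m, d)) : M^T *m M = \sum_k (row k M)^T *m row k M.
Proof.
by rewrite sum_row_outer; apply/matrixP => i j; rewrite !mxE; apply: eq_bigr => k _; rewrite mxE.
Qed.

(** The factor [sqrt N] undoes the scaling of the rows of the sketch, so that row [k] becomes
    [s_k^T U]. *)
Definition coords m n d (N : R) (U : 'M[R]_(n, d)) (S : 'M[R]_(m, n)) : 'M[R]_(m, d) :=
  Num.sqrt N *: (S *m U).

Lemma smp_coords_outer m n d (N : R) (U : 'M[R]_(n, d)) (S : 'M[R]_(m, n)) k : 0 < N ->
  smp (coords N U S) k *m (smp (coords N U S) k)^T =
  N *: ((row k (S *m U))^T *m row k (S *m U)).
Proof.
move=> N0; rewrite /smp trmxK /coords.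
have -> : row k (Num.sqrt N *: (S *m U)) = Num.sqrt N *: row k (S *m U).
  by apply/rowP => l; rewrite !mxE.
rewrite (_ : (Num.sqrt N *: _)^T = Num.sqrt N *: (row k (S *m U))^T); last first.
  by apply/colP => l; rewrite !mxE.
by rewrite -scalemxAl -scalemxAr scalerA -expr2 sqr_sqrtr // ltW.
Qed.

Lemma Wmx_coords m n d (N : R) (U : 'M[R]_(n, d)) (S : 'M[R]_(m, n)) : 0 < N ->
  Wmx U N (coords N U S) = U^T *m S^T *m S *m U + (1%:M - U^T *m U).
Proof.
move=> N0; rewrite /Wmx; congr (_ + _).
under eq_bigr do rewrite smp_coords_outer //.
by rewrite -scaler_sumr scalerA mulVf ?gt_eqF // scale1r -gram_rows trmx_mul !mulmxA.
Qed.

Lemma third_coords m n d (N : R) (U : 'M[R]_(n, d)) (S : 'M[R]_(m, n)) :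
  0 < N -> (0 < m %/ 3)%N ->
  third (m %/ 3) N (coords N U S) 0 =
  (let St := Num.sqrt 3 *: first_third S in U^T *m St^T *m St *m U).
Proof.
move=> N0 q0 /=; rewrite /third.
under eq_bigr do rewrite smp_coords_outer //.
rewrite -scaler_sumr scalerA divfK ?gt_eqF //.
set F := first_third S.
have -> : U^T *m (Num.sqrt 3 *: F)^T *m (Num.sqrt 3 *: F) *m U = 3 *: ((F *m U)^T *m (F *m U)).
  have -> : (Num.sqrt 3 *: F)^T = Num.sqrt 3 *: F^T by apply/matrixP => i j; rewrite !mxE.
  rewrite !(=^~ scalemxAl, =^~ scalemxAr) scalerA -expr2 sqr_sqrtr //.
  by rewrite trmx_mul !mulmxA.
congr (_ *: _); rewrite gram_rows.
rewrite (eq_bigl (fun k : 'I_m => (k < m %/ 3)%N)); last first.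
  by move=> k; rewrite -leqn0 -ltnS ltn_divLR // mul1n.
rewrite (big_ord_narrow (leq_div m 3)); apply: eq_bigr => k _.
have -> // : row (widen_ord (leq_div m 3) k) (S *m U) = row k (F *m U).
rewrite !row_mul; congr (_ *m _); apply/rowP => l; rewrite !mxE //.
Qed.

Lemma coords_repl m n d (N : R) (U : 'M[R]_(n, d)) (S : 'M[R]_(m, n)) i (s : 'cV[R]_n) :
  0 < N ->
  coords N U (repl i ((Num.sqrt N)^-1 *: s^T) S) = repl i (U^T *m s)^T (coords N U S).
Proof.
move=> N0; apply/row_matrixP => k; rewrite row_repl /coords linearZ /= row_mul row_repl.
rewrite [in RHS]linearZ /= [in RHS]row_mul; case: eqP => _ //.
rewrite -scalemxAl scalerA divff ?scale1r ?gt_eqF ?sqrtr_gt0 //.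
by rewrite trmx_mul trmxK.
Qed.

Definition swap_fun m q (mq : m = (3 * q)%N) (j : 'I_3) (i : 'I_m) : nat :=
  if (i %/ q)%N == 0%N then (i + j * q)%N
  else if (i %/ q)%N == j then (i - j * q)%N else i.

(** [swap_fun] exchanges block 0 with block [j] and fixes the rest; it is an involution, hence a
    permutation, and the identity for [j = 0]. *)
Lemma swap_block m q (mq : m = (3 * q)%N) (q0 : (0 < q)%N) (j : 'I_3) :
  exists s : 'S_m, forall i, ((s i %/ q)%N == 0%N) = ((i %/ q)%N == j).
Proof.
have lt i : (swap_fun mq j i < m)%N.
  rewrite /swap_fun; case: ifP => [/eqP h|_]; last first.
    by case: ifP => _; rewrite ?(leq_ltn_trans (leq_subr _ _)).
  have : (i < q)%N by rewrite -[q]mul1n -ltn_divLR // h.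
  move=> h1; apply: (@leq_trans (q + j * q)); first by rewrite ltn_add2r.
  by rewrite -mulSn [leqRHS]mq leq_mul2r ltn_ord orbT.
pose f i := Ordinal (lt i).
have val_f i : (f i : nat) = swap_fun mq j i by [].
have blk i : (f i %/ q)%N = if (i %/ q)%N == 0%N then j : nat
   else if (i %/ q)%N == j then 0%N else (i %/ q)%N.
  rewrite val_f /swap_fun; case: ifP => [/eqP h|_].
    by rewrite addnC divnMDl // h addn0.
  case: ifP => [/eqP h|//].
  by rewrite divnBMl // h subnn.
have ff : involutive f.
  move=> i; apply: val_inj => /=; rewrite {1}/swap_fun blk val_f /swap_fun.
  case: (eqVneq (i %/ q)%N 0%N) => [h0|h0].
    case: (eqVneq (j : nat) 0%N) => [j0|j0]; first by rewrite j0 mul0n !addn0.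
    by rewrite eqxx addnK.
  case: (eqVneq (i %/ q)%N j) => [hj|hj] /=.
    by rewrite subnK // -hj leq_divM.
  by rewrite (negPf h0) (negPf hj).
exists (perm (inv_inj ff)) => i; rewrite permE blk.
case: (eqVneq (i %/ q)%N 0%N) => [h0|h0]; first by rewrite h0 eq_sym.
by case: (eqVneq (i %/ q)%N j) => [hj|hj]; rewrite ?eqxx ?(negPf h0).
Qed.

Lemma third_perm m d q (N : R) (X : 'M[R]_(m, d)) (s : 'S_m) (j : nat) :
  (forall i, ((s i %/ q)%N == 0%N) = ((i %/ q)%N == j)) ->
  third q N (row_perm s^-1 X) 0 = third q N X j.
Proof.
move=> hs; rewrite /third (reindex_inj (@perm_inj _ s)) /=; congr (_ *: _).
apply: eq_big => [i|i _]; first exact: hs.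
have -> // : smp (row_perm s^-1 X) (s i) = smp X i.
by apply/colP => l; rewrite !mxE permK.
Qed.

End rows.

(** * Means of bilinear forms and moments of one projected row *)

Section integral_sums.
Context {R : realType} {dT : measure_display} {T : measurableType dT}
  {P : probability T R} {E : set T}.
Hypothesis mE : measurable E.

Lemma mean_sum (I : Type) (r : seq I) (F : I -> T -> R) :
  (forall p, P.-integrable E (EFin \o F p)) ->
  P.-integrable E (EFin \o (fun w => \sum_(p <- r) F p w)) /\
  \int[P]_(w in E) (\sum_(p <- r) F p w) = \sum_(p <- r) \int[P]_(w in E) F p w.
Proof.
move=> Fi; elim: r => [|p r [IH1 IH2]].
  split; first by under eq_fun do rewrite big_nil; exact: integrable0.
  by under eq_Rintegral do rewrite big_nil; rewrite big_nil Rintegral_cst // mul0r.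
split.
  under eq_fun do rewrite big_cons.
  by have := integrableD mE (Fi p) IH1; apply: eq_integrable.
under eq_Rintegral do rewrite big_cons.
by rewrite RintegralD // IH2 big_cons.
Qed.

Lemma mean_bilinear p q (X : T -> 'M[R]_(p, q)) v w :
  (forall i j, P.-integrable E (EFin \o (fun t => X t i j))) ->
  P.-integrable E (EFin \o (fun t => dot v (X t *m w))) /\
  \int[P]_(t in E) dot v (X t *m w) =
  \sum_i \sum_j v i 0 * w j 0 * \int[P]_(t in E) X t i j.
Proof.
move=> hX.
pose F (k : 'I_p * 'I_q) t := v k.1 0 * w k.2 0 * X t k.1 k.2.
have FE t : dot v (X t *m w) = \sum_k F k t.
  rewrite dotE -(pair_bigA _ (fun a b => F (a, b) t)) /=.
  apply: eq_bigr => a _; rewrite mxE mulr_sumr; apply: eq_bigr => b _.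
  by rewrite /F /=; ring.
have Fi k : P.-integrable E (EFin \o F k).
  by have := integrableZl mE (v k.1 0 * w k.2 0) (hX k.1 k.2); apply: eq_integrable.
have [h1 h2] := mean_sum (index_enum _) Fi.
split; first by under eq_fun do rewrite FE.
under eq_Rintegral do rewrite FE.
rewrite h2 -(pair_bigA _ (fun a b => \int[P]_(t in E) F (a, b) t)) /=.
by apply: eq_bigr => a _; apply: eq_bigr => b _; rewrite RintegralZl.
Qed.

End integral_sums.

Lemma probability_setC_le {R : realType} {dT : measure_display} {T : measurableType dT}
    (P : probability T R) (X : set T) (e : R) : measurable X ->
  ((1 - e)%:E <= P X)%E = (P (~` X) <= e%:E)%E.
Proof.
move=> mX; rewrite probability_setC //; rewrite -(fineK (fin_num_measure P _ mX)) -EFinB !lee_fin.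
by apply/idP/idP; lra.
Qed.

Lemma integral_indic_preimage {R : realType} {dT : measure_display} {T : measurableType dT}
    (P : probability T R) (V : Type) (f : T -> V) (B : set V) :
  measurable [set w | B (f w)] -> (\int[P]_w (\1_B (f w) : R)%:E = P [set w | B (f w)])%E.
Proof.
move=> mB; have := integral_indic P measurableT mB; rewrite setIT => <-.
by apply: eq_integral.
Qed.

Section vector_moments.
Context {R : realType} {n d : nat} {dT' : measure_display} {T' : measurableType dT'}
  {P' : probability T' R}.
Variables (U : 'M[R]_(n, d)) (s : {RV P' >-> 'cV[R]_n}).
Hypothesis cov : forall i j, ('E_P'[fun w => (s w *m (s w)^T) i j])%E =
               ((1%:M : 'M[R]_n) i j)%:E.
Local Notation G := (U^T *m U).

Let ms : mmx s. Proof. apply/measurable_mmx; exact: measurable_funP. Qed.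

Lemma cov_mean i j :
  (\int[P']_w (s w i 0 * s w j 0)%:E)%E = ((1%:M : 'M[R]_n) i j)%:E.
Proof.
rewrite -cov unlock; apply: eq_integral => w _.
by rewrite mxE big_ord1 mxE.
Qed.

(** The covariance assumption only gives values of integrals. For squares, a finite value of a
    nonnegative integral is integrability; [|a b| <= a^2 + b^2] does the rest. *)
Lemma cov_integrable i j : P'.-integrable setT (EFin \o (fun w => s w i 0 * s w j 0)).
Proof.
have sq k : P'.-integrable setT (EFin \o (fun w => s w k 0 * s w k 0)).
  apply: (@ub_integrable _ _ _ P' _ 1); split.
  - exact: measurable_funM.
  - by move=> w; rewrite -expr2 sqr_ge0.
  by rewrite cov_mean mxE eqxx.
have := integrableD measurableT (sq i) (sq j); apply: le_integrable => //.
  by apply/measurable_EFinP; exact: measurable_funM.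
move=> w _ /=; rewrite lee_fin.
rewrite [leRHS]ger0_norm; last by rewrite addr_ge0 // -expr2 sqr_ge0.
move: (s w i 0) (s w j 0) => a b; rewrite ler_norml.
have := sqr_ge0 (a + b); have := sqr_ge0 (a - b); rewrite !expr2.
have := sqr_ge0 a; have := sqr_ge0 b; rewrite !expr2.
by move=> h1 h2 h3 h4; apply/andP; split; lra.
Qed.

Definition proj w := U^T *m s w.

Lemma measurable_proj : mmx proj.
Proof. by apply: mmxM => //; exact: mmx_cst. Qed.

Lemma projE a w : proj w a 0 = dot (col a U) (s w).
Proof. by rewrite dotE mxE; apply: eq_bigr => k _; rewrite !mxE. Qed.

Lemma proj_moments a b : P'.-integrable setT (EFin \o (fun w => proj w a 0 * proj w b 0)) /\
  \int[P']_w (proj w a 0 * proj w b 0) = G a b.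
Proof.
have e w : proj w a 0 * proj w b 0 = dot (col a U) (s w *m (s w)^T *m col b U).
  by rewrite !projE mul_outer dotZr mulrC (dotC (s w)).
have hX i j : P'.-integrable setT (EFin \o (fun w => (s w *m (s w)^T) i j)).
  have := cov_integrable i j; apply: eq_integrable => // w _ /=.
  by rewrite mxE big_ord1 mxE.
have [h1 h2] := mean_bilinear measurableT (col a U) (col b U) hX.
split; first by under eq_fun do rewrite e.
under eq_Rintegral do rewrite e.
rewrite h2 mxE; apply: eq_bigr => i _; rewrite (bigD1 i) //= big1 => [|j ji].
  rewrite /Rintegral; under eq_integral do rewrite mxE big_ord1 mxE.
  by rewrite cov_mean !mxE eqxx /= mulr1 addr0.
rewrite /Rintegral; under eq_integral do rewrite mxE big_ord1 mxE.
by rewrite cov_mean !mxE eq_sym (negPf ji) mulr0.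
Qed.

Lemma proj_variance alpha L : alpha <= L -> 0 <= L ->
  (forall B : 'M[R]_d, psd B ->
   (variance P' (fun w => ((s w)^T *m U *m B *m U^T *m s w) ord0 ord0) <=
    (alpha * \tr (U *m (B *m B) *m U^T))%:E)%E) ->
  forall B : 'M[R]_d, psd B ->
  ub P' (fun w => (dot (proj w) (B *m proj w) - \tr (B *m G)) ^+ 2)
       (L * \tr (B *m B *m G)).
Proof.
move=> aL L0 hv B pB.
have e w : ((s w)^T *m U *m B *m U^T *m s w) ord0 ord0 = dot (proj w) (B *m proj w).
  by rewrite /dot /proj trmx_mul trmxK !mulmxA.
(* Nonnegativity allows [alpha], of any sign, to be replaced by the larger [L]. *)
have t0 : 0 <= \tr (B *m B *m G).
  rewrite trace_gram; apply: sumr_ge0 => k _; rewrite -mulmxA dot_mul.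
  by have [-> _] := pB; exact: dot_ge0.
have [q1 q2] := quad_mean (fun a b => (proj_moments a b).1) (fun a b => (proj_moments a b).2) B.
have := hv B pB; under [X in variance _ X]eq_fun do rewrite e.
rewrite /variance covariance.unlock expectation.unlock.
have -> : fine (\int[P']_w (dot (proj w) (B *m proj w))%:E)%E = \tr (B *m G) by rewrite -q2.
have -> : \tr (U *m (B *m B) *m U^T) = \tr (B *m B *m G).
  by rewrite -!mulmxA mxtrace_mulC !mulmxA.
move=> h; split.
- apply: measurable_funX; apply: measurable_funB => //.
  exact: measurable_quad measurable_proj _.
- by move=> w; exact: sqr_ge0.
apply: (@le_trans _ _ (alpha * \tr (B *m B *m G))%:E); last first.
  by rewrite lee_fin ler_wpM2r.
apply: le_trans h; rewrite le_eqVlt; apply/orP; left; apply/eqP.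
by apply: eq_integral => w _ /=; rewrite expr2.
Qed.

End vector_moments.

(** * The sketch as an instance of the model *)

Section sketch_law.
Context {R : realType} {n d m : nat} {dT dT' : measure_display}
  {T : measurableType dT} {T' : measurableType dT'}
  {P : probability T R} {P' : probability T' R}.
Variables (A : 'M[R]_(n, d)) (C0 : 'M[R]_d) (S : {RV P >-> 'M[R]_(m, n)})
  (s : {RV P' >-> 'cV[R]_n}) (eta delta alpha alpha0 : R).
Local Notation U := (Umx A C0).
Local Notation G := (U^T *m U).
Local Notation D := (\tr G).
Local Notation q := (m %/ 3)%N.
Local Notation L := (alpha0 + 1).
Local Notation N := (m%:R - D).
Hypotheses (halpha0 : 0 < alpha0) (pC0 : psd C0) (uH : Hmx A C0 \in unitmx)
  (m0 : (0 < m)%N) (m3 : (3 %| m)%N)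
  (hC : 3840 * L * D <= m%:R) (hD : D < m%:R).
Hypothesis cov : forall i j, ('E_P'[fun w => (s w *m (s w)^T) i j])%E =
               ((1%:M : 'M[R]_n) i j)%:E.
Hypothesis iid : iid_rows P P' S (fun w => (Num.sqrt N)^-1 *: (s w)^T).
Hypotheses (heta : eta <= 1 / 2) (hdelta : delta <= 1 / m%:R ^+ 3).
Hypothesis hgood : ((1 - delta / 3)%:E <=
    P [set w | (let St := Num.sqrt 3 *: first_third (S w) in
               specnorm (U^T *m St^T *m St *m U - U^T *m U) <= eta)%R])%E.
Hypotheses (halpha : alpha <= alpha0)
  (hvar : forall B : 'M[R]_d, psd B ->
   (variance P' (fun w => ((s w)^T *m U *m B *m U^T *m s w) ord0 ord0) <=
    (alpha * \tr (U *m (B *m B) *m U^T))%:E)%E).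

Let D0 : 0 <= D. Proof. exact: trace_gram_ge0. Qed.
Let N0 : 0 < N. Proof. by rewrite subr_gt0. Qed.
Let mS : mmx S. Proof. apply/measurable_mmx; exact: measurable_funP. Qed.
Let ms : mmx s. Proof. apply/measurable_mmx; exact: measurable_funP. Qed.
Let mq : m = (3 * q)%N. Proof. by rewrite mulnC divnK. Qed.
Let q0 : (0 < q)%N. Proof. by rewrite divn_gt0 // dvdn_leq. Qed.

Definition xcoords w := coords N U (S w).

Lemma measurable_coords k : mmx (fun M : 'M[R]_(k, n) => coords N U M).
Proof.
by apply: mmxZ => //; apply: mmxM; [exact: mmx_id|exact: mmx_cst].
Qed.

Lemma measurable_xcoords : measurable_fun setT xcoords.
Proof.
apply/measurable_mmx; apply: mmxZ => //; apply: mmxM => //; exact: mmx_cst.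
Qed.

HB.instance Definition _ := isMeasurableFun.Build _ _ _ _ xcoords measurable_xcoords.

Definition xlaw : probability 'M[R]_(m, d) R := distribution P xcoords.

Lemma integral_xlaw (f : 'M[R]_(m, d) -> \bar R) :
  measurable_fun setT f -> (forall M, (0 <= f M)%E) ->
  (\int[xlaw]_M f M = \int[P]_w f (xcoords w))%E.
Proof. by move=> mf f0; rewrite ge0_integral_distribution. Qed.

Lemma xlaw_resample i (f : 'M[R]_(m, d) -> \bar R) :
  measurable_fun setT f -> (forall M, (0 <= f M)%E) ->
  (\int[xlaw]_M f M = \int[xlaw]_M \int[P']_w f (repl i (proj U s w)^T M))%E.
Proof.
move=> mf f0; rewrite integral_xlaw //.
have mv : mmx (fun w => (Num.sqrt N)^-1 *: (s w)^T).
  by apply: mmxZ => //; exact: mmx_tr.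
have mfc : measurable_fun setT (fun M : 'M[R]_(m, n) => f (coords N U M)).
  by apply: (measurableT_comp mf); apply/measurable_mmx; exact: measurable_coords.
rewrite (resampling mS mv iid i mfc); last by move=> M; exact: f0.
rewrite integral_xlaw.
- apply: eq_integral => w _; apply: eq_integral => w' _.
  by rewrite coords_repl.
- have mr : measurable_fun setT (fun p : 'M[R]_(m, d) * T' => repl i (proj U s p.2)^T p.1).
    apply/measurable_mmx => k l; under eq_fun do rewrite mxE; case: eqP => _.
      under eq_fun do rewrite mxE.
      exact: (measurableT_comp (measurable_proj U s l 0) measurable_snd).
    exact: (measurableT_comp (@mmx_id R m d k l) measurable_fst).
  have mfr : measurable_fun setT (fun p : 'M[R]_(m, d) * T' => f (repl i (proj U s p.2)^T p.1)).
    exact: (measurableT_comp mf mr).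
  by have := @measurable_fun_fubini_tonelli_F _ _ _ _ R P' _ mfr (fun p => f0 _).
by move=> M; apply: integral_ge0.
Qed.

Lemma specnorm_eta_ge0 p k (M : 'M[R]_(p, k)) : specnorm M <= eta -> 0 <= eta.
Proof. by apply: le_trans; exact: specnorm_ge0. Qed.

Lemma delta_lt1 : delta < 1.
Proof.
apply: le_lt_trans hdelta _; rewrite ltr_pdivrMr ?exprn_gt0 ?ltr0n // mul1r.
by rewrite exprn_egt1 // ltr1n; move: q0; rewrite divn_gt0 //; apply: leq_trans.
Qed.

(** For [eta < 0] the event of the hypothesis would be empty, whereas its probability is at least
    [1 - delta / 3 > 0]. *)
Lemma eta_ge0 : 0 <= eta.
Proof.
rewrite leNgt; apply/negP => e0; move: hgood.
rewrite (_ : [set w | _] = set0) ?measure0; last first.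
  apply/seteqP; split => w //= h.
  by have := specnorm_eta_ge0 h; rewrite leNgt e0.
rewrite lee_fin; have := delta_lt1; lra.
Qed.

Lemma good0_prob : ((1 - delta / 3)%:E <= P [set w | good q U N eta (xcoords w) 0])%E.
Proof.
apply: le_trans hgood _; rewrite le_eqVlt; apply/orP; left; apply/eqP; congr (P _).
apply/seteqP; split=> w /=; rewrite /good /xcoords third_coords // => h.
  by apply/specnormP; [exact: eta_ge0|exact: h].
by move/specnormP: h; apply; exact: eta_ge0.
Qed.

Lemma measurable_good_set p (f : 'M[R]_(p, n) -> 'M[R]_(m, d)) j : mmx f ->
  measurable [set M | good q U N eta (f M) j].
Proof.
move=> mf; apply: measurable_opb; first exact: eta_ge0.
apply: mmxB; last exact: mmx_cst.
apply: mmxZ => //; apply: mmx_sum => k; apply: mmxM.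
  by apply: mmx_tr; exact: mmx_row.
by apply: mmx_tr; apply: mmx_tr; exact: mmx_row.
Qed.

(** The assumption speaks of the first third only; a permutation exchanging two thirds leaves the
    law of [S] unchanged. *)
Lemma good_prob (j : 'I_3) : ((1 - delta / 3)%:E <= P [set w | good q U N eta (xcoords w) j])%E.
Proof.
have [t ht] := swap_block mq q0 j.
apply: le_trans good0_prob _; rewrite le_eqVlt; apply/orP; left; apply/eqP.
have [B [BE mB]] : exists B : set 'M[R]_(m, n),
    (forall M, B M = good q U N eta (coords N U M) 0) /\ measurable B.
  exists [set M : 'M[R]_(m, n) | good q U N eta (coords N U M) 0]; split=> //.
  by apply: measurable_good_set; exact: measurable_coords.
have mi : measurable_fun setT (fun M => (\1_B M : R)%:E).
  by apply/measurable_EFinP; exact: measurable_indic.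
have mBS : measurable [set w | B (S w)].
  have /measurable_mmx h := mS; by have := h measurableT B mB; rewrite setTI.
have mBp : measurable [set w | B (row_perm (t^-1)%g (S w))].
  have h : mmx (fun w => row_perm (t^-1)%g (S w)).
    by move=> k l; under eq_fun do rewrite mxE; exact: mS.
  move/measurable_mmx : h => h; by have := h measurableT B mB; rewrite setTI.
have B0 M : (0 <= (\1_B M : R)%:E)%E by rewrite lee_fin indicE ler0n.
have coordsP w : coords N U (row_perm (t^-1)%g (S w)) = row_perm (t^-1)%g (xcoords w).
  by apply/matrixP => a b; rewrite !mxE; congr (_ * _); apply: eq_bigr => c _; rewrite mxE.
have e0 : [set w | good q U N eta (xcoords w) 0] = [set w | B (S w)].
  by apply/funext => w; rewrite /mkset BE.
have ej : [set w | good q U N eta (xcoords w) j] = [set w | B (row_perm (t^-1)%g (S w))].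
  by apply/funext => w; rewrite /mkset BE coordsP /good (third_perm N (xcoords w) ht).
rewrite [LHS](congr1 P e0) [RHS](congr1 P ej).
rewrite -(integral_indic_preimage P mBS) -(iid_perm mS iid (t^-1)%g mi B0).
exact: integral_indic_preimage.
Qed.

Definition event := [set w | good_all q U N eta (xcoords w)].

Lemma measurable_good_x j : measurable [set w | good q U N eta (xcoords w) j].
Proof.
have h : measurable [set M : 'M[R]_(m, n) | good q U N eta (coords N U M) j].
  by apply: measurable_good_set; exact: measurable_coords.
by have /measurable_mmx k := mS; have := k measurableT _ h; rewrite setTI.
Qed.

Lemma eventE : event = \bigcap_(j in [set: 'I_3]) [set w | good q U N eta (xcoords w) j].
Proof. by apply/seteqP; split=> w h j; [move=> _; exact: h|exact: (h j I)]. Qed.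

Lemma measurable_event : measurable event.
Proof.
rewrite eventE; apply: fin_bigcap_measurable; first exact: finite_finset.
by move=> j _; exact: measurable_good_x.
Qed.

Lemma event_compl : (P (~` event) <= delta%:E)%E.
Proof.
pose F (j : 'I_3) := ~` [set w | good q U N eta (xcoords w) j].
have mF j : measurable (F j) by apply: measurableC; exact: measurable_good_x.
have sub : ~` event `<=` F ord0 `|` F (inord 1) `|` F (inord 2).
  move=> w /= h; apply: contrapT => /not_orP[/not_orP[/contrapT h0 /contrapT h1] /contrapT h2].
  apply: h => j.
  have : j = ord0 \/ j = inord 1 \/ j = inord 2.
    case: j => [[|[|[|//]]] lj]; [left|right; left|right; right];
      by apply: val_inj; rewrite /= ?inordK.
  by case=> [->|[->|->]].
have PF j : (P (F j) <= (delta / 3)%:E)%E.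
  rewrite -probability_setC_le; first exact: good_prob.
  exact: measurable_good_x.
apply: (@le_trans _ _ (P (F ord0 `|` F (inord 1) `|` F (inord 2)))).
  apply: le_measure; rewrite ?inE //; first exact/measurableC/measurable_event.
  by apply: measurableU => //; exact: measurableU.
have mF2 := measurableU _ _ (mF ord0) (mF (inord 1)).
apply: (@le_trans _ _ (P (F ord0) + P (F (inord 1)) + P (F (inord 2)))%E).
  apply: (le_trans (measureU2 P mF2 (mF (inord 2)))).
  by rewrite leeD2r //; exact: (measureU2 P (mF _) (mF _)).
apply: (@le_trans _ _ ((delta / 3)%:E + (delta / 3)%:E + (delta / 3)%:E)%E).
  by rewrite !leeD.
by rewrite -!EFinD lee_fin; lra.
Qed.

Lemma event_prob : ((1 - delta)%:E <= P event)%E.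
Proof.
rewrite probability_setC_le; first exact: event_compl.
exact: measurable_event.
Qed.

Lemma xlaw_model : sketch_model q U N eta L P' (proj U s) xlaw.
Proof.
(* [L = alpha0 + 1] dominates both [alpha] and 1. *)
have L1 : 1 <= L by rewrite lerDr ltW.
split=> //.
- have : 3840 * D <= m%:R.
    by have := mulr_ge0 (ltW halpha0) D0; have := hC; lra.
  by move: D0; lra.
- exact: eta_ge0.
- exact: Umx_gram_le.
- exact: measurable_proj.
- by move=> a b; have [] := proj_moments U cov a b.
- by move=> a b; have [] := proj_moments U cov a b.
- apply: (proj_variance cov (alpha := alpha)) => //.
    by apply: le_trans halpha _; rewrite lerDl.
  exact: le_trans ler01 L1.
- exact: xlaw_resample.
have -> : xlaw (~` [set M : 'M[R]_(m, d) | good_all q U N eta M]) = P (~` event) by [].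
by apply: (le_trans event_compl); rewrite lee_fin -[leRHS]mul1r.
Qed.

(** Conditioning on the event thus at most doubles a bound on an unnormalized integral; this is the
    factor 2 in the final constant. *)
Lemma event_half : 1 / 2 <= fine (P event).
Proof.
have := event_prob; rewrite -[P event]fineK; last first.
  by apply: fin_num_measure; exact: measurable_event.
rewrite lee_fin; apply: le_trans.
have : delta <= 1 / 2.
  apply: le_trans hdelta _; rewrite ler_pdivrMr ?exprn_gt0 ?ltr0n //.
  have h2 : 2 <= m%:R :> R by rewrite ler_nat; move: q0; rewrite divn_gt0 //; apply: leq_trans.
  have : 2 ^+ 3 <= m%:R ^+ 3 :> R by rewrite ler_pXn2r ?nnegrE.
  by rewrite !exprS !expr0; lra.
lra.
Qed.

Lemma mb_event (f : 'M[R]_(m, d) -> R) c : measurable_fun setT f ->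
  mb xlaw (fun M => \1_[set M : 'M[R]_(m, d) | good_all q U N eta M] M * f M) c ->
  P.-integrable event (EFin \o (fun w => f (xcoords w))) /\
  `|\int[P]_(w in event) f (xcoords w)| <= c.
Proof.
set B := [set M : 'M[R]_(m, d) | _]; move=> mf [hi hc].
have mg : measurable_fun setT (fun M => \1_B M * f M).
  by apply: measurable_funM => //; exact: measurable_indic_all xlaw_model.
have hi' : P.-integrable setT (EFin \o (fun w => \1_B (xcoords w) * f (xcoords w))).
  move/integrableP: hi => [_ hi]; apply/integrableP; split.
    by apply/measurable_EFinP; exact: (measurableT_comp mg measurable_xcoords).
  rewrite integral_xlaw in hi => //.
  by apply: measurableT_comp => //; exact/measurable_EFinP.
have E : (fun w => f (xcoords w)) \_ event =
   (fun w => \1_B (xcoords w) * f (xcoords w)).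
  apply/funext => w; rewrite patchE.
  have [h|h] := pselect (event w).
    by rewrite mem_set // indicE mem_set // mul1r.
  by rewrite memNset // indicE memNset // mul0r.
split.
  apply/(integrable_mkcond _ measurable_event); rewrite restrict_EFin E.
  exact: hi'.
rewrite Rintegral_mkcond E; move: hc; rewrite /Rintegral.
by rewrite (integral_distribution (X := xcoords)) //; exact/measurable_EFinP.
Qed.

Lemma Wmx_event w : Wmx U N (xcoords w) =
   U^T *m (S w)^T *m S w *m U + (1%:M - U^T *m U).
Proof. exact: Wmx_coords. Qed.

Lemma event_unit w : event w -> sketched_Hmx A C0 (S w) \in unitmx.
Proof.
move=> hw; apply: sketched_unit => //; rewrite -Wmx_event.
exact: (Wmx_unit mq q0 heta hw).
Qed.

Lemma event_Qmx w : event w -> Qmx A C0 (S w) = Qr U N (xcoords w).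
Proof.
move=> hw; rewrite /Qr Wmx_event; apply: Qmx_normalized => //; rewrite -Wmx_event.
exact: (Wmx_unit mq q0 heta hw).
Qed.

(** [Q - I = - Q (W - I)], where [Q] has norm at most 2 and [W - I] norm at most [eta]. *)
Lemma event_norm w : event w -> specnorm (Qmx A C0 (S w) - 1%:M) <= 2 * eta.
Proof.
move=> hw; rewrite event_Qmx //; have e0 := eta_ge0; apply: specnorm_le.
  by rewrite mulr_ge0.
have uW := Wmx_unit mq q0 heta hw.
have -> : Qr U N (xcoords w) - 1%:M = - (Qr U N (xcoords w) *m (Wmx U N (xcoords w) - 1%:M)).
  by rewrite mulmxBr mulmx1 /Qr mulVmx // opprB.
apply/opbN/opbM => //.
  exact: (@Qr_opb _ _ _ _ _ _ _ _ mq q0 heta _ hw).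
exact: (@good_opb _ _ _ _ _ _ _ _ mq q0 _ hw).
Qed.

(** A bilinear form commutes with the conditional mean, so pairs of unit vectors control the
    spectral norm; coordinate vectors give the integrability of each entry. *)
Lemma cond_expmx_bound (X : T -> 'M[R]_d) (f : 'M[R]_(m, d) -> 'M[R]_d) (C : 'M[R]_d) c :
  mmx f -> (forall w, event w -> X w = f (xcoords w)) ->
  (forall v w, enorm v <= 1 -> enorm w <= 1 ->
     mb xlaw (fun M => \1_[set M : 'M[R]_(m, d) | good_all q U N eta M] M *
       (dot v (f M *m w) - dot v (C *m w))) c) ->
  integrable_mx P event X /\ specnorm (cond_expmx P event X - C) <= 2 * c.
Proof.
move=> mf hX hb; have mE := measurable_event.
have mbil v w : measurable_fun setT (fun M => dot v (f M *m w) - dot v (C *m w)).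
  apply: measurable_funB => //; apply: measurable_dot; first exact: mmx_cst.
  by apply: mmxM => //; exact: mmx_cst.
have e1 k : enorm (delta_mx k 0 : 'cV[R]_d) <= 1.
  rewrite enormE dotE (bigD1 k) //= big1 ?mxE ?eqxx ?mulr1 ?addr0 ?sqrtr1 // => j ji.
  by rewrite mxE (negPf ji) /= mulr0.
have icst (a : R) : P.-integrable event (EFin \o (fun=> a)).
  by apply: finite_measure_integrable_cst.
have iX : integrable_mx P event X.
  move=> i j; have [h _] := mb_event (mbil _ _) (hb _ _ (e1 i) (e1 j)).
  have := integrableD mE h (icst (dot (delta_mx i 0) (C *m delta_mx j 0))).
  apply: eq_integrable => // w; rewrite inE => hw /=.
  rewrite -EFinD subrK hX // /dot trmx_delta -rowE -colE !mxE //.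
split=> //.
have z1 : enorm (0 : 'cV[R]_d) <= 1 by rewrite enorm0.
have c0 : 0 <= c := mb_ge0 (hb 0 0 z1 z1).
apply: specnorm_le; first by rewrite mulr_ge0.
apply: dot_opb; first by rewrite mulr_ge0.
move=> v w v1 w1.
have [_ hm] := mb_event (mbil v w) (hb v w (eq_ler v1) (eq_ler w1)).
have p2 := event_half.
have p0 : 0 < fine (P event) by apply: lt_le_trans p2; lra.
have [i1 i2] := mean_bilinear mE v w iX.
have -> : dot v ((cond_expmx P event X - C) *m w) =
   (\int[P]_(t in event) (dot v (f (xcoords t) *m w) - dot v (C *m w))) / fine (P event).
  have -> : \int[P]_(t in event) (dot v (f (xcoords t) *m w) - dot v (C *m w)) =
     \int[P]_(t in event) (dot v (X t *m w) - dot v (C *m w)).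
    by apply: eq_Rintegral => t; rewrite inE => ht; rewrite hX.
  rewrite RintegralB // Rintegral_cst // i2 mulmxBl dotBr mulrBl mulfK ?gt_eqF //.
  congr (_ - _); rewrite dotE mulr_suml; apply: eq_bigr => i _.
  rewrite mxE mulr_sumr mulr_suml; apply: eq_bigr => j _.
  by rewrite mxE; ring.
rewrite normrM normfV (gtr0_norm p0) ler_pdivrMr //; apply: le_trans hm _.
have : c * (1 / 2) <= c * fine (P event) by rewrite ler_wpM2l.
lra.
Qed.

Lemma sketched_resolvent_moments :
  integrable_mx P event (fun w => Qmx A C0 (S w)) /\
  integrable_mx P event (fun w => Qmx A C0 (S w) *m Qmx A C0 (S w)) /\
  specnorm (cond_expmx P event (fun w => Qmx A C0 (S w)) - 1%:M) <=
    2 * (21000 * L) * (Num.sqrt D / m%:R) /\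
  specnorm (cond_expmx P event (fun w => Qmx A C0 (S w) *m Qmx A C0 (S w)) -
     (1%:M + (D / (m%:R - \tr (G *m G))) *: G)) <= 2 * (21000 * L) * (Num.sqrt D / m%:R).
Proof.
have M := xlaw_model.
have mQ := @measurable_Qr R n d m U N.
have [k1 k2] : integrable_mx P event (fun w => Qmx A C0 (S w)) /\
   specnorm (cond_expmx P event (fun w => Qmx A C0 (S w)) - 1%:M) <=
   2 * (2000 * L * (Num.sqrt D / m%:R)).
  apply: (cond_expmx_bound mQ event_Qmx) => v w v1 w1.
  by have := resolvent_first M hC v1 w1; rewrite mul1mx.
have [k3 k4] : integrable_mx P event (fun w => Qmx A C0 (S w) *m Qmx A C0 (S w)) /\
   specnorm (cond_expmx P event (fun w => Qmx A C0 (S w) *m Qmx A C0 (S w)) -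
     (1%:M + (D / (m%:R - \tr (G *m G))) *: G)) <=
   2 * (21000 * L * (Num.sqrt D / m%:R)).
  apply: (cond_expmx_bound (mmxM mQ mQ)) => [w hw|v w v1 w1]; first by rewrite event_Qmx.
  have := resolvent_square M hC v1 w1; apply: eq_mb => X.
  rewrite mulmxDl mul1mx dotDr -scalemxAl dotZr mulmxA; ring.
do 3 split=> //.
  apply: le_trans k2 _.
  have : 0 <= L * (Num.sqrt D / m%:R).
    by rewrite mulr_ge0 ?divr_ge0 ?sqrtr_ge0 // addr_ge0 // ltW.
  lra.
apply: le_trans k4 _; lra.
Qed.

End sketch_law.

Theorem theorem6 (R : realType) (alpha0 : R) (halpha0 : 0 < alpha0) :
  exists C K : R, 0 < C /\ 0 < K /\
  forall (n d : nat) (A : 'M[R]_(n, d)) (C0 : 'M[R]_d),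
  psd C0 -> Hmx A C0 \in unitmx ->
  forall m : nat, (0 < m)%N -> (3 %| m)%N ->
  C * deff A C0 <= m%:R -> deff A C0 < m%:R ->
  forall (dT dT' : measure_display)
    (T : measurableType dT) (T' : measurableType dT')
    (P : probability T R) (P' : probability T' R)
    (S : {RV P >-> 'M[R]_(m, n)}) (s : {RV P' >-> 'cV[R]_n}),
  (forall i j, ('E_P'[fun w => (s w *m (s w)^T) i j])%E =
               ((1%:M : 'M[R]_n) i j)%:E) ->
  iid_rows P P' S
    (fun w => (Num.sqrt (m%:R - deff A C0))^-1 *: (s w)^T) ->
  forall eta delta : R,
  eta <= 1 / 2 -> delta <= 1 / m%:R ^+ 3 ->
  (let U := Umx A C0 in
   ((1 - delta / 3)%:E <=
    P [set w | let St := Num.sqrt 3 *: first_third (S w) in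
               specnorm (U^T *m St^T *m St *m U - U^T *m U) <= eta]%R)%E) ->
  (exists2 alpha : R, alpha <= alpha0 &
   let U := Umx A C0 in
   forall B : 'M[R]_d, psd B ->
   (variance P' (fun w => ((s w)^T *m U *m B *m U^T *m s w) ord0 ord0) <=
    (alpha * \tr (U *m (B *m B) *m U^T))%:E)%E) ->
  exists E : set T,
    measurable E /\
    ((1 - delta)%:E <= P E)%E /\
    (forall w, E w -> sketched_Hmx A C0 (S w) \in unitmx /\
                      specnorm (Qmx A C0 (S w) - 1%:M) <= K * eta) /\
    let Q := fun w => Qmx A C0 (S w) in
    let Q2 := fun w => Q w *m Q w in
    let U := Umx A C0 in
    integrable_mx P E Q /\ integrable_mx P E Q2 /\
    specnorm (cond_expmx P E Q - 1%:M) <= K * (Num.sqrt (deff A C0) / m%:R) /\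
    specnorm (cond_expmx P E Q2 -
              (1%:M + (deff A C0 / (m%:R - deff2 A C0)) *: (U^T *m U)))
      <= K * (Num.sqrt (deff A C0) / m%:R).
Proof.
have L0 : 0 < alpha0 + 1 by rewrite addr_gt0.
(* The first constant is that of [D_over_N] with [L = alpha0 + 1]. The second is twice that of
   [resolvent_square], and exceeds the 2 of [event_norm]. *)
exists (3840 * (alpha0 + 1)), (2 * (21000 * (alpha0 + 1))).
split; first exact: mulr_gt0 (ltr0Sn _ _) L0.
split; first exact: mulr_gt0 (ltr0Sn _ _) (mulr_gt0 (ltr0Sn _ _) L0).
move=> n d A C0 pC0 uH m m0 m3 hC hD dT dT' T T' P P' S s cov iid eta delta heta hdelta
  hgood [alpha halpha hvar].
exists (event A C0 S eta); split; first exact: (measurable_event m0 m3 hdelta hgood).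
split; first exact: (event_prob m0 m3 hD iid hdelta hgood).
split.
  move=> w hw; split; first exact: (event_unit pC0 uH m0 m3 hD heta hw).
  apply: (le_trans (event_norm pC0 uH m0 m3 hD heta hdelta hgood hw)).
  apply: ler_wpM2r; first exact: (eta_ge0 m0 m3 hdelta hgood).
  by move: (ltW halpha0); lra.
exact: (sketched_resolvent_moments halpha0 pC0 uH m0 m3 hC hD cov iid heta hdelta
  hgood halpha hvar).
Qed.
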